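(* Consider the multi-response regression model $$Y_k^{(i)}=\sum_{j=1}^p\sum_{\ell=1}^m X^{(i)}_{\ell j}T_{k\ell j}+\epsilon^{(i)}_k,\qquad 1\le i\le n,\ 1\le k\le m,$$ with $\epsilon^{(i)}_k$ i.i.d. $\mathcal N(0,\sigma^2)$, independent of the covariates, and $X^{(1)},\dots,X^{(n)}\in\mathbb{R}^{m\times p}$ independent centered Gaussian with $\mathrm{Cov}(\mathrm{vec}(X^{(i)}))=\widetilde\Sigma\in\mathbb{R}^{mp\times mp}$ satisfying $c_\ell^2\le\lambda_{\min}(\widetilde\Sigma)\le\lambda_{\max}(\widetilde\Sigma)\le c_u^2$, where $0<c_\ell\le c_u<\infty$ are constants. Let $$\mathcal{T}_1=\Big\{A\in\mathbb{R}^{m\times m\times p}:\ \sum_{j=1}^p\mathbb{I}(\|A_{\cdot\cdot j}\|_{\rm F}\ne0)\le s\Big\}$$ and suppose $T\in\mathcal{T}_1$. Let $\widehat T$ be a minimizer over $A\in\mathbb{R}^{m\times m\times p}$ of $$\frac1{2n}\sum_{i=1}^n\|Y^{(i)}-\langle A,X^{(i)}\rangle\|_{\ell_2}^2+\lambda\sum_{j=1}^p\|A_{\cdot\cdot j}\|_{\rm F}.$$ If $$\lambda\ge3\sigma c_u\sqrt{\frac{\max\{m^2,\log p\}}{n}}$$ is such that $\sqrt s\,\lambda$ converges to zero as $n$ increases, then there exist constants $c_1,c_2>0$ such that, with probability at least $1-p^{-c_1}$, $$\max\left\{\|\widehat T-T\|_n^2,\ \|\widehat T-T\|_{\rm F}^2\right\}\le\frac{c_2c_u^2}{c_\ell^2}\,s\lambda^2$$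 when $n$ is sufficiently large. In addition, there is a constant $c_3>0$ such that $$\min_{\widetilde T}\max_{T\in\mathcal{T}_1}\|\widetilde T-T\|_{\rm F}^2\ge\frac{c_3\sigma^2 s\max\{m^2,\log(p/s)\}}{c_u^2\,n}$$ with probability at least $1/2$, where the minimum is over all estimators $\widetilde T$ based on the data $\{(X^{(i)},Y^{(i)}):1\le i\le n\}$; that is, for every such estimator, $$\sup_{T\in\mathcal{T}_1}\mathbb{P}_T\Big\{\|\widetilde T-T\|_{\rm F}^2\ge\frac{c_3\sigma^2 s\max\{m^2,\log(p/s)\}}{c_u^2\,n}\Big\}\ge\frac12 .$$
   Context: For a tensor $A\in\mathbb{R}^{m\times m\times p}$, $A_{\cdot\cdot j}\in\mathbb{R}^{m\times m}$ is its $j$-th slice in the third index, and $\|A\|_{\rm F}$ is the Frobenius norm (square root of the sum of squared entries). For $A\in\mathbb{R}^{m\times m\times p}$ and $X\in\mathbb{R}^{m\times p}$, $\langle A,X\rangle\in\mathbb{R}^m$ has $k$-th entry $\sum_{j=1}^p\sum_{\ell=1}^m X_{\ell j}A_{k\ell j}$. The empirical norm is $\|A\|_n^2=\frac1n\sum_{i=1}^n\|\langle A,X^{(i)}\rangle\|_{\ell_2}^2$. $\mathbb{I}$ is the indicator; $\lambda_{\min},\lambda_{\max}$ are smallest and largest eigenvalues. $\mathbb{P}_T$ is the law of the data when the true parameter is $T$. *)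

(* Defs.v *)
From HB Require Import structures.
From mathcomp Require Export all_boot all_order all_algebra.
From mathcomp Require Export all_classical all_reals all_analysis.
Export Order.TTheory GRing.Theory Num.Theory.
Export numFieldNormedType.Exports.

Set Implicit Arguments.
Unset Strict Implicit.
Unset Printing Implicit Defensive.

Local Open Scope classical_set_scope.
Local Open Scope ring_scope.

(* A tensor A in R^(m x m x p) is stored by its slices in the third index:
   [A j] is the slice A_{..j}, so the entry A_{klj} is [A j k l]. *)
Notation tensor R m p := {ffun 'I_p -> 'M[R]_m}.

(* [D i] is the observation (X^(i), Y^(i)). *)
Notation dataset R n m p := ('I_n -> 'M[R]_(m, p) * 'cV[R]_m).

Section Tensors.
Context {R : realType}.
Implicit Types m p n s : nat.

(* For a column vector this is the Euclidean norm. *)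
Definition frobenius_mx a b (M : 'M[R]_(a, b)) : R :=
  Num.sqrt (\sum_k \sum_l M k l ^+ 2).

Definition frobenius m p (A : tensor R m p) : R :=
  Num.sqrt (\sum_j \sum_k \sum_l A j k l ^+ 2).

Definition inner m p (A : tensor R m p) (X : 'M[R]_(m, p)) : 'cV[R]_m :=
  \col_k \sum_(j < p) \sum_(l < m) X l j * A j k l.

Definition emp_norm n m p (X : 'I_n -> 'M[R]_(m, p)) (A : tensor R m p) : R :=
  Num.sqrt (n%:R^-1 * \sum_(i < n) frobenius_mx (inner A (X i)) ^+ 2).

Definition sparse_class m p s : set (tensor R m p) :=
  [set A | (\sum_(j < p) (frobenius_mx (A j) != 0%R) <= s)%N].

Definition objective n m p (lambda : R) (X : 'I_n -> 'M[R]_(m, p))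
    (Y : 'I_n -> 'cV[R]_m) (A : tensor R m p) : R :=
  (2 * n%:R)^-1 * \sum_(i < n) frobenius_mx (Y i - inner A (X i)) ^+ 2
  + lambda * \sum_(j < p) frobenius_mx (A j).

Definition is_minimizer m p (f : tensor R m p -> R) (A : tensor R m p) : Prop :=
  forall B, f A <= f B.

(* Column-stacking vectorisation: [mxvec] alone lists the rows. *)
Definition vec m p (X : 'M[R]_(m, p)) : 'rV[R]_(p * m) := mxvec X^T.

(* For a real symmetric matrix of positive size the set of eigenvalues is
   finite and nonempty, so these are its minimum and maximum. *)
Definition lambda_min q (S : 'M[R]_q) : R := inf [set a | eigenvalue S a].
Definition lambda_max q (S : 'M[R]_q) : R := sup [set a | eigenvalue S a].

End Tensors.

(* The sigma-algebra on [T] generated by a family of real-valued functions. *)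
Definition sigma_gen {R : realType} {T J : Type} (f : J -> T -> R) :
    set (set T) :=
  <<s \bigcup_j preimage_set_system setT (f j) measurable >>.

Section Probability.
Context {R : realType} {d : measure_display} {Omega : measurableType d}.
Variable P : probability Omega R.

Definition mutually_independent (I : finType) (F : I -> set (set Omega)) : Prop :=
  forall (E : I -> set Omega), (forall i, F i (E i)) ->
  forall J : {set I},
    P (\bigcap_(i in [set i | i \in J]) E i) = (\prod_(i in J) P (E i))%E.

Definition independent2 (F G : set (set Omega)) : Prop :=
  forall A B, F A -> G B -> P (A `&` B) = (P A * P B)%E.

Definition has_law (Z : Omega -> R) (mu : set R -> \bar R) : Prop :=
  measurable_fun setT Z /\
  forall B : set R, measurable B -> P (Z @^-1` B) = mu B.

(* [normal_prob mu 0] is the uniform law on [0, 1] in the library, hence the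
   separate degenerate case. *)
Definition normal_law (mu sd : R) : set R -> \bar R :=
  if sd == 0 then (\d_mu : set R -> \bar R) else normal_prob mu sd.

Definition gaussian_vector q (V : Omega -> 'rV[R]_q) : Prop :=
  forall u : 'cV[R]_q, exists mu sd : R,
    has_law (fun w => (V w *m u) 0 0) (normal_law mu sd).

Definition centered q (V : Omega -> 'rV[R]_q) : Prop :=
  forall a, ('E_P[fun w => V w ord0 a] = 0)%E.

Definition has_covariance q (V : Omega -> 'rV[R]_q) (S : 'M[R]_q) : Prop :=
  forall a b, covariance P (fun w => V w 0 a) (fun w => V w 0 b) = (S a b)%:E.

Definition prob_at_least (r : R) (A : set Omega) : Prop :=
  exists E : set Omega, [/\ measurable E, (r%:E <= P E)%E & E `<=` A].

Definition gaussian_design n m p (X : 'I_n -> Omega -> 'M[R]_(m, p))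
    (S : 'M[R]_(p * m)) : Prop :=
  mutually_independent
    (fun i => sigma_gen (fun lj : 'I_m * 'I_p => fun w => X i w lj.1 lj.2)) /\
  forall i, [/\ gaussian_vector (fun w => vec (X i w)),
                centered (fun w => vec (X i w)) &
                has_covariance (fun w => vec (X i w)) S].

Definition gaussian_noise n m (eps : 'I_n -> Omega -> 'cV[R]_m) (sigma : R) : Prop :=
  mutually_independent
    (fun ik : 'I_n * 'I_m => sigma_gen (fun _ : unit => fun w => eps ik.1 w ik.2 0)) /\
  forall i k, has_law (fun w => eps i w k 0) (normal_law 0 sigma).

Definition noise_indep_covariates n m p (X : 'I_n -> Omega -> 'M[R]_(m, p))
    (eps : 'I_n -> Omega -> 'cV[R]_m) : Prop :=
  independent2
    (sigma_gen (fun ilj : 'I_n * 'I_m * 'I_p => fun w => X ilj.1.1 w ilj.1.2 ilj.2))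
    (sigma_gen (fun ik : 'I_n * 'I_m => fun w => eps ik.1 w ik.2 0)).

Definition regression_model n m p (cl cu sigma : R) (S : 'M[R]_(p * m))
    (X : 'I_n -> Omega -> 'M[R]_(m, p)) (eps : 'I_n -> Omega -> 'cV[R]_m) : Prop :=
  [/\ cl ^+ 2 <= lambda_min S, lambda_min S <= lambda_max S
    & lambda_max S <= cu ^+ 2] /\
  [/\ gaussian_design X S, gaussian_noise eps sigma
    & noise_indep_covariates X eps].

Definition response n m p (T : tensor R m p) (X : 'I_n -> Omega -> 'M[R]_(m, p))
    (eps : 'I_n -> Omega -> 'cV[R]_m) (i : 'I_n) (w : Omega) : 'cV[R]_m :=
  inner T (X i w) + eps i w.

(* The law P_T of the data: the covariates and the noise have the same joint
   law for every T, and only the responses depend on T. *)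
Definition data_law n m p (X : 'I_n -> Omega -> 'M[R]_(m, p))
    (eps : 'I_n -> Omega -> 'cV[R]_m) (T : tensor R m p) :
    set (dataset R n m p) -> \bar R :=
  fun A => P ((fun w i => (X i w, response T X eps i w)) @^-1` A).

End Probability.

(* The Borel sigma-algebra of the data space, a finite-dimensional real space,
   is the one generated by the coordinates. *)
Definition data_measurable {R : realType} n m p : set (set (dataset R n m p)) :=
  sigma_gen (fun c : 'I_n * 'I_m * 'I_p + 'I_n * 'I_m => fun D : dataset R n m p =>
    match c with
    | inl (i, l, j) => (D i).1 l j
    | inr (i, k) => (D i).2 k 0
    end).

(* Estimators are the Borel measurable functions of the data. *)
Definition is_estimator {R : realType} n m p
    (That : dataset R n m p -> tensor R m p) : Prop :=
  forall j k l (B : set R), measurable B ->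
    data_measurable ((fun D => That D j k l) @^-1` B).

(* Main.v *)
From HB Require Import structures.
Require Import Defs.
From mathcomp Require Import measurable_realfun ring lra zify.

(** Both halves of the theorem use the Gaussian model only through one-dimensional
Gaussian integrals, independence, and the bounds cl^2 |u|^2 <= u S u^T <= cu^2 |u|^2
(the extreme eigenvalues of a symmetric S bound its quadratic form, because the
quadratic form attains its maximum on the sphere at an eigenvector). The common
probabilistic tool is a conditional Cameron-Martin formula ([cameron_martin]): when
the noise e is independent of x, shifting e by a function h of x multiplies the law
by exp((<e, h> - |h|^2 / 2) / sigma^2).

Lower bound. The parameter is put together from blocks, block i carrying a letter
theta_i. Given theta, a block can be removed from the parameter; the observations
then carry no information on theta_i, so that any decoder of theta_i succeeds, on
average over the letters, with probability at most 1 / #letters. Restoring the block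
shifts the noise by <block, X>, whose expected squared norm is at most
n cu^2 |block|_F^2, and a truncated second moment bound on the likelihood ratio
([shift_probability_le]) shows that for a block of small enough norm the average
success probability stays below 1/4. By Markov, for some theta at least half of the
blocks are decoded wrongly with probability at least 1/2, and each of them costs a fixed
amount of squared error ([minimax_product_prior]). Using this average success
probability instead of a total-variation or entropy argument gives the probability
1/2 directly. Two block designs suffice: one entry per block, in arithmetic
progression, gives the rate s m^2 ([minimax_dimension]); s blocks that each hide one
nonzero entry among floor(p / s) slices give the rate s ln(p / s)
([minimax_selection]).

Upper bound. Let D be the error of the minimizer. Comparing the objective at the
minimizer and at T gives the usual oracle inequality, in which
N_1(D) = sum_j |D_j|_F satisfies N_1(D) <= 20 sqrt(s) |D|_F, as soon as

  - every noise matrix (1/n) sum_i eps_i x_ij^T has Frobenius norm at most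
    9/10 lambda, and
  - |D|_n^2 >= (cl^2 / 2) |D|_F^2 - small * N_1(D)^2 (restricted lower bound).

The restricted lower bound is first proved on finitely many tensors. The unit ball of
a slice lies in the convex hull of the matrices with entries in a grid of mesh
1/(10 m) and squared norm at most 121/100, by independent unbiased rounding of the
entries, and there are at most 2^(123 m^2) of these. An atom is such a matrix placed
in one slice. On every sum of N atoms the empirical norm is within a constant factor
of its mean, by Chernoff bounds for chi-squared variables and a union bound over
(p 2^(123 m^2))^N sums; this costs N (m^2 + ln p) = o(n) when N is of order s.
Maurey's empirical method ([maurey_lower_bound]) then extends the inequality from sums
of N atoms to all tensors with a loss N_1(D)^2 / (N - 1). The same atoms give
|U|_n^2 <= 1.331 cu^2 |U|_F^2 for tensors U supported on one slice. On that event the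
noise matrices are, given X, sub-Gaussian with variance proxy 1.331 cu^2 sigma^2 / n;
linearising the exponential of their squared norm by a Gaussian average
([subgaussian_exp_sum_sqr]) gives a tail which at the level
lambda >= 3 sigma cu sqrt(max(m^2, ln p) / n) beats both the dimension m^2 and the
union over the p slices. *)
Set Implicit Arguments.
Unset Strict Implicit.
Unset Printing Implicit Defensive.

Local Open Scope classical_set_scope.
Local Open Scope ring_scope.

(** * One-dimensional Gaussian integrals *)

Section NormalIntegrals.
Import HBNNSimple.
Context {R : realType}.
Implicit Types m s h t : R.
Local Notation mu := (@lebesgue_measure R).
Local Open Scope ereal_scope.

(** The normal law is defined set by set, by integrating its density; approximation by
simple functions carries the density over to integrals of nonnegative functions. *)
Lemma ge0_integral_normal_prob m s (f : measurableTypeR R -> \bar R) :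
  measurable_fun setT f -> (forall x, 0 <= f x) ->
  \int[normal_prob m s]_x f x = \int[mu]_x (f x * (normal_pdf m s x)%:E).
Proof.
move=> mf f0.
have pdf0 x : 0 <= (normal_pdf m s x)%:E by rewrite lee_fin normal_pdf_ge0.
have mpdf : measurable_fun setT (fun x => (normal_pdf m s x)%:E).
  by apply/measurable_EFinP; exact: measurable_normal_pdf.
have indic (A : set (measurableTypeR R)) : measurable A ->
    \int[normal_prob m s]_x (\1_A x)%:E = \int[mu]_x ((\1_A x)%:E * (normal_pdf m s x)%:E).
  move=> mA; rewrite integral_indic// setIT /normal_prob.
  rewrite [LHS]integral_mkcond /=; apply: eq_integral => x _.
  by rewrite patchE indicE; case: (x \in A); rewrite ?mul1e ?mul0e.
pose f_ := nnsfun_approx measurableT mf.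
have approx x : (f_ n x)%:E @[n --> \oo] --> f x.
  exact: cvg_nnsfun_approx.
transitivity (limn (fun n => \int[normal_prob m s]_x (f_ n x)%:E)).
  rewrite -monotone_convergence//=.
  - by apply: eq_integral => x _; apply/esym/cvg_lim.
  - by move=> n; exact/measurable_EFinP/measurable_funTS.
  - by move=> n x _; rewrite lee_fin.
  - by move=> x _ a b ab; rewrite lee_fin; exact/lefP/nd_nnsfun_approx.
transitivity (limn (fun n => \int[mu]_x ((f_ n x)%:E * (normal_pdf m s x)%:E))).
  apply: congr_lim; apply/funext => n.
  under eq_integral do rewrite fimfunE -fsumEFin//.
  rewrite ge0_integral_fsum//=; last 2 first.
  - by move=> r; apply/measurable_EFinP/measurableT_comp.
  - by move=> r x _; rewrite EFinM nnfun_muleindic_ge0.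
  under [RHS]eq_integral.
    move=> x _; rewrite fimfunE -fsumEFin// ge0_mule_fsuml; last first.
      by move=> r; rewrite EFinM nnfun_muleindic_ge0.
    over.
  rewrite [RHS]ge0_integral_fsum//=; last 2 first.
  - move=> r; apply: emeasurable_funM => //.
    by apply/measurable_EFinP/measurableT_comp.
  - by move=> r x _; rewrite mule_ge0// EFinM nnfun_muleindic_ge0.
  apply: eq_fsbigr => r _.
  rewrite integralZl_indic_nnsfun//= indic//.
  have [r0|r0] := ltP r 0%R.
    rewrite preimage_nnfun0//.
    under eq_integral do rewrite indicE in_set0 mul0e.
    under [RHS]eq_integral do rewrite indicE in_set0 mulr0 mul0e.
    by rewrite !integral0 mule0.
  rewrite -ge0_integralZl//.
  - by apply: eq_integral => x _; rewrite EFinM muleA.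
  - apply: emeasurable_funM => //.
    by apply/measurable_EFinP/measurable_indic.
  - by move=> x _; rewrite mule_ge0// lee_fin indicE.
rewrite -monotone_convergence//=.
- apply: eq_integral => x _; apply/cvg_lim => //.
  exact: cvgeZr.
- move=> n; apply: emeasurable_funM => //.
  exact/measurable_EFinP/measurable_funTS.
- by move=> n x _; rewrite mule_ge0// lee_fin.
- move=> x _ a b ab; apply: lee_wpmul2r => //.
  rewrite lee_fin; exact/lefP/nd_nnsfun_approx.
Qed.

Lemma normal_pdf_exp m s h x : s != 0%R ->
  (expR (h * x) * normal_pdf m s x =
   expR (h * m + s ^+ 2 * h ^+ 2 / 2) * normal_pdf (m + s ^+ 2 * h) s x)%R.
Proof.
move=> s0; rewrite !normal_pdfE//= !(mulrCA (expR _)) /normal_fun -!expRD.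
by congr (_ * expR _)%R; field.
Qed.

Lemma normal_mgf m s h : s != 0%R ->
  \int[normal_prob m s]_x (expR (h * x))%:E = (expR (h * m + s ^+ 2 * h ^+ 2 / 2))%:E.
Proof.
move=> s0; rewrite ge0_integral_normal_prob//; last first.
  by apply/measurable_EFinP/measurableT_comp => //; exact: measurable_funM.
under eq_integral do rewrite -EFinM normal_pdf_exp// EFinM.
rewrite ge0_integralZl//.
- by rewrite integral_normal_pdf mule1.
- by apply/measurable_EFinP; exact: measurable_normal_pdf.
- by move=> x _; rewrite lee_fin normal_pdf_ge0.
Qed.

(** Up to the factor (1 - 2 t s^2)^(-1/2), multiplying the density of N(0, s^2) by
exp(t x^2) gives the density of N(0, s^2 / (1 - 2 t s^2)). *)
Lemma normal_exp_sqr s t : s != 0%R -> (0 < 1 - 2 * t * s ^+ 2)%R ->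
  \int[normal_prob 0 s]_x (expR (t * x ^+ 2))%:E =
  ((Num.sqrt (1 - 2 * t * s ^+ 2))^-1)%:E.
Proof.
move=> s0 c0; set c := (1 - _)%R in c0 *.
have rc : (0 < Num.sqrt c)%R by rewrite sqrtr_gt0.
have s'0 : (s / Num.sqrt c != 0)%R by rewrite mulf_neq0// invr_eq0 gt_eqF.
have E x : (expR (t * x ^+ 2) * normal_pdf 0 s x =
            (Num.sqrt c)^-1 * normal_pdf 0 (s / Num.sqrt c) x)%R.
  rewrite !normal_pdfE//= /normal_peak.
  have -> : ((s / Num.sqrt c) ^+ 2 * pi *+ 2 = (s ^+ 2 * pi *+ 2) * c^-1)%R.
    by rewrite exprMn exprVn sqr_sqrtr ?(ltW c0)// mulrAC mulrnAl.
  rewrite [Num.sqrt (_ * c^-1)]sqrtrM; last first.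
    by rewrite mulrn_wge0// mulr_ge0 ?sqr_ge0// pi_ge0.
  rewrite (sqrtrV (ltW c0)) invfM invrK -!(mulrA (Num.sqrt _)^-1)%R.
  rewrite [RHS]mulrCA [in RHS]mulKf ?gt_eqF// mulrCA /normal_fun -expRD.
  congr (_ * expR _)%R.
  rewrite exprMn exprVn sqr_sqrtr ?(ltW c0)// /c.
  by field; rewrite -/c gt_eqF.
rewrite ge0_integral_normal_prob//; last first.
  by apply/measurable_EFinP/measurableT_comp => //; exact: measurable_funM.
under eq_integral do rewrite -EFinM E EFinM.
rewrite ge0_integralZl//.
- by rewrite integral_normal_pdf mule1.
- by apply/measurable_EFinP; exact: measurable_normal_pdf.
- by move=> x _; rewrite lee_fin normal_pdf_ge0.
Qed.

Lemma ge0_integral_lebesgue_shift h (f : measurableTypeR R -> \bar R) :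
  measurable_fun setT f -> (forall x, 0 <= f x) ->
  \int[mu]_x f (x + h)%R = \int[mu]_x f x.
Proof.
move=> mf f0.
have mh : measurable_fun setT (fun x : measurableTypeR R => (x + h)%R : measurableTypeR R).
  exact: measurable_funD.
have := @ge0_integral_pushforward _ _ _ _ R _ mh mu setT f measurableT mf.
rewrite preimage_setT => <-; last by move=> x _.
apply: eq_measure_integral => A mA _; apply/esym.
apply: lebesgue_measure_unique => //.
move=> X [[a b] _ <-].
rewrite /= /pushforward.
have -> : (fun x : R => (x + h)%R) @^-1` `]a, b]%classic = `](a - h)%R, (b - h)%R]%classic.
  by apply/seteqP; split => x /=; rewrite !in_itv/= ltrBlDr lerBrDr.
rewrite !lebesgue_measure_itv/= !lte_fin ltrD2r; case: ifPn => // _.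
by rewrite -!EFinD opprB addrA subrK.
Qed.

(** After translation by h in the Lebesgue integral, the exponential is the quotient of
the densities of N(0, s^2) at x - h and at x. *)
Lemma ge0_integral_normal_shift s h (f : measurableTypeR R -> \bar R) : s != 0%R ->
  measurable_fun setT f -> (forall x, 0 <= f x) ->
  \int[normal_prob 0 s]_x f (x + h)%R =
  \int[normal_prob 0 s]_x (f x * (expR ((x * h - h ^+ 2 / 2) / s ^+ 2))%:E).
Proof.
move=> s0 mf f0.
have me : measurable_fun setT (fun x : R => (expR ((x * h - h ^+ 2 / 2) / s ^+ 2))%:E).
  apply/measurable_EFinP/measurableT_comp => //; apply: measurable_funM => //.
  by apply: measurable_funB => //; exact: measurable_funM.
rewrite !ge0_integral_normal_prob//; first last.
- by apply: (measurableT_comp mf); exact: measurable_funD.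
- by move=> x; rewrite mule_ge0// lee_fin.
- exact: emeasurable_funM.
rewrite -[RHS](ge0_integral_lebesgue_shift h); first last.
- by move=> x; rewrite !mule_ge0// lee_fin ?expR_ge0 ?normal_pdf_ge0.
- apply: emeasurable_funM; first exact: emeasurable_funM.
  by apply/measurable_EFinP; exact: measurable_normal_pdf.
apply: eq_integral => x _; rewrite -muleA; congr (_ * _).
rewrite -EFinM !normal_pdfE//= mulrCA /normal_fun -expRD; congr (_ * expR _)%:E%R.
by field.
Qed.

End NormalIntegrals.

(** * Independence and generated sigma-algebras *)

Definition generators {R : realType} {T J : Type} (f : J -> T -> R) : set (set T) :=
  \bigcup_j preimage_set_system setT (f j) measurable.

(** The same carrier with only the events determined by f: a function measurable on
[generated f] is a function of the data f. *)
Notation generated f := (g_sigma_algebraType (generators f)).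

Section Generated.
Context {R : realType} {T : pointedType} {J : Type} (f : J -> T -> R).

Lemma measurable_to_generated d (U : measurableType d) (phi : U -> T) :
  (forall j, measurable_fun setT (fun u => f j (phi u))) ->
  measurable_fun setT (phi : U -> generated f).
Proof.
move=> mf; apply: (@measurability _ _ U (generated f) setT phi (generators f)) => //.
move=> _ [_ [j _ [B mB <-] <-]].
rewrite !setTI -comp_preimage -[X in measurable X]setTI; exact: mf.
Qed.

Lemma measurable_generator j : measurable_fun setT (f j : generated f -> R).
Proof.
move=> _ B mB; apply: sub_sigma_algebra; exists j => //.
by exists B.
Qed.

End Generated.

Arguments measurable_generator {R T J} f j.

Section Independence.
Context {R : realType} {d : measure_display} {Omega : measurableType d}.
Variable P : probability Omega R.
Local Open Scope ereal_scope.

(** Independence says that the law of w |-> (w, w) on the product of the two coarsened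
copies of Omega is a product measure, to which Tonelli applies. *)
Lemma ge0_integral_independent (J1 J2 : Type) (f : J1 -> Omega -> R)
    (g : J2 -> Omega -> R) (H : generated f * generated g -> \bar R) :
  (forall j, measurable_fun setT (f j)) -> (forall j, measurable_fun setT (g j)) ->
  independent2 P (sigma_gen f) (sigma_gen g) ->
  measurable_fun setT H -> (forall z, 0 <= H z) ->
  \int[P]_w H (w, w) = \int[P]_w \int[P]_w' H (w, w').
Proof.
move=> mf mg ind mH H0.
have mif : measurable_fun setT (idfun : Omega -> generated f).
  exact: measurable_to_generated.
have mig : measurable_fun setT (idfun : Omega -> generated g).
  exact: measurable_to_generated.
have mdiag : measurable_fun setT (fun w : Omega => (w : generated f, w : generated g)).
  exact: measurable_fun_pair.
pose X1 : {mfun Omega >-> generated f} := HB.pack (idfun : Omega -> generated f) (isMeasurableFun.Build _ _ _ _ _ mif).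
pose X2 : {mfun Omega >-> generated g} := HB.pack (idfun : Omega -> generated g) (isMeasurableFun.Build _ _ _ _ _ mig).
pose D : {mfun Omega >-> (generated f * generated g)%type} :=
  HB.pack (fun w : Omega => (w : generated f, w : generated g)) (isMeasurableFun.Build _ _ _ _ _ mdiag).
have prodE : forall A, measurable A ->
   (distribution P X1 \x distribution P X2) A = distribution P D A.
  apply: product_measure_unique => A B mA mB.
  exact: ind.
transitivity (\int[distribution P D]_z H z).
  by rewrite ge0_integral_distribution.
transitivity (\int[distribution P X1 \x distribution P X2]_z H z).
  by apply: eq_measure_integral => A mA _; rewrite -[LHS]/(distribution P D A) -prodE.
apply: (eq_trans (fubini_tonelli1 H mH H0)).
apply: (eq_trans (ge0_integral_distribution X1 _ _)).
- exact: measurable_fun_fubini_tonelli_F.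
- by move=> z; exact: integral_ge0.
- apply: eq_integral => w _.
  apply: (ge0_integral_distribution X2) => //.
  exact: (measurableT_comp mH).
Qed.

End Independence.

Section Laws.
Context {R : realType} {d : measure_display} {Omega : measurableType d}.
Variable P : probability Omega R.
Implicit Types (Z : Omega -> R) (m s h t : R).
Local Open Scope ereal_scope.

Lemma ge0_integral_has_law Z (nu : {measure set (measurableTypeR R) -> \bar R})
    (f : measurableTypeR R -> \bar R) :
  has_law P Z nu -> measurable_fun setT f -> (forall x, 0 <= f x) ->
  \int[P]_w f (Z w) = \int[nu]_x f x.
Proof.
move=> [mZ lZ] mf f0.
pose X : {mfun Omega >-> measurableTypeR R} :=
  HB.pack (Z : Omega -> measurableTypeR R) (isMeasurableFun.Build _ _ Omega (measurableTypeR R) Z mZ).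
transitivity (\int[distribution P X]_x f x).
  by rewrite ge0_integral_distribution.
by apply: eq_measure_integral => A mA _; exact: lZ.
Qed.

Lemma has_law_mgf Z m s h : has_law P Z (normal_law m s) ->
  \int[P]_w (expR (h * Z w))%:E = (expR (h * m + s ^+ 2 * h ^+ 2 / 2))%:E.
Proof.
rewrite /normal_law.
have me : measurable_fun setT (fun x : R => (expR (h * x))%:E).
  by apply/measurable_EFinP/measurableT_comp => //; exact: measurable_funM.
have e0 (x : R) : 0 <= (expR (h * x))%:E by rewrite lee_fin expR_ge0.
case: eqVneq => [->|s0] lZ.
  rewrite (@ge0_integral_has_law Z \d_(_ : measurableTypeR R) _ lZ me e0) integral_dirac// diracT mul1e.
  by rewrite expr0n/= !mul0r addr0.
by rewrite (@ge0_integral_has_law Z (normal_prob _ s) _ lZ me e0) normal_mgf.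
Qed.

Lemma has_law_exp_sqr Z s t : has_law P Z (normal_law 0 s) ->
  (0 < 1 - 2 * t * s ^+ 2)%R ->
  \int[P]_w (expR (t * Z w ^+ 2))%:E = ((Num.sqrt (1 - 2 * t * s ^+ 2))^-1)%:E.
Proof.
rewrite /normal_law.
have me : measurable_fun setT (fun x : R => (expR (t * x ^+ 2))%:E).
  by apply/measurable_EFinP/measurableT_comp => //; exact: measurable_funM.
have e0 (x : R) : 0 <= (expR (t * x ^+ 2))%:E by rewrite lee_fin expR_ge0.
case: eqVneq => [->|s0] lZ.
  rewrite (@ge0_integral_has_law Z \d_(_ : measurableTypeR R) _ lZ me e0) integral_dirac// diracT mul1e.
  by rewrite expr0n/= !mulr0 subr0 sqrtr1 invr1 expR0.
by move=> c0; rewrite (@ge0_integral_has_law Z (normal_prob _ s) _ lZ me e0) normal_exp_sqr.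
Qed.

End Laws.

Section MutualIndependence.
Context {R : realType} {d : measure_display} {Omega : measurableType d}.
Variable P : probability Omega R.
Local Open Scope ereal_scope.

Lemma sub_sigma_gen_measurable (J : Type) (f : J -> Omega -> R) :
  (forall j, measurable_fun setT (f j)) -> sigma_gen f `<=` measurable.
Proof.
move=> mf; apply: smallest_sub; first exact: sigma_algebra_measurable.
by move=> _ [j _ [B mB <-]]; exact: mf.
Qed.

Lemma independent2_sub (F F' G G' : set (set Omega)) :
  F `<=` F' -> G `<=` G' -> independent2 P F' G' -> independent2 P F G.
Proof. by move=> FF' GG' ind A B /FF' FA /GG' GB; exact: ind. Qed.

(** The finite intersections of events of the other members form a pi-system on which
the product rule holds; uniqueness of finite measures extends the rule to the
sigma-algebra they generate. *)
Lemma mutually_independent_rest (I : finType) (F : I -> set (set Omega)) (a : I) :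
  (forall i, sigma_algebra setT (F i)) -> (forall i, F i `<=` measurable) ->
  mutually_independent P F ->
  independent2 P <<s \bigcup_(i in [set i | i != a]) F i >> (F a).
Proof.
move=> sF mF ind A B sA FB.
have FT i : F i setT.
  by have [F0 FC _] := sF i; rewrite -(setD0 setT); exact: FC.
have FI i U V : F i U -> F i V -> F i (U `&` V).
  move=> FU FV; rewrite -(sigma_algebra_id (sF i)).
  by apply: (@measurableI _ (g_sigma_algebraType (F i)) U V); exact: sub_sigma_algebra.
pose G : set (set Omega) := [set A | exists2 E : I -> set Omega, (forall i, F i (E i)) &
  A = \bigcap_(i in [set i | i \in [set~ a]%SET]) E i].
have capm (E : I -> set Omega) (K : {set I}) : (forall i, F i (E i)) ->
    measurable (\bigcap_(i in [set i | i \in K]) E i).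
  move=> FE; apply: fin_bigcap_measurable => [|i _]; first exact: finite_finset.
  exact: (mF i).
have GT : G setT.
  exists (fun=> setT) => //.
  by apply/seteqP; split.
have GI : setI_closed G.
  move=> _ _ [E FE ->] [E' FE' ->]; exists (fun i => E i `&` E' i).
    by move=> i; exact: FI.
  by rewrite bigcapI.
have Gm : G `<=` measurable.
  by move=> _ [E FE ->]; exact: capm.
have {}sA : <<s G >> A.
  move: A sA; apply: sub_smallest2r => // U [i /= ia FU].
  exists (fun k => if k == i then U else setT).
    by move=> k; case: eqP => // ->.
  apply/seteqP; split => w.
    by move=> Uw k /= _; case: eqP.
  by move=> /(_ i); rewrite /= !inE ia eqxx; apply.
have mB := mF a B FB.
have PB0 : (0 <= fine (P B))%R by apply: fine_ge0.
have PBE : P B = (fine (P B))%:E by rewrite fineK// fin_num_measure.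
have -> : P (A `&` B) = mrestr P mB A by [].
rewrite muleC PBE -[RHS]/(mscale (NngNum PB0) P A).
apply: (@g_sigma_algebra_measure_unique _ R Omega G Gm (fun=> setT)) => //.
- by apply/seteqP; split => // w _; exists 0%N.
- move=> _ [E FE ->]; rewrite /= /mrestr /mscale /=.
  pose E' i := if i == a then B else E i.
  have FE' i : F i (E' i) by rewrite /E'; case: eqP => // ->.
  have := ind E' FE' [set: I]%SET; rewrite (ind E FE [set~ a]%SET).
  rewrite (bigD1 a)//= {2}/E' eqxx PBE.
  rewrite (_ : \bigcap_(i in _) E' i = \bigcap_(i in [set i | i \in [set~ a]%SET]) E i `&` B).
    move=> ->; congr (_ * _); apply: eq_big => i; first by rewrite !inE.
    by rewrite /E' => /andP[_ /negbTE ->].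
  apply/seteqP; split => w.
    move=> Ew; split.
      by move=> i /=; rewrite !inE => /negbTE ia; have := Ew i (finset.in_setT i); rewrite /E' ia.
    by have := Ew a (finset.in_setT a); rewrite /E' eqxx.
  move=> [Ew Bw] i _; rewrite /E'; case: ifPn => // ia; apply: Ew.
  by rewrite /= !inE.
- by move=> k; rewrite /= /mrestr setTI ltey_eq fin_num_measure.
Qed.

Lemma independent2_sigma_gen_split (I : finType) (J : Type) (f : I -> J -> Omega -> R) (a : I) :
  (forall i j, measurable_fun setT (f i j)) ->
  mutually_independent P (fun i => sigma_gen (f i)) ->
  independent2 P (sigma_gen (fun ij : {i | i != a} * J => f (sval ij.1) ij.2)) (sigma_gen (f a)).
Proof.
move=> mf ind.
have := @mutually_independent_rest I _ a _ _ ind.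
move/(_ (fun i => smallest_sigma_algebra _ _)).
move/(_ (fun i => sub_sigma_gen_measurable (mf i))).
apply: independent2_sub => //.
apply: sub_smallest2r => // A [[[i ia] j] _ [B mB <-]].
by exists i => //; apply: sub_sigma_algebra; exists j => //; exists B.
Qed.

(** One factor is peeled off at a time: the product of the others is measurable for the
sigma-algebra of the remaining members. *)
Lemma ge0_integral_prod_independent (I : finType) (J : Type) (f : I -> J -> Omega -> R)
    (g : I -> Omega -> R) :
  (forall i j, measurable_fun setT (f i j)) ->
  mutually_independent P (fun i => sigma_gen (f i)) ->
  (forall i, measurable_fun setT (g i : generated (f i) -> R)) ->
  (forall i w, (0 <= g i w)%R) ->
  \int[P]_w (\prod_i g i w)%:E = \prod_i \int[P]_w (g i w)%:E.
Proof.
move=> mf ind mg g0.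
have mgO i : measurable_fun setT (g i).
  move=> _ B mB; rewrite setTI; apply: (sub_sigma_gen_measurable (mf i)).
  by have := mg i measurableT B mB; rewrite setTI.
have main (s : seq I) : uniq s ->
    \int[P]_w (\prod_(i <- s) g i w)%:E = \prod_(i <- s) \int[P]_w (g i w)%:E.
  elim: s => [_|a s IH /= /andP[as_ us]].
    rewrite big_nil; under eq_integral do rewrite big_nil.
    by rewrite integral_cst//= mul1e probability_setT.
  rewrite big_cons -IH//.
  pose f' := fun ij : {i | i != a} * J => f (sval ij.1) ij.2.
  pose G (w : Omega) := (\prod_(i <- s) g i w)%R.
  have mG : measurable_fun setT (G : generated f' -> R).
    have -> : G = (fun x => \prod_(i <- s) (if i \in s then g i x else 1))%R.
      by apply/funext => x; rewrite /G [LHS]big_seq [RHS]big_seq; apply: eq_bigr => i ->.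
    apply: measurable_prod => i _; case: (boolP (i \in s)) => [is_|_]; last first.
      exact: measurable_cst.
    have ia : i != a by apply: contraNneq as_ => <-.
    move=> _ B mB; have := mg i measurableT B mB.
    move: (_ `&` _); apply: sub_smallest2r => // A [j _ [C mC <-]].
    by exists (exist _ i ia, j) => //; exists C.
  have mprod : measurable_fun setT (fun w : Omega => (\prod_(i <- s) g i w)%R).
    exact: measurable_prod.
  transitivity (\int[P]_w (G w * g a w)%:E).
    by apply: eq_integral => w _; rewrite big_cons mulrC.
  pose H (z : generated f' * generated (f a)) := (G z.1 * g a z.2)%:E.
  rewrite (@ge0_integral_independent _ _ _ P _ _ f' (f a) H) //.
  - rewrite /H /=.
    under eq_integral.
      move=> w _.
      under eq_integral do rewrite EFinM.
      rewrite ge0_integralZl//; first over.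
      + exact/measurable_EFinP.
      + by move=> x _; rewrite lee_fin.
      + by rewrite lee_fin prodr_ge0.
    rewrite ge0_integralZr//.
    + by rewrite muleC.
    + exact/measurable_EFinP.
    + by move=> x _; rewrite lee_fin prodr_ge0.
    + by apply: integral_ge0 => x _; rewrite lee_fin.
  - by move=> ij; exact: mf.
  - exact: independent2_sigma_gen_split.
  - apply/measurable_EFinP; apply: measurable_funM.
      exact: (measurableT_comp mG).
    exact: (measurableT_comp (mg a)).
  - by move=> z; rewrite lee_fin mulr_ge0// prodr_ge0.
by have := main (index_enum I) (index_enum_uniq I).
Qed.

End MutualIndependence.

(** [generated coordinates] is R^I with its product sigma-algebra. *)
Definition coordinates {R : realType} (I : Type) (a : I) (y : I -> R) : R := y a.

Section CameronMartin.
Context {R : realType} {d : measure_display} {Omega : measurableType d}.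
Variables (P : probability Omega R) (I : finType) (Jx : Type).
Variables (x : Jx -> Omega -> R) (e : I -> Omega -> R) (sigma : R).
Hypothesis mx : forall j, measurable_fun setT (x j).
Hypothesis sigma_neq0 : sigma != 0.
Hypothesis indep_e : mutually_independent P (fun a => sigma_gen (fun _ : unit => e a)).
Hypothesis law_e : forall a, has_law P (e a) (normal_law 0 sigma).
Hypothesis indep_xe : independent2 P (sigma_gen x) (sigma_gen e).
Local Open Scope ereal_scope.

Let me_ a : measurable_fun setT (e a). Proof. by case: (law_e a). Qed.

Let rest a (j : Jx + {b : I | b != a}) : Omega -> R :=
  match j with inl j => x j | inr b => e (sval b) end.

Let indep_rest a : independent2 P (sigma_gen (@rest a)) (sigma_gen (fun _ : unit => e a)).
Proof.
pose F (o : option I) := if o is Some b then sigma_gen (fun _ : unit => e b) else sigma_gen x.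
have sF o : sigma_algebra setT (F o).
  by case: o => [b|]; rewrite /F /sigma_gen; exact: smallest_sigma_algebra.
have mF o : F o `<=` measurable.
  by case: o => [b|]; apply: sub_sigma_gen_measurable.
have sub b : sigma_gen (fun _ : unit => e b) `<=` sigma_gen e.
  by apply: sub_smallest2r => // A [_ _ [B mB <-]]; exists b => //; exists B.
have ind : mutually_independent P F.
  move=> E FE K.
  pose K' : {set I} := [set b | Some b \in K]%SET.
  have sK' : sigma_gen e (\bigcap_(b in [set b | b \in K']) E (Some b)).
    apply: (@fin_bigcap_measurable _ (generated e)); first exact: finite_finset.
    by move=> b _; exact: (sub b _ (FE (Some b))).
  have prodE : (\prod_(o in K | o != None) P (E o) = \prod_(b in K') P (E (Some b)))%E.
    rewrite (reindex_omap Some id)/=; last by move=> [b|] //=; rewrite andbF.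
    by apply: eq_bigl => b; rewrite !inE /= ?eqxx ?andbT.
  have PK' := indep_e (fun b => FE (Some b)) K'.
  case: (boolP (None \in K)) => NK.
    rewrite (bigD1 None)//= prodE -PK' -(indep_xe (FE None) sK').
    congr (P _); apply/seteqP; split => w.
      move=> EK; split; first exact: EK.
      by move=> b /=; rewrite inE => bK; exact: EK.
    by move=> [E0 EK] [b|] //= bK; apply: EK; rewrite /= inE.
  rewrite (eq_bigl (fun o => (o \in K) && (o != None))); last first.
    by case=> [b|]; rewrite ?andbT// (negbTE NK).
  rewrite prodE -PK'; congr (P _); apply/seteqP; split => w.
    by move=> EK b /=; rewrite inE => bK; exact: EK.
  by move=> EK [b|] //= bK; [apply: EK; rewrite /= inE|rewrite bK in NK].
have := mutually_independent_rest (a := Some a) sF mF ind.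
apply: independent2_sub => //.
apply: sub_smallest2r; first exact: smallest_sigma_algebra.
move=> A [[j|[b ba]] _ [B mB <-]].
  by exists None => //; apply: sub_sigma_algebra; exists j => //; exists B.
by exists (Some b) => //; apply: sub_sigma_algebra; exists tt => //; exists B.
Qed.

(** With x and the other noise variables frozen, only e_a is integrated and the shift is
a constant, so that the one-dimensional shift formula applies inside the integral. *)
Lemma cameron_martin_coordinate (a : I) (h : Omega -> R)
    (F : generated x * generated (@coordinates R I) -> \bar R) :
  measurable_fun setT (h : generated x -> R) ->
  measurable_fun setT F -> (forall z, 0 <= F z) ->
  \int[P]_w F (w, fun b => e b w + (if b == a then h w else 0))%R =
  \int[P]_w (F (w, e^~ w) * (expR ((e a w * h w - h w ^+ 2 / 2) / sigma ^+ 2))%:E).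
Proof.
move=> mh mF F0.
pose y (w1 : Omega) (z : R) : I -> R := fun b => if b == a then z else e b w1.
pose phi (w1 : Omega) (z : R) : \bar R := F (w1, y w1 z).
pose D (w1 : Omega) (z : R) : \bar R := (expR ((z * h w1 - h w1 ^+ 2 / 2) / sigma ^+ 2))%:E.
have mid : measurable_fun setT (idfun : generated (@rest a) -> generated x).
  by apply: measurable_to_generated => j; exact: (measurable_generator (@rest a) (inl j)).
have mh' : measurable_fun setT (h : generated (@rest a) -> R).
  exact: (measurableT_comp mh mid).
have mea : measurable_fun setT (e a : generated (fun _ : unit => e a) -> R).
  exact: (measurable_generator (fun _ : unit => e a) tt).
have mphi : measurable_fun setT (fun u : generated (@rest a) * R => phi u.1 u.2).
  apply: (measurableT_comp mF); apply: measurable_fun_pair.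
    exact: (measurableT_comp mid measurable_fst).
  apply: measurable_to_generated => b; rewrite /coordinates /y /=.
  have [_|ba] := eqVneq b a; first exact: (@measurable_snd _ _ (generated (@rest a)) R).
  exact: (measurableT_comp (measurable_generator (@rest a) (inr (exist _ b ba))) measurable_fst).
have phi0 w z : 0 <= phi w z by exact: F0.
have mD : measurable_fun setT (fun u : generated (@rest a) * R => D u.1 u.2).
  have mh1 : measurable_fun setT (fun u : generated (@rest a) * R => h u.1).
    exact: (measurableT_comp mh').
  apply/measurable_EFinP/measurableT_comp => //; apply: measurable_funM => //.
  apply: measurable_funB; first exact: measurable_funM.
  by apply: measurable_funM => //; exact: measurable_funX.
have mrest j : measurable_fun setT (@rest a j) by case: j => [j|b]; [exact: mx|exact: me_].
pose H1 (z : generated (@rest a) * generated (fun _ : unit => e a)) :=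
  phi z.1 (e a z.2 + h z.1)%R.
pose H2 (z : generated (@rest a) * generated (fun _ : unit => e a)) :=
  phi z.1 (e a z.2) * D z.1 (e a z.2).
have msum : measurable_fun setT (fun z : generated (@rest a) * generated (fun _ : unit => e a) =>
    (z.1, (e a z.2 + h z.1)%R)).
  apply: measurable_fun_pair => //; apply: measurable_funD.
    exact: (measurableT_comp mea).
  exact: (measurableT_comp mh').
have mpair : measurable_fun setT (fun z : generated (@rest a) * generated (fun _ : unit => e a) =>
    (z.1, e a z.2)).
  by apply: measurable_fun_pair => //; exact: (measurableT_comp mea).
transitivity (\int[P]_w H1 (w, w)).
  apply: eq_integral => w _; rewrite /H1 /phi /=; congr (F (_, _)); apply/funext => b.
  by rewrite /y; case: eqVneq => [->//|_]; rewrite addr0.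
transitivity (\int[P]_w H2 (w, w)); last first.
  apply: eq_integral => w _; rewrite /H2 /phi /=; congr (F (_, _) * _); apply/funext => b.
  by rewrite /y; case: eqVneq => [->//|_].
rewrite (@ge0_integral_independent _ _ _ P _ _ _ _ H1 mrest (fun _ => me_ a) (@indep_rest a))//; last 2 first.
  exact: (measurableT_comp mphi msum).
  by move=> z; exact: phi0.
rewrite (@ge0_integral_independent _ _ _ P _ _ _ _ H2 mrest (fun _ => me_ a) (@indep_rest a))//; last 2 first.
  apply: emeasurable_funM; first exact: (measurableT_comp mphi mpair).
  exact: (measurableT_comp mD mpair).
  by move=> z; rewrite mule_ge0// lee_fin expR_ge0.
apply: eq_integral => w _.
have mpw : measurable_fun setT (fun z : R => (w : generated (@rest a), z)).
  exact: measurable_fun_pair.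
have mphiw : measurable_fun setT (phi w) by exact: (measurableT_comp mphi mpw).
have mDw : measurable_fun setT (D w) by exact: (measurableT_comp mD mpw).
have law_ea : has_law P (e a) (normal_prob 0 sigma).
  by have := law_e a; rewrite /normal_law (negbTE sigma_neq0).
rewrite /H1 /H2 /=.
rewrite (ge0_integral_has_law (f := fun z => phi w (z + h w)%R) law_ea)//; last first.
  by apply: (measurableT_comp mphiw); exact: measurable_funD.
rewrite (ge0_integral_has_law (f := fun z => phi w z * D w z) law_ea)//; last 2 first.
  exact: emeasurable_funM.
  by move=> z; rewrite mule_ge0// lee_fin expR_ge0.
exact: ge0_integral_normal_shift.
Qed.

(** The coordinates are shifted one after the other. The exponential factor of a
coordinate does not see the shifts of the others, so the factors multiply. *)
Lemma cameron_martin (h : I -> Omega -> R)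
    (F : generated x * generated (@coordinates R I) -> \bar R) :
  (forall a, measurable_fun setT (h a : generated x -> R)) ->
  measurable_fun setT F -> (forall z, 0 <= F z) ->
  \int[P]_w F (w, fun a => e a w + h a w)%R =
  \int[P]_w (F (w, e^~ w) *
    (expR ((\sum_a (e a w * h a w - h a w ^+ 2 / 2)) / sigma ^+ 2))%:E).
Proof.
move=> mh.
have main (s : seq I) : uniq s ->
    forall (F : generated x * generated (@coordinates R I) -> \bar R),
    measurable_fun setT F -> (forall z, 0 <= F z) ->
    \int[P]_w F (w, fun a => e a w + (if a \in s then h a w else 0))%R =
    \int[P]_w (F (w, e^~ w) *
    (expR ((\sum_(a <- s) (e a w * h a w - h a w ^+ 2 / 2)) / sigma ^+ 2))%:E).
  elim: s => [_|a s IH /= /andP[as_ us]] {}F mF F0.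
    apply: eq_integral => w _; rewrite big_nil mul0r expR0 mule1; congr (F (_, _)).
    by apply/funext => b; rewrite addr0.
  pose F' (z : generated x * generated (@coordinates R I)) :=
    F (z.1, fun b => z.2 b + (if b == a then h a z.1 else 0))%R.
  have mcoord (b : I) : measurable_fun setT (fun z : generated x * generated (@coordinates R I) => z.2 b).
    exact: (measurableT_comp (measurable_generator (@coordinates R I) b)).
  have mh1 (b : I) : measurable_fun setT (fun z : generated x * generated (@coordinates R I) => h b z.1).
    exact: (measurableT_comp (mh b)).
  have mF' : measurable_fun setT F'.
    apply: (measurableT_comp mF); apply: measurable_fun_pair => //.
    apply: measurable_to_generated => b; rewrite /coordinates /=.
    by apply: measurable_funD => //; case: eqP => // _.
  pose W (z : generated x * generated (@coordinates R I)) :=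
    (expR ((\sum_(b <- s) (z.2 b * h b z.1 - h b z.1 ^+ 2 / 2)) / sigma ^+ 2))%:E.
  have mW : measurable_fun setT W.
    apply/measurable_EFinP/measurableT_comp => //; apply: measurable_funM => //.
    apply: measurable_sum => b; apply: measurable_funB; first exact: measurable_funM.
    by apply: measurable_funM => //; exact: measurable_funX.
  have W0 z : 0 <= W z by rewrite lee_fin expR_ge0.
  transitivity (\int[P]_w F' (w, fun b => e b w + (if b \in s then h b w else 0))%R).
    apply: eq_integral => w _; congr (F (_, _)); apply/funext => b /=.
    rewrite inE; case: (eqVneq b a) => [->|_] /=; last by rewrite addr0.
    by rewrite (negbTE as_) addr0.
  apply: (eq_trans (IH us F' mF' (fun z => F0 _))).
  pose G z := F z * W z.
  have mG : measurable_fun setT G by exact: emeasurable_funM.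
  have G0 z : 0 <= G z by exact: mule_ge0.
  transitivity (\int[P]_w G (w, fun b => e b w + (if b == a then h a w else 0))%R).
    apply: eq_integral => w _; rewrite [RHS]/G.
    suff -> : W (w, fun b => e b w + (if b == a then h a w else 0))%R =
        (expR ((\sum_(b <- s) (e b w * h b w - h b w ^+ 2 / 2)) / sigma ^+ 2))%:E by [].
    suff sE : (\sum_(b <- s) ((e b w + (if b == a then h a w else 0)) * h b w - h b w ^+ 2 / 2) =
        \sum_(b <- s) (e b w * h b w - h b w ^+ 2 / 2))%R by rewrite /W /= sE.
    apply: eq_big_seq => b bs; case: eqP => [ba|_]; last by rewrite addr0.
    by rewrite -ba bs in as_.
  rewrite (@cameron_martin_coordinate a (h a) G (mh a) mG G0).
  apply: eq_integral => w _; rewrite /G -muleA.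
  suff -> : W (w, e^~ w) * (expR ((e a w * h a w - h a w ^+ 2 / 2) / sigma ^+ 2))%:E =
      (expR ((\sum_(b <- a :: s) (e b w * h b w - h b w ^+ 2 / 2)) / sigma ^+ 2))%:E by [].
  by rewrite /W /= -EFinM -expRD -mulrDl big_cons [in RHS]addrC.
move=> mF F0; apply: (eq_trans _ (main _ (index_enum_uniq I) F mF F0)).
apply: eq_integral => w _; congr (F (_, _)); apply/funext => a.
by rewrite mem_index_enum.
Qed.

End CameronMartin.

Section RealIntegrals.
Context {R : realType} {d : measure_display} {Omega : measurableType d}.
Variable P : probability Omega R.
Implicit Types (f g : Omega -> R) (A : set Omega) (c : R).
Local Open Scope ereal_scope.

Lemma integral_real_cst c : \int[P]_w c%:E = c%:E.
Proof. by rewrite integral_cst// [X in _ * X](probability_setT P) mule1. Qed.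

Lemma ge0_integral_realD f g : measurable_fun setT f -> measurable_fun setT g ->
  (forall w, 0 <= f w)%R -> (forall w, 0 <= g w)%R ->
  \int[P]_w (f w + g w)%:E = \int[P]_w (f w)%:E + \int[P]_w (g w)%:E.
Proof.
move=> mf mg f0 g0; rewrite -ge0_integralD//.
- by move=> w _; rewrite lee_fin.
- exact/measurable_EFinP.
- by move=> w _; rewrite lee_fin.
- exact/measurable_EFinP.
Qed.

Lemma ge0_integral_realZ c f : measurable_fun setT f -> (0 <= c)%R ->
  (forall w, 0 <= f w)%R ->
  \int[P]_w (c * f w)%:E = c%:E * \int[P]_w (f w)%:E.
Proof.
move=> mf c0 f0; rewrite -ge0_integralZl//.
- exact/measurable_EFinP.
- by move=> w _; rewrite lee_fin.
Qed.

Lemma ge0_le_integral_real f g : measurable_fun setT f -> measurable_fun setT g ->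
  (forall w, 0 <= f w)%R -> (forall w, f w <= g w)%R ->
  \int[P]_w (f w)%:E <= \int[P]_w (g w)%:E.
Proof.
move=> mf mg f0 fg; apply: ge0_le_integral => //.
- by move=> w _; rewrite lee_fin.
- exact/measurable_EFinP.
- exact/measurable_EFinP.
- by move=> w _; rewrite lee_fin.
Qed.

Lemma integral_real_indic A : measurable A -> \int[P]_w (\1_A w)%:E = P A.
Proof. by move=> mA; rewrite integral_indic// setIT. Qed.

Lemma probability_le_integral A g : measurable A -> measurable_fun setT g ->
  (forall w, 0 <= g w)%R -> (forall w, A w -> 1 <= g w)%R ->
  P A <= \int[P]_w (g w)%:E.
Proof.
move=> mA mg g0 Ag; rewrite -integral_real_indic//.
apply: ge0_le_integral_real => //.
- move=> w; rewrite indicE; case: (boolP (w \in A)) => //.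
  by rewrite inE => /Ag.
Qed.

End RealIntegrals.

Section ComparisonSets.
Context {R : realType} {d : measure_display} {T : measurableType d}.
Implicit Types f g : T -> R.

Lemma measurable_lt_set f g : measurable_fun setT f -> measurable_fun setT g ->
  measurable [set w | f w < g w].
Proof.
by move=> mf mg; have := measurable_fun_ltr mf mg measurableT (I : measurable [set true]); rewrite setTI.
Qed.

Lemma measurable_le_set f g : measurable_fun setT f -> measurable_fun setT g ->
  measurable [set w | f w <= g w].
Proof.
by move=> mf mg; have := measurable_fun_ler mf mg measurableT (I : measurable [set true]); rewrite setTI.
Qed.

End ComparisonSets.

(** * Change of measure for Gaussian noise *)

Section GaussianShift.
Context {R : realType} {d : measure_display} {Omega : measurableType d}.
Variables (P : probability Omega R) (I : finType) (Jx : Type).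
Variables (x : Jx -> Omega -> R) (e : I -> Omega -> R) (sigma : R).
Hypothesis mx : forall j, measurable_fun setT (x j).
Hypothesis sigma_neq0 : sigma != 0.
Hypothesis indep_e : mutually_independent P (fun a => sigma_gen (fun _ : unit => e a)).
Hypothesis law_e : forall a, has_law P (e a) (normal_law 0 sigma).
Hypothesis indep_xe : independent2 P (sigma_gen x) (sigma_gen e).

Let mid : measurable_fun setT (idfun : Omega -> generated x).
Proof. exact: measurable_to_generated. Qed.

Let me_ a : measurable_fun setT (e a). Proof. by case: (law_e a). Qed.

Section Shift.
Variable h : I -> Omega -> R.
Hypothesis mh : forall a, measurable_fun setT (h a : generated x -> R).

Let mhO a : measurable_fun setT (h a). Proof. exact: (measurableT_comp (mh a) mid). Qed.

(** The log-density, given x, of the law of e + h(x) with respect to the law of e. *)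
Definition log_likelihood_ratio (w : Omega) : R :=
  (\sum_a (e a w * h a w - h a w ^+ 2 / 2)) / sigma ^+ 2.

Lemma measurable_log_likelihood_ratio : measurable_fun setT log_likelihood_ratio.
Proof.
apply: measurable_funM => //; apply: measurable_sum => a.
by apply: measurable_funB; apply: measurable_funM => //; exact: measurable_funX.
Qed.

(** A likelihood ratio has conditional mean one given x. *)
Lemma integral_likelihood_ratio (f : Omega -> R) :
  measurable_fun setT (f : generated x -> R) -> (forall w, 0 <= f w) ->
  (\int[P]_w (f w * expR (log_likelihood_ratio w))%:E = \int[P]_w (f w)%:E)%E.
Proof.
move=> mf f0; pose F (z : generated x * generated (@coordinates R I)) := (f z.1)%:E.
have mF : measurable_fun setT F.
  by apply/measurable_EFinP; exact: (measurableT_comp mf measurable_fst).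
have F0 z : (0 <= F z)%E by rewrite lee_fin.
apply/esym; exact: (cameron_martin mx sigma_neq0 indep_e law_e indep_xe mh mF F0).
Qed.

End Shift.

Variable h : I -> Omega -> R.
Hypothesis mh : forall a, measurable_fun setT (h a : generated x -> R).

Let mhO a : measurable_fun setT (h a). Proof. exact: (measurableT_comp (mh a) mid). Qed.

Local Notation llr := (log_likelihood_ratio h).

(** Let Z be the likelihood ratio. On the event |h|^2 <= kappa sigma^2 its second moment
is at most exp kappa, because Z^2 is exp(|h|^2 / sigma^2) times the likelihood ratio of
the shift 2 h; and Z <= e^tau + e^-tau Z^2 pointwise, which trades the second moment
for a bounded change of measure. *)
Lemma shift_probability_le (B : set (generated x * generated (@coordinates R I))) (kappa tau : R) :
  measurable B ->
  (P [set w | B (w, fun a => e a w + h a w)%R] <=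
   P [set w | (sigma ^+ 2 * kappa < \sum_a h a w ^+ 2)%R] + (expR (kappa - tau)%R)%:E
   + (expR tau)%:E * P [set w | B (w, e^~ w)])%E.
Proof.
move=> mB.
pose H (w : Omega) := \sum_a h a w ^+ 2.
have mH : measurable_fun setT (H : generated x -> R).
  by apply: measurable_sum => a; exact: measurable_funX.
have mHO : measurable_fun setT H by exact: (measurableT_comp mH mid).
pose C : set Omega := [set w | H w <= sigma ^+ 2 * kappa].
have mC : measurable (C : set (generated x)).
  have := mH measurableT _ (@measurable_itv R `]-oo, (sigma ^+ 2 * kappa)]).
  rewrite setTI; congr measurable; apply/seteqP; split => w /=; by rewrite in_itv.
have mCO : measurable C.
  by have := mid measurableT mC; rewrite setTI preimage_id.
pose F (z : generated x * generated (@coordinates R I)) : R := \1_B z * \1_C z.1.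
have mI : measurable_fun setT (\1_C : generated x -> R) by exact: measurable_indic.
have mFr : measurable_fun setT F.
  apply: measurable_funM; first exact: measurable_indic.
  exact: (measurableT_comp mI measurable_fst).
have F0 z : 0 <= F z by rewrite mulr_ge0// indicE.
have mpair (y : I -> Omega -> R) : (forall a, measurable_fun setT (y a)) ->
    measurable_fun setT (fun w : Omega => (w : generated x, (fun a => y a w) : generated (@coordinates R I))).
  move=> my; apply: measurable_fun_pair => //.
  by apply: measurable_to_generated => a; exact: my.
have meh : measurable_fun setT (fun w : Omega => (w : generated x, (fun a => e a w + h a w) : generated (@coordinates R I))).
  by apply: mpair => a; exact: measurable_funD.
have me' : measurable_fun setT (fun w : Omega => (w : generated x, (e^~ w) : generated (@coordinates R I))).
  exact: mpair.
set E1 : set Omega := [set w | B (w, fun a => e a w + h a w)]; set E2 := [set w | (_ < _)%R]; set E0 := [set w | B (w, e^~ w)].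
have mE1 : measurable E1 by rewrite -[E1]setTI; exact: (meh measurableT _ mB).
have mE0 : measurable E0 by rewrite -[E0]setTI; exact: (me' measurableT _ mB).
have E2C : E2 = ~` C.
  by apply/seteqP; split => w; rewrite /E2 /C /= ltNge => /negP.
have mE2 : measurable E2 by rewrite E2C; exact: measurableC.
have step1 : (P E1 <= P E2 + P (E1 `&` C))%E.
  apply: (@le_trans _ _ (P (E2 `|` (E1 `&` C)))).
    apply: le_measure; rewrite ?inE//.
      by apply: measurableU => //; exact: measurableI.
    move=> w E1w; have [Cw|nCw] := pselect (C w); first by right.
    by left; rewrite E2C.
  by apply: measureU2 => //; exact: measurableI.
have step2 : (P (E1 `&` C) = \int[P]_w (F (w, fun a => e a w + h a w)%R)%:E)%E.
  rewrite -(integral_real_indic P)//; last exact: measurableI.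
  apply: eq_integral => w _; rewrite /F /= -[in RHS]/(\1_C w).
  rewrite indicI; congr ((_ * _)%:E).
have step3 : (\int[P]_w (F (w, fun a => e a w + h a w)%R)%:E =
   \int[P]_w (F (w, e^~ w) * expR (llr w))%:E)%E.
  have mFE : measurable_fun setT (EFin \o F) by exact/measurable_EFinP.
  have FE0 z : (0 <= (EFin \o F) z)%E by rewrite lee_fin.
  exact: (cameron_martin mx sigma_neq0 indep_e law_e indep_xe mh mFE FE0).
have mF' : measurable_fun setT (fun w : Omega => F (w, e^~ w)).
  exact: (measurableT_comp mFr me').
have mL : measurable_fun setT llr by exact: measurable_log_likelihood_ratio.
have mCr : measurable_fun setT (\1_C : Omega -> R) by exact: measurable_indic.
have mexpL c : measurable_fun setT (fun w => expR (c * llr w)).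
  by apply: measurableT_comp => //; exact: measurable_funM.
have step4 : (\int[P]_w (F (w, e^~ w) * expR (llr w))%:E <=
   (expR tau)%:E * P E0 + (expR (- tau))%:E * \int[P]_w (\1_C w * expR (2 * llr w))%:E)%E.
  rewrite -(integral_real_indic P mE0).
  have m1 : measurable_fun setT (fun w => \1_C w * expR (2 * llr w)).
    exact: measurable_funM.
  have m0 : measurable_fun setT (\1_E0 : Omega -> R) by exact: measurable_indic.
  have p1 w : 0 <= \1_C w * expR (2 * llr w).
    by rewrite mulr_ge0// ?expR_ge0// indicE.
  have p0 w : 0 <= \1_E0 w :> R by rewrite indicE.
  rewrite -(ge0_integral_realZ P m0 (expR_ge0 _) p0) -(ge0_integral_realZ P m1 (expR_ge0 _) p1).
  rewrite -ge0_integral_realD; [|exact: measurable_funM|exact: measurable_funM|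
    by move=> w; rewrite mulr_ge0 ?expR_ge0|by move=> w; rewrite mulr_ge0 ?expR_ge0].
  apply: ge0_le_integral_real => //.
  - by apply: measurable_funM => //; exact: measurableT_comp.
  - by apply: measurable_funD; exact: measurable_funM.
  - by move=> w; rewrite mulr_ge0 ?expR_ge0.
  move=> w; rewrite /F /=.
  have -> : \1_B (w, e^~ w) = \1_E0 w :> R by [].
  set L := llr w.
  have key : expR L <= expR tau + expR (- tau) * expR (2 * L).
    have -> : expR (- tau) * expR (2 * L) = expR (L - tau) * expR L.
      by rewrite -!expRD; congr expR; ring.
    have [Lt|tL] := leP L tau.
      by rewrite (le_trans (y := expR tau)) ?ler_expR// lerDl mulr_ge0 ?expR_ge0.
    have : 1 <= expR (L - tau) by rewrite -expR0 ler_expR subr_ge0 ltW.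
    by have := expR_gt0 L; have := expR_gt0 tau; nra.
  rewrite !indicE; case: (w \in E0); case: (w \in C);
    rewrite /= ?(mulr1n, mulr0n) ?(mul0r, mulr0, mul1r, mulr1, addr0, add0r) ?mulr_ge0 ?expR_ge0//.
have step5 : (\int[P]_w (\1_C w * expR (2 * llr w))%:E <= (expR kappa)%:E)%E.
  pose f (w : Omega) := \1_C w * expR (H w / sigma ^+ 2).
  have mf : measurable_fun setT (f : generated x -> R).
    apply: measurable_funM => //; apply: measurableT_comp => //.
    exact: measurable_funM.
  have f0 w : 0 <= f w by rewrite mulr_ge0 ?expR_ge0// indicE.
  have m2h a : measurable_fun setT ((fun w => 2 * h a w) : generated x -> R).
    exact: measurable_funM.
  have -> : (\int[P]_w (\1_C w * expR (2 * llr w))%:E = \int[P]_w (f w)%:E)%E.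
    rewrite -(integral_likelihood_ratio m2h mf f0).
    apply: eq_integral => w _; rewrite /f -[in RHS]mulrA -expRD; congr (_ * expR _)%:E.
    rewrite /log_likelihood_ratio /H -mulrDl mulrA mulr_sumr -big_split /=.
    congr (_ / _); apply: eq_bigr => a _; by field.
  rewrite -(integral_real_cst P (expR kappa)); apply: ge0_le_integral_real => //.
    exact: (measurableT_comp mf mid).
  move=> w; rewrite /f indicE; have [Cw|nCw] := boolP (w \in C); last by rewrite mul0r expR_ge0.
  rewrite mul1r ler_expR ler_pdivrMr ?exprn_even_gt0//= mulrC.
  by move: Cw; rewrite inE.
apply: (le_trans step1); rewrite -addeA leeD2l// step2 step3; apply: (le_trans step4).
rewrite [X in (_ <= X)%E]addeC; apply: leeD2l.
rewrite expRD mulrC EFinM; apply: lee_wpmul2l => //.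
Qed.

End GaussianShift.

(** * Quadratic forms and extreme eigenvalues *)

Section Rayleigh.
Context {R : realType}.

Definition qform q (S : 'M[R]_q) (u : 'rV[R]_q) : R := (u *m S *m u^T) 0 0.

Lemma qformE q (S : 'M[R]_q) u : qform S u = \sum_a \sum_b u 0 a * u 0 b * S a b.
Proof.
rewrite /qform mxE exchange_big /=; apply: eq_bigr => b _.
rewrite !mxE big_distrl /=; apply: eq_bigr => a _.
by rewrite mulrAC.
Qed.

Definition sqnorm q (u : 'rV[R]_q) : R := \sum_a u 0 a ^+ 2.

Lemma sqnormE q (u : 'rV[R]_q) : sqnorm u = (u *m u^T) 0 0.
Proof. by rewrite mxE; apply: eq_bigr => a _; rewrite mxE expr2. Qed.

Lemma sqnorm_ge0 q (u : 'rV[R]_q) : 0 <= sqnorm u.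
Proof. by apply: sumr_ge0 => a _; exact: sqr_ge0. Qed.

Lemma sqnorm_eq0 q (u : 'rV[R]_q) : sqnorm u = 0 -> u = 0.
Proof.
move=> /eqP; rewrite psumr_eq0; last by move=> a _; exact: sqr_ge0.
move=> /allP u0; apply/rowP => a; rewrite mxE.
by have := u0 a (mem_index_enum a); rewrite sqrf_eq0 => /eqP.
Qed.

Lemma sqnormZ q c (u : 'rV[R]_q) : sqnorm (c *: u) = c ^+ 2 * sqnorm u.
Proof. by rewrite !sqnormE linearZ/= -scalemxAl -scalemxAr !mxE mulrA. Qed.

Lemma qformZ q (S : 'M[R]_q) c u : qform S (c *: u) = c ^+ 2 * qform S u.
Proof. by rewrite /qform linearZ/= -!scalemxAl -scalemxAr !mxE mulrA. Qed.

(** A function which vanishes at 0 and is nonnegative has slope zero there. *)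
Lemma linear_coef_eq0 (c e : R) : (forall t, 0 <= t * c + t ^+ 2 * e) -> c = 0.
Proof.
move=> H; apply/eqP; rewrite -sqrf_eq0 eq_le sqr_ge0 andbT.
have d0 : 0 < `|e| + 1 by rewrite ltr_wpDl.
pose y := c / (2 * (`|e| + 1)).
have cE : c = y * (2 * (`|e| + 1)) by rewrite divfK// mulf_neq0// gt_eqF.
have := H (- y); have := ler_norm e; rewrite cE => le.
have -> : - y * (y * (2 * (`|e| + 1))) + (- y) ^+ 2 * e = y ^+ 2 * (e - 2 * (`|e| + 1)) by ring.
have neg : e - 2 * (`|e| + 1) < 0 by have := normr_ge0 e; lra.
rewrite nmulr_lge0// => y2.
by rewrite exprMn pmulr_lle0// exprn_gt0// mulr_gt0.
Qed.

Lemma continuous_sum (T : topologicalType) (I : Type) (r : seq I) (f : I -> T -> R) :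
  (forall i, continuous (f i)) -> continuous (fun x => \sum_(i <- r) f i x).
Proof.
move=> cf; elim: r => [|i r IH] x.
  by under eq_fun do rewrite big_nil; exact: cvg_cst.
under eq_fun do rewrite big_cons.
by apply: cvgD; [exact: cf|exact: IH].
Qed.

(** The form attains its maximum on the compact unit sphere at some v. Its first
variation at v in every direction vanishes, that is, v is an eigenvector. *)
Lemma qform_max_eigenvalue q (S : 'M[R]_q) : (0 < q)%N -> S^T = S ->
  exists2 M, eigenvalue S M & forall u, qform S u <= M * sqnorm u.
Proof.
case: q S => [//|q] S _ symS.
pose A : set 'rV[R]_q.+1 := [set u | sqnorm u = 1].
have cont_sq : continuous (@sqnorm q.+1).
  apply: continuous_sum => a u; under eq_fun do rewrite expr2.
  by apply: continuousM; exact: coord_continuous.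
have cont_q : continuous (qform S).
  rewrite (_ : qform S = fun u => \sum_a \sum_b u 0 a * u 0 b * S a b); last first.
    by apply/funext => w; exact: qformE.
  apply: continuous_sum => a; apply: continuous_sum => b u.
  apply: (@continuousM R _ (fun w : 'rV[R]_q.+1 => w 0 a * w 0 b) (fun=> S a b) u).
    by apply: continuousM; exact: coord_continuous.
  exact: cst_continuous.
have A0 : A !=set0.
  exists (delta_mx 0 0); rewrite /A /= sqnormE trmx_delta mul_delta_mx.
  by rewrite mxE !eqxx.
have cA : compact A.
  apply: bounded_closed_compact.
    exists 1; split => // t t1 u Au; apply: (le_trans _ (ltW t1)).
    rewrite -[leLHS]/(mx_norm u) mx_normrE; apply: bigmax_le => // -[i a] _ /=.
    rewrite -(@ler_pXn2r _ 2) ?nnegrE// expr1n -normrX ger0_norm ?sqr_ge0//.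
    rewrite -Au /sqnorm (bigD1 a)//= ord1 lerDl.
    by apply: sumr_ge0 => b _; exact: sqr_ge0.
  rewrite (_ : A = @sqnorm q.+1 @^-1` [set 1])//.
  by apply: closed_comp => //; move=> u _; exact: cont_sq.
have cw : {within A, continuous (qform S)} by exact: continuous_subspaceT.
have [v Av vmax] := compact_EVT_max A0 cA cw.
rewrite inE in Av.
pose M := qform S v.
have maxM u : qform S u <= M * sqnorm u.
  have [u0|u0] := eqVneq (sqnorm u) 0.
    by rewrite u0 mulr0 (sqnorm_eq0 u0) /qform !mul0mx mxE.
  have up : 0 < sqnorm u by rewrite lt_neqAle eq_sym u0 sqnorm_ge0.
  have /vmax : (Num.sqrt (sqnorm u))^-1 *: u \in A.
    by rewrite inE /A /= sqnormZ exprVn sqr_sqrtr ?sqnorm_ge0// mulVf.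
  by rewrite qformZ exprVn sqr_sqrtr ?sqnorm_ge0// ler_pdivrMl// mulrC.
exists M => //; apply/eigenvalueP; exists v; last first.
  by apply/eqP => v0; move: Av; rewrite /A /= v0 sqnormE mul0mx mxE => /esym/eqP; rewrite oner_eq0.
pose r := M *: v - v *m S.
suff r0 : forall w : 'rV[R]_q.+1, (r *m w^T) 0 0 = 0.
  apply/esym/eqP; rewrite -subr_eq0; apply/eqP/sqnorm_eq0.
  by rewrite sqnormE; exact: r0.
move=> w; suff : 2 * (r *m w^T) 0 0 = 0.
  by move/eqP; rewrite mulf_eq0 pnatr_eq0 /= => /eqP.
apply: (@linear_coef_eq0 _ (M * sqnorm w - qform S w)) => t.
have := maxM (v + t *: w); rewrite -subr_ge0.
have swap : (w *m S *m v^T) 0 0 = (v *m S *m w^T) 0 0.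
  have -> : v *m S *m w^T = (w *m S *m v^T)^T.
    by rewrite !trmx_mul trmxK symS mulmxA.
  by rewrite [RHS]mxE.
have swap1 : (w *m v^T) 0 0 = (v *m w^T) 0 0.
  by rewrite -[in LHS](trmxK w) -trmx_mul mxE.
have vv : (v *m v^T) 0 0 = 1 by rewrite -sqnormE.
have add (B C : 'M[R]_1) : (B + C) 0 0 = B 0 0 + C 0 0 by rewrite mxE.
have opp (B : 'M[R]_1) : (- B) 0 0 = - B 0 0 by rewrite mxE.
have scal c (B : 'M[R]_1) : (c *: B) 0 0 = c * B 0 0 by rewrite mxE.
have rw : (r *m w^T) 0 0 = M * (v *m w^T) 0 0 - (v *m S *m w^T) 0 0.
  by rewrite /r mulmxBl -scalemxAl add opp scal.
move: ((r *m w^T) 0 0) rw => z ->.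
rewrite /qform !sqnormE [(v + t *: w)^T]raddfD/= linearZ/=.
rewrite !(mulmxDl, mulmxDr) -?(scalemxAl, scalemxAr) ?(mulmxDl, mulmxDr).
rewrite -?(scalemxAl, scalemxAr) !(add, opp, scal) swap swap1 vv.
rewrite -/(qform S v) -/M; lra.
Qed.

Lemma qform_le_lambda_max q (S : 'M[R]_q) u : (0 < q)%N -> S^T = S ->
  qform S u <= lambda_max S * sqnorm u.
Proof.
move=> q0 symS; have [M eM maxM] := qform_max_eigenvalue q0 symS.
apply: (le_trans (maxM u)); apply: ler_wpM2r; first exact: sqnorm_ge0.
apply: sup_upper_bound => //; split; first by exists M.
exists M => a /eigenvalueP[v va v0].
have v0' : 0 < sqnorm v.
  by rewrite lt_neqAle eq_sym sqnorm_ge0 andbT; apply: contraNneq v0 => /sqnorm_eq0 ->.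
have := maxM v; rewrite {1}/qform va -scalemxAl mxE -sqnormE.
by rewrite ler_pM2r.
Qed.

Lemma lambda_min_le_qform q (S : 'M[R]_q) u : (0 < q)%N -> S^T = S ->
  lambda_min S * sqnorm u <= qform S u.
Proof.
move=> q0 symS.
have symNS : (- S)^T = - S by rewrite raddfN/= symS.
have [M /eigenvalueP[v vM v0] maxM] := qform_max_eigenvalue q0 symNS.
have qN w : qform (- S) w = - qform S w by rewrite /qform mulmxN mulNmx mxE.
apply: (@le_trans _ _ (- M * sqnorm u)); last first.
  by have := maxM u; rewrite qN mulNr => h; rewrite lerNl.
apply: ler_wpM2r; first exact: sqnorm_ge0.
apply: inf_lbound; last first.
  apply/eigenvalueP; exists v => //.
  by rewrite scaleNr -vM mulmxN opprK.
exists (- M) => a /eigenvalueP[w wa w0].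
have w0' : 0 < sqnorm w.
  by rewrite lt_neqAle eq_sym sqnorm_ge0 andbT; apply: contraNneq w0 => /sqnorm_eq0 ->.
have := maxM w; rewrite qN {1}/qform wa -scalemxAl mxE -sqnormE.
by rewrite -mulNr ler_pM2r// lerNl.
Qed.

End Rayleigh.

(** * Projections of Gaussian vectors *)

Section GaussianVectors.
Context {R : realType} {d : measure_display} {Omega : measurableType d}.
Variable P : probability Omega R.
Implicit Types (Z : Omega -> R) (m s h t : R).

Lemma sqr_le_exp (x : R) : x ^+ 2 <= 4 * (expR x + expR (- x)).
Proof.
wlog x0 : x / 0 <= x => [hw|].
  have [/hw//|x0] := leP 0 x.
  by have := hw (- x); rewrite oppr_ge0 ltW// sqrrN opprK addrC => ->.
have h : 1 + x / 2 <= expR (x / 2) by exact: expR_ge1Dx.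
have e2 : expR x = expR (x / 2) ^+ 2 by rewrite expr2 -expRD -splitr.
have p : 0 <= expR (- x) by exact: expR_ge0.
by rewrite e2; nra.
Qed.

Lemma has_law_integrable_sqr Z m s : has_law P Z (normal_law m s) ->
  P.-integrable setT (EFin \o (fun w => Z w ^+ 2)).
Proof.
move=> lZ; have mZ : measurable_fun setT Z by case: lZ.
have mexp h : measurable_fun setT (fun w => expR (h * Z w)).
  by apply: measurableT_comp => //; exact: measurable_funM.
have mZ2 : measurable_fun setT (fun w => Z w ^+ 2) by exact: measurable_funX.
apply/integrableP; split; first exact/measurable_EFinP.
under eq_integral do rewrite gee0_abs ?lee_fin ?sqr_ge0//.
apply: (@le_lt_trans _ _ (\int[P]_w (4 * (expR (1 * Z w) + expR (-1 * Z w)))%:E)%E).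
  apply: ge0_le_integral_real => //.
  - by apply: measurable_funM => //; exact: measurable_funD.
  - by move=> w; exact: sqr_ge0.
  - by move=> w; rewrite mul1r mulN1r; exact: sqr_le_exp.
rewrite ge0_integral_realZ//.
- rewrite ge0_integral_realD//.
  by rewrite !(has_law_mgf _ lZ) -EFinD -EFinM ltry.
- exact: measurable_funD.
Qed.

Lemma integrable_mul_sqr (Z1 Z2 : Omega -> R) :
  measurable_fun setT Z1 -> measurable_fun setT Z2 ->
  P.-integrable setT (EFin \o (fun w => Z1 w ^+ 2)) ->
  P.-integrable setT (EFin \o (fun w => Z2 w ^+ 2)) ->
  P.-integrable setT (EFin \o (fun w => Z1 w * Z2 w)).
Proof.
move=> m1 m2 i1 i2.
apply: (le_integrable measurableT _ _ (integrableD measurableT i1 i2)).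
  by apply/measurable_EFinP; exact: measurable_funM.
move=> w _ /=; rewrite lee_fin normrM [leRHS]ger0_norm ?addr_ge0 ?sqr_ge0//.
rewrite -(real_normK (num_real (Z1 w))) -(real_normK (num_real (Z2 w))).
by have := normr_ge0 (Z1 w); have := normr_ge0 (Z2 w); nra.
Qed.

Lemma integrable_of_sqr Z : measurable_fun setT Z ->
  P.-integrable setT (EFin \o (fun w => Z w ^+ 2)) ->
  P.-integrable setT (EFin \o Z).
Proof.
move=> mZ iZ.
have i1 : P.-integrable setT (EFin \o (fun w : Omega => (1 : R) ^+ 2)).
  by apply: finite_measure_integrable_cst.
have := integrable_mul_sqr mZ (measurable_cst (1 : R)) iZ i1.
by apply: eq_integrable => // w _; rewrite /= mulr1.
Qed.

(** Integrating 1 + h Z <= exp(h Z) against the explicit generating function gives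
0 <= h m + h^2 s^2 / 2 for every h, hence m = 0. *)
Lemma has_law_centered_mean0 Z m s : has_law P Z (normal_law m s) ->
  (\int[P]_w (Z w)%:E = 0)%E -> m = 0.
Proof.
move=> lZ EZ; have mZ : measurable_fun setT Z by case: lZ.
have iZ := integrable_of_sqr mZ (has_law_integrable_sqr lZ).
have H h : 0 <= h * m + h ^+ 2 * (s ^+ 2 / 2).
  have : (1%:E <= (expR (h * m + s ^+ 2 * h ^+ 2 / 2))%:E)%E.
    rewrite -(has_law_mgf h lZ).
    have ilin : P.-integrable setT (EFin \o (fun w => 1 + h * Z w)).
      apply: (@eq_integrable _ _ _ _ _ measurableT (fun w => 1%:E + h%:E * (Z w)%:E)%E) => //.
      apply: integrableD => //; last exact: integrableZl.
      exact: finite_measure_integrable_cst.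
    have E1 : (\int[P]_w (1 + h * Z w)%:E = 1%:E)%E.
      under eq_integral do rewrite EFinD EFinM.
      rewrite integralD//; last 2 first.
        exact: finite_measure_integrable_cst.
        exact: integrableZl.
      by rewrite integralZl// EZ mule0 adde0 integral_real_cst.
    rewrite -[leLHS]E1; apply: le_integral => //.
      apply/integrableP; split.
        by apply/measurable_EFinP/measurableT_comp => //; exact: measurable_funM.
      under eq_integral do rewrite gee0_abs ?lee_fin ?expR_ge0//.
      by rewrite (has_law_mgf h lZ) ltry.
    by move=> w _; rewrite lee_fin expR_ge1Dx.
  by rewrite lee_fin -{1}expR0 ler_expR mulrA (mulrC (h ^+ 2)).
exact: (linear_coef_eq0 H).
Qed.

(** The random variable t Z^2 lies between 1 - exp(- t Z^2) and exp(t Z^2) - 1, whose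
means are explicit and equivalent to t s^2 as t tends to 0. *)
Lemma has_law_sqr_integral Z s : has_law P Z (normal_law 0 s) ->
  (\int[P]_w (Z w ^+ 2)%:E = (s ^+ 2)%:E)%E.
Proof.
move=> lZ; have mZ : measurable_fun setT Z by case: lZ.
have iZ := has_law_integrable_sqr lZ.
have finM := integrable_fin_num measurableT iZ.
have mZ2 : measurable_fun setT (fun w => Z w ^+ 2) by exact: measurable_funX.
have me t : measurable_fun setT (fun w => expR (t * Z w ^+ 2)).
  by apply: measurableT_comp => //; exact: measurable_funM.
rewrite -(fineK finM); set M := fine _; congr EFin.
have ME : (\int[P]_w (Z w ^+ 2)%:E = M%:E)%E by rewrite fineK.
have lin t : 0 <= t -> (\int[P]_w (t * Z w ^+ 2)%:E = (t * M)%:E)%E.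
  by move=> t0; rewrite ge0_integral_realZ// ?ME// => w; exact: sqr_ge0.
have tZ0 t w : 0 <= t -> 0 <= t * Z w ^+ 2 by move=> t0; rewrite mulr_ge0 ?sqr_ge0.
have mt t : measurable_fun setT (fun w => t * Z w ^+ 2) by exact: measurable_funM.
have up t : 0 < t -> 2 * t * s ^+ 2 < 1 -> t * M + 1 <= (Num.sqrt (1 - 2 * t * s ^+ 2))^-1.
  move=> t0 ts; rewrite -lee_fin -(has_law_exp_sqr lZ) ?subr_gt0//.
  rewrite EFinD -(lin _ (ltW t0)) -(integral_real_cst P 1) -ge0_integral_realD//; last first.
    by move=> w; exact/tZ0/ltW.
  apply: ge0_le_integral_real => //.
  - exact: measurable_funD.
  - by move=> w; rewrite addr_ge0// tZ0// ltW.
  - by move=> w; rewrite addrC expR_ge1Dx.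
have dn t : 0 < t -> 1 <= t * M + (Num.sqrt (1 + 2 * t * s ^+ 2))^-1.
  move=> t0; have ts : 0 < 1 - 2 * - t * s ^+ 2.
    by have := mulr_ge0 (ltW t0) (sqr_ge0 s); nra.
  have -> : 1 + 2 * t * s ^+ 2 = 1 - 2 * - t * s ^+ 2 by rewrite mulrN mulNr opprK.
  rewrite -lee_fin EFinD -(has_law_exp_sqr lZ ts).
  rewrite -(lin _ (ltW t0)) -(integral_real_cst P 1) -ge0_integral_realD//; last first.
    by move=> w; exact/tZ0/ltW.
  apply: ge0_le_integral_real => //; first exact: measurable_funD.
  by move=> w; have := expR_ge1Dx (- t * Z w ^+ 2); rewrite mulNr; lra.
have M0 : 0 <= M.
  by apply: fine_ge0; apply: integral_ge0 => w _; rewrite lee_fin sqr_ge0.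
have s20 : 0 <= s ^+ 2 by exact: sqr_ge0.
have upper t : 0 < t -> 2 * t * s ^+ 2 < 1 -> M <= s ^+ 2 + t * (2 * s ^+ 2 * M).
  move=> t0 ts; have := up t t0 ts; set r := Num.sqrt _.
  have c0 : 0 < 1 - 2 * t * s ^+ 2 by rewrite subr_gt0.
  have r0 : 0 < r by rewrite sqrtr_gt0.
  have r2 : r ^+ 2 = 1 - 2 * t * s ^+ 2 by rewrite sqr_sqrtr// ltW.
  have y0 : 0 <= t * s ^+ 2 by rewrite mulr_ge0// ltW.
  have ry : r <= 1 - t * s ^+ 2.
    rewrite -(@ler_pXn2r _ 2) ?nnegrE// ?(ltW r0)//; last by lra.
    by rewrite r2; nra.
  rewrite -[_^-1]mul1r ler_pdivlMr// => h.
  have : (t * M + 1) * (1 - 2 * t * s ^+ 2) <= r.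
    by rewrite -r2 expr2 mulrA -[leRHS]mul1r ler_pM2r.
  move=> h2; rewrite -(ler_pM2l t0); lra.
have lower t : 0 < t -> s ^+ 2 <= M + t * (2 * s ^+ 2 * M).
  move=> t0; have := dn t t0; set r := Num.sqrt _.
  have y0 : 0 <= t * s ^+ 2 by rewrite mulr_ge0// ltW.
  have c0 : 0 < 1 + 2 * t * s ^+ 2 by lra.
  have r0 : 0 < r by rewrite sqrtr_gt0.
  have r2 : r ^+ 2 = 1 + 2 * t * s ^+ 2 by rewrite sqr_sqrtr// ltW.
  have ry : r <= 1 + t * s ^+ 2.
    rewrite -(@ler_pXn2r _ 2) ?nnegrE// ?(ltW r0)//; last by lra.
    by rewrite r2; nra.
  rewrite -lerBlDl -[_^-1]mul1r ler_pdivlMr// => h.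
  have : (1 - t * M) * (1 + 2 * t * s ^+ 2) <= r.
    by rewrite -r2 expr2 mulrA -[leRHS]mul1r ler_pM2r.
  move=> h2; rewrite -(ler_pM2l t0); lra.
have small (e : R) : 0 < e ->
    exists t, [/\ 0 < t, 2 * t * s ^+ 2 < 1 & t * (2 * s ^+ 2 * M) <= e].
  move=> e0; pose c := 2 * s ^+ 2 * (M + 1) + 1.
  have sM : 0 <= s ^+ 2 * M by rewrite mulr_ge0.
  have c1 : 0 < c by rewrite /c; lra.
  exists (Num.min e (1 / 2) / c); split.
  - by rewrite divr_gt0// lt_min e0 divr_gt0.
  - rewrite mulrAC mulrA ltr_pdivrMr//.
    have : Num.min e (1 / 2) <= 1 / 2 by rewrite ge_min lexx orbT.
    rewrite /c; nra.
  - rewrite mulrAC ler_pdivrMr//.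
    have : Num.min e (1 / 2) <= e by rewrite ge_min lexx.
    have : 0 < Num.min e (1 / 2) by rewrite lt_min e0 divr_gt0.
    rewrite /c; nra.
apply/eqP; rewrite eq_le; apply/andP; split; apply/ler_addgt0Pr => e /small[t [t0 t1 te]].
- by apply: (le_trans (upper t t0 t1)); rewrite lerD2l.
- by apply: (le_trans (lower t t0)); rewrite lerD2l.
Qed.

End GaussianVectors.

Section GaussianProjections.
Context {R : realType} {d : measure_display} {Omega : measurableType d}.
Variables (P : probability Omega R) (q : nat) (V : Omega -> 'rV[R]_q) (S : 'M[R]_q).
Hypothesis gV : gaussian_vector P V.

Lemma gaussian_vector_entry a : exists m s, has_law P (fun w => V w 0 a) (normal_law m s).
Proof.
have [m [s law]] := gV (delta_mx a 0); exists m, s.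
suff <- : (fun w => (V w *m delta_mx a (0 : 'I_1)) 0 0) = (fun w => V w 0 a) by [].
by apply/funext => w; rewrite -colE mxE.
Qed.

Lemma gaussian_vector_measurable a : measurable_fun setT (fun w => V w 0 a).
Proof. by have [m [s []]] := gaussian_vector_entry a. Qed.

Lemma has_covariance_sym : has_covariance P V S -> S^T = S.
Proof.
by move=> cS; apply/matrixP => a b; rewrite mxE; apply: EFin_inj; rewrite -!cS covarianceC.
Qed.

Hypothesis cV : centered P V.
Hypothesis covS : has_covariance P V S.

Let iV2 a : P.-integrable setT (EFin \o (fun w => V w 0 a ^+ 2)).
Proof. by have [m [s]] := gaussian_vector_entry a; exact: has_law_integrable_sqr. Qed.

Let iV a : P.-integrable setT (EFin \o (fun w => V w 0 a)).
Proof. exact: (integrable_of_sqr (gaussian_vector_measurable a) (iV2 a)). Qed.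

Let iVV a b : P.-integrable setT (EFin \o (fun w => V w 0 a * V w 0 b)).
Proof.
exact: (integrable_mul_sqr (gaussian_vector_measurable a) (gaussian_vector_measurable b)).
Qed.

Let EVV a b : (\int[P]_w (V w 0 a * V w 0 b)%:E = (S a b)%:E)%E.
Proof.
have l1 c : (fun w => V w 0 c) \in Lfun P 1 by exact/Lfun1_integrable.
rewrite -covS covarianceE//; last by apply/Lfun1_integrable; exact: iVV.
by rewrite !cV mule0 sube0 unlock.
Qed.

(** The definition of a Gaussian vector leaves the parameters of each projection open;
centering and the covariance matrix determine them. *)
Lemma gaussian_vector_projection (u : 'cV[R]_q) :
  exists2 s, has_law P (fun w => (V w *m u) 0 0) (normal_law 0 s) & s ^+ 2 = qform S u^T.
Proof.
have [m [s law]] := gV u.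
have E0 : (\int[P]_w ((V w *m u) 0 0)%:E = 0)%E.
  transitivity (\sum_a \int[P]_w ((u a 0)%:E * (V w 0 a)%:E))%E.
    rewrite -integral_sum//; last by move=> a; apply: integrableZl => //; exact: iV.
    apply: eq_integral => w _; rewrite mxE -sumEFin; apply: eq_bigr => a _.
    by rewrite mulrC EFinM.
  rewrite big1// => a _; rewrite integralZl//; last exact: iV.
  by have := cV a; rewrite unlock => ->; rewrite mule0.
have m0 := has_law_centered_mean0 law E0; subst m; exists s => //.
apply: EFin_inj; rewrite -(has_law_sqr_integral law).
transitivity (\sum_a \sum_b \int[P]_w ((u a 0 * u b 0)%:E * (V w 0 a * V w 0 b)%:E))%E.
  under [RHS]eq_bigr => a _.
    rewrite -integral_sum//; last by move=> b; apply: integrableZl => //; exact: iVV.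
    over.
  rewrite -integral_sum//; last first.
    move=> a; apply: integrable_sum => // b _; apply: integrableZl => //; exact: iVV.
  apply: eq_integral => w _.
  under eq_bigr do rewrite sumEFin.
  rewrite sumEFin; congr EFin; rewrite mxE expr2 mulr_suml; apply: eq_bigr => a _.
  rewrite mulr_sumr; apply: eq_bigr => b _; ring.
rewrite qformE -sumEFin; apply: eq_bigr => a _; rewrite -sumEFin; apply: eq_bigr => b _.
by rewrite integralZl//; [rewrite EVV -EFinM !mxE|exact: iVV].
Qed.

End GaussianProjections.

(** * The regression model and its likelihood *)

Section TensorRows.
Context {R : realType} {m p : nat}.
Implicit Types (A B : tensor R m p) (X : 'M[R]_(m, p)).

(** Coordinate k of the inner product only involves this row of the tensor, in the order
of entries used by [vec]. *)
Definition row_vector A (k : 'I_m) : 'rV[R]_(p * m) :=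
  mxvec (\matrix_(j < p, l < m) A j k l).

Lemma mxvec_dot a b (M N : 'M[R]_(a, b)) :
  (mxvec M *m (mxvec N)^T) 0 0 = \sum_i \sum_j M i j * N i j.
Proof.
rewrite mxE (reindex _ (curry_mxvec_bij _ _)) /= pair_bigA /=.
by apply: eq_bigr => -[i j] _ /=; rewrite mxE !mxvecE.
Qed.

Lemma inner_row_vector A X k : inner A X k 0 = (vec X *m (row_vector A k)^T) 0 0.
Proof.
rewrite mxvec_dot mxE; apply: eq_bigr => j _; apply: eq_bigr => l _.
by rewrite !mxE.
Qed.

Lemma sqnorm_row_vector A k : sqnorm (row_vector A k) = \sum_(j < p) \sum_(l < m) A j k l ^+ 2.
Proof.
rewrite sqnormE mxvec_dot; apply: eq_bigr => j _; apply: eq_bigr => l _.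
by rewrite !mxE expr2.
Qed.

Lemma frobenius_sqr A : frobenius A ^+ 2 = \sum_j \sum_k \sum_l A j k l ^+ 2.
Proof.
rewrite sqr_sqrtr//; apply: sumr_ge0 => j _; apply: sumr_ge0 => k _.
by apply: sumr_ge0 => l _; exact: sqr_ge0.
Qed.

Lemma frobenius_mx_sqr a b (M : 'M[R]_(a, b)) :
  frobenius_mx M ^+ 2 = \sum_k \sum_l M k l ^+ 2.
Proof.
rewrite sqr_sqrtr//; apply: sumr_ge0 => k _.
by apply: sumr_ge0 => l _; exact: sqr_ge0.
Qed.

Lemma frobenius_rows A : frobenius A ^+ 2 = \sum_k sqnorm (row_vector A k).
Proof.
rewrite frobenius_sqr exchange_big /=; apply: eq_bigr => k _.
by rewrite sqnorm_row_vector.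
Qed.

Lemma frobenius_slices A : frobenius A ^+ 2 = \sum_j frobenius_mx (A j) ^+ 2.
Proof. by rewrite frobenius_sqr; apply: eq_bigr => j _; rewrite frobenius_mx_sqr. Qed.

Lemma innerD A B X : inner (A + B) X = inner A X + inner B X.
Proof.
apply/colP => k; rewrite !mxE -big_split; apply: eq_bigr => j _ /=.
by rewrite -big_split; apply: eq_bigr => l _ /=; rewrite ffunE mxE mulrDr.
Qed.

Lemma innerN A X : inner (- A) X = - inner A X.
Proof.
apply/colP => k; rewrite !mxE -sumrN; apply: eq_bigr => j _ /=.
by rewrite -sumrN; apply: eq_bigr => l _ /=; rewrite ffunE mxE mulrN.
Qed.

Lemma innerB A B X : inner (A - B) X = inner A X - inner B X.
Proof. by rewrite innerD innerN. Qed.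

Lemma innerZ c A X : inner (c *: A) X = c *: inner A X.
Proof.
apply/colP => k; rewrite !mxE mulr_sumr; apply: eq_bigr => j _ /=.
by rewrite mulr_sumr; apply: eq_bigr => l _ /=; rewrite ffunE mxE mulrCA.
Qed.

End TensorRows.

Definition data_coordinate {R : realType} n m p (c : 'I_n * 'I_m * 'I_p + 'I_n * 'I_m)
    (D : dataset R n m p) : R :=
  match c with inl (i, l, j) => (D i).1 l j | inr (i, k) => (D i).2 k 0 end.

Section Model.
Context {R : realType} {d : measure_display} {Omega : measurableType d}.
Variables (P : probability Omega R) (n m p : nat) (cl cu sigma : R).
Variables (S : 'M[R]_(p * m)).
Variables (X : 'I_n -> Omega -> 'M[R]_(m, p)) (eps : 'I_n -> Omega -> 'cV[R]_m).
Hypothesis model : regression_model P cl cu sigma S X eps.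
Hypotheses (m_gt0 : (0 < m)%N) (p_gt0 : (0 < p)%N).

Definition covariate_entry (ilj : 'I_n * 'I_m * 'I_p) (w : Omega) : R :=
  X ilj.1.1 w ilj.1.2 ilj.2.

Definition noise_entry (ik : 'I_n * 'I_m) (w : Omega) : R := eps ik.1 w ik.2 0.

Lemma inner_law_qform (A : tensor R m p) i k :
  exists2 s, has_law P (fun w => inner A (X i w) k 0) (normal_law 0 s)
    & s ^+ 2 = qform S (row_vector A k).
Proof.
case: model => [_ [[_ gX] _ _]]; have [gXi cXi covXi] := gX i.
have [s law sE] := gaussian_vector_projection gXi cXi covXi (row_vector A k)^T.
exists s; last by rewrite sE trmxK.
suff -> : (fun w => inner A (X i w) k 0) = (fun w => (vec (X i w) *m (row_vector A k)^T) 0 0) by [].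
by apply/funext => w; exact: inner_row_vector.
Qed.

Lemma row_qform_bounds (i : 'I_n) (A : tensor R m p) k :
  cl ^+ 2 * sqnorm (row_vector A k) <= qform S (row_vector A k)
    <= cu ^+ 2 * sqnorm (row_vector A k).
Proof.
case: model => [[cl_min _ max_cu] [[_ gX] _ _]]; have [_ _ covXi] := gX i.
have symS := has_covariance_sym covXi.
have pm0 : (0 < p * m)%N by rewrite muln_gt0 p_gt0.
apply/andP; split.
- apply: le_trans (lambda_min_le_qform _ pm0 symS).
  by apply: ler_wpM2r => //; exact: sqnorm_ge0.
- apply: (le_trans (qform_le_lambda_max _ pm0 symS)).
  by apply: ler_wpM2r => //; exact: sqnorm_ge0.
Qed.

Lemma covariate_measurable ilj : measurable_fun setT (covariate_entry ilj).
Proof.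
case: ilj => [[i l] j]; case: model => [_ [[_ gX] _ _]].
have [gXi _ _] := gX i.
have := gaussian_vector_measurable gXi (mxvec_index j l).
rewrite (_ : (fun w => vec (X i w) 0 (mxvec_index j l)) = covariate_entry (i, l, j))//.
by apply/funext => w; rewrite /vec mxvecE mxE.
Qed.

Lemma noise_law ik : has_law P (noise_entry ik) (normal_law 0 sigma).
Proof. by case: model => [_ [_ [_ lawe] _]]; exact: lawe. Qed.

Lemma noise_independent :
  mutually_independent P (fun a => sigma_gen (fun _ : unit => noise_entry a)).
Proof. by case: model => [_ [_ [inde _] _]]. Qed.

Lemma noise_covariate_independent :
  independent2 P (sigma_gen covariate_entry) (sigma_gen noise_entry).
Proof. by case: model => [_ [_ _ ?]]. Qed.

Lemma inner_generated_measurable (A : tensor R m p) i k :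
  measurable_fun setT ((fun w => inner A (X i w) k 0) : generated covariate_entry -> R).
Proof.
under eq_fun do rewrite mxE.
apply: measurable_sum => j; apply: measurable_sum => l; apply: measurable_funM => //.
exact: (measurable_generator covariate_entry (i, l, j)).
Qed.

Definition data_of (T : tensor R m p) (w : Omega) (y : 'I_n * 'I_m -> R) : dataset R n m p :=
  fun i => (X i w, inner T (X i w) + \col_k y (i, k)).

Lemma data_of_measurable T :
  measurable_fun setT
   ((fun z => data_of T z.1 z.2) :
     generated covariate_entry * generated (@coordinates R ('I_n * 'I_m)) ->
     generated (@data_coordinate R n m p)).
Proof.
apply: measurable_to_generated => -[[[i l] j]|[i k]] /=.
  exact: (measurableT_comp (measurable_generator covariate_entry (i, l, j)) measurable_fst).
rewrite [F in measurable_fun _ F](_ : _ = (fun z => inner T (X i z.1) k 0 + z.2 (i, k))); last first.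
  by apply/funext => z; rewrite mxE [Y in _ + Y]mxE.
apply: measurable_funD.
  exact: (measurableT_comp (inner_generated_measurable T i k) measurable_fst).
exact: (measurableT_comp (measurable_generator (@coordinates R _) (i, k)) measurable_snd).
Qed.

Lemma inner_sqr_integral (A : tensor R m p) i k :
  (\int[P]_w (inner A (X i w) k 0 ^+ 2)%:E <= (cu ^+ 2 * sqnorm (row_vector A k))%:E)%E.
Proof.
have [s law sE] := inner_law_qform A i k; have /andP[_ le_q] := row_qform_bounds i A k.
by rewrite (has_law_sqr_integral law) lee_fin sE.
Qed.

(** The observations under T are those under T0 with the noise shifted by <T - T0, X>,
whose expected squared norm is at most n cu^2 |T - T0|_F^2; Markov bounds the
probability that the shift is too large. *)
Lemma data_law_change (T T0 : tensor R m p) (A : set (dataset R n m p)) (kappa tau : R) :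
  data_measurable A -> 0 < sigma -> 0 < kappa ->
  (data_law P X eps T A <=
   (n%:R * cu ^+ 2 * frobenius (T - T0) ^+ 2 / (sigma ^+ 2 * kappa) + expR (kappa - tau))%:E
   + (expR tau)%:E * data_law P X eps T0 A)%E.
Proof.
move=> mA sigma0 kappa0.
pose h (ik : 'I_n * 'I_m) (w : Omega) := inner (T - T0) (X ik.1 w) ik.2 0.
have mh a : measurable_fun setT (h a : generated covariate_entry -> R).
  exact: inner_generated_measurable.
have mid : measurable_fun setT (idfun : Omega -> generated covariate_entry).
  by apply: measurable_to_generated => j; exact: covariate_measurable.
have mhO a : measurable_fun setT (h a) by exact: (measurableT_comp (mh a) mid).
pose B : set (generated covariate_entry * generated (@coordinates R ('I_n * 'I_m))) :=
  [set z | A (data_of T0 z.1 z.2)].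
have mB : measurable B.
  by rewrite -[B]setTI; exact: (data_of_measurable T0 measurableT mA).
have := shift_probability_le covariate_measurable (lt0r_neq0 sigma0) noise_independent
  noise_law noise_covariate_independent mh kappa tau mB.
have -> : [set w | B (w, fun a => noise_entry a w + h a w)%R] =
    (fun w i => (X i w, response T X eps i w)) @^-1` A.
  have dataE w : data_of T0 w (fun a => noise_entry a w + h a w) = (fun i => (X i w, response T X eps i w)).
    apply/funext => i; congr (_, _); apply/colP => k.
    by rewrite /response !mxE /h /noise_entry innerB !mxE; lra.
  by apply/seteqP; split => w; rewrite /B /= dataE.
have -> : [set w | B (w, (@noise_entry)^~ w)] = (fun w i => (X i w, response T0 X eps i w)) @^-1` A.
  have dataE w : data_of T0 w (noise_entry^~ w) = (fun i => (X i w, response T0 X eps i w)).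
    apply/funext => i; congr (_, _); apply/colP => k.
    by rewrite /response !mxE /noise_entry.
  by apply/seteqP; split => w; rewrite /B /= dataE.
move=> le; apply: (le_trans le).
rewrite EFinD; apply: leeD => //; apply: leeD => //.
pose H (w : Omega) := (\sum_a h a w ^+ 2) / (sigma ^+ 2 * kappa).
have c0 : 0 < sigma ^+ 2 * kappa by rewrite mulr_gt0// exprn_gt0.
have msum : measurable_fun setT (fun w => \sum_a h a w ^+ 2).
  by apply: measurable_sum => a; exact: measurable_funX.
have mH : measurable_fun setT H by exact: measurable_funM.
have mE : measurable [set w | sigma ^+ 2 * kappa < \sum_a h a w ^+ 2].
  exact: measurable_lt_set.
have sum0 w : 0 <= \sum_a h a w ^+ 2 by apply: sumr_ge0 => a _; exact: sqr_ge0.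
apply: (le_trans (probability_le_integral (g := H) P mE mH _ _)).
- by move=> w; rewrite divr_ge0// ltW.
- by move=> w /=; rewrite /H ler_pdivlMr// mul1r => /ltW.
rewrite /H; under eq_integral do rewrite mulrC.
rewrite ge0_integral_realZ; [|exact: msum|by rewrite invr_ge0 ltW|exact: sum0].
rewrite [Y in (_ <= Y%:E)%E]mulrC EFinM; apply: lee_wpmul2l; first by rewrite lee_fin invr_ge0 ltW.
under eq_integral do rewrite -sumEFin.
rewrite ge0_integral_sum//; last 2 first.
- by move=> a; apply/measurable_EFinP; exact: measurable_funX.
- by move=> a w _; rewrite lee_fin sqr_ge0.
apply: (@le_trans _ _ (\sum_(a : 'I_n * 'I_m) (cu ^+ 2 * sqnorm (row_vector (T - T0) a.2))%:E)%E).
  by apply: lee_sum => a _; exact: inner_sqr_integral.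
rewrite sumEFin lee_fin -(pair_bigA _ (fun (i : 'I_n) k => cu ^+ 2 * sqnorm (row_vector (T - T0) k)))/=.
rewrite sumr_const card_ord frobenius_rows -mulr_sumr.
by rewrite -mulrA mulr_natl.
Qed.

End Model.

Section Averaging.
Context {R : realFieldType} {I Q : finType}.

Definition update (theta : {ffun I -> Q}) (i : I) (q : Q) : {ffun I -> Q} :=
  [ffun j => if j == i then q else theta j].

(** Resampling coordinate i of a uniform theta: (theta, q) |-> (theta with theta_i
replaced by q, theta_i) is an involution. *)
Lemma sum_resample (i : I) (g : {ffun I -> Q} -> Q -> R) :
  (forall theta q q', g (update theta i q') q = g theta q) ->
  #|Q|%:R * \sum_theta g theta (theta i) = \sum_theta \sum_q g theta q.
Proof.
move=> gi.
transitivity (\sum_theta \sum_(q : Q) g theta (theta i)).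
  rewrite mulr_sumr; apply: eq_bigr => theta _.
  by rewrite sumr_const mulr_natl.
rewrite !pair_bigA /=.
pose phi (z : {ffun I -> Q} * Q) := (update z.1 i z.2, z.1 i).
have phiK : involutive phi.
  move=> [theta q]; rewrite /phi /=; congr (_, _); last by rewrite ffunE eqxx.
  by apply/ffunP => j; rewrite !ffunE; case: eqP => [->|].
rewrite (reindex_inj (inv_inj phiK)) /=; apply: eq_bigr => -[theta q] _ /=.
by rewrite ffunE eqxx gi.
Qed.

Lemma exists_le_average (T : finType) (f : T -> R) (c : R) : (0 < #|T|)%N ->
  \sum_x f x <= #|T|%:R * c -> exists x, f x <= c.
Proof.
move=> T0 le; apply/existsP; rewrite -[X in is_true X]negbK negb_exists.
apply/negP => /forallP h.
have /card_gt0P[x0 _] := T0.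
suff : #|T|%:R * c < \sum_x f x by rewrite ltNge le.
rewrite mulr_natl -sumr_const (bigD1 x0)//= [ltRHS](bigD1 x0)//=.
apply: ltr_leD; first by rewrite ltNge h.
by apply: ler_sum => x _; rewrite ltW// ltNge h.
Qed.

End Averaging.

Section ProductPrior.
Context {R : realType} {d : measure_display} {Omega : measurableType d}.
Variables (P : probability Omega R) (n m p : nat) (cl cu sigma : R).
Variables (S : 'M[R]_(p * m)).
Variables (X : 'I_n -> Omega -> 'M[R]_(m, p)) (eps : 'I_n -> Omega -> 'cV[R]_m).
Hypothesis model : regression_model P cl cu sigma S X eps.
Hypotheses (m_gt0 : (0 < m)%N) (p_gt0 : (0 < p)%N) (sigma_gt0 : 0 < sigma).

Local Notation data T := (fun w i => (X i w, response T X eps i w)).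

Lemma data_preimage_measurable (T : tensor R m p) (A : set (dataset R n m p)) :
  data_measurable A -> measurable (data T @^-1` A).
Proof.
move=> mA.
have mdata : measurable_fun setT (data T : Omega -> generated (@data_coordinate R n m p)).
  apply: measurable_to_generated => -[[[i l] j]|[i k]] /=.
    exact: (covariate_measurable model (i, l, j)).
  rewrite [F in measurable_fun _ F](_ : _ = (fun w => inner T (X i w) k 0 + noise_entry eps (i, k) w)); last first.
    by apply/funext => w; rewrite mxE.
  apply: measurable_funD; last by case: (noise_law model (i, k)).
  by have [s []] := inner_law_qform model T i k.
by rewrite -[_ @^-1` _]setTI; exact: (mdata measurableT A mA).
Qed.

Lemma sum_disjoint_probability_le1 (Q : finType) (A : Q -> set Omega) :
  (forall q, measurable (A q)) -> (forall q q' w, A q w -> A q' w -> q = q') ->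
  \sum_q fine (P (A q)) <= 1.
Proof.
move=> mA dA; rewrite -lee_fin -sumEFin.
under eq_bigr do rewrite fineK ?fin_num_measure// -(integral_real_indic P)//.
rewrite -ge0_integral_sum; [|by []|
  by move=> q; apply/measurable_EFinP; exact: measurable_indic|
  by move=> q w _; rewrite lee_fin indicE].
rewrite -(integral_real_cst P 1).
under eq_integral do rewrite sumEFin.
apply: ge0_le_integral_real => //.
- by apply: measurable_sum => q; exact: measurable_indic.
- by move=> w; apply: sumr_ge0 => q _; rewrite indicE.
move=> w; have [[q Aqw]|nA] := pselect (exists q, A q w).
  rewrite (bigD1 q)//= indicE mem_set//= big1 ?addr0// => q' q'q.
  rewrite indicE memNset// => Aq'w; move: q'q; rewrite (dA _ _ _ Aqw Aq'w).
  by rewrite eqxx.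
rewrite big1// => q _; rewrite indicE memNset// => Aqw; apply: nA; by exists q.
Qed.

Variables (I Q : finType) (t : I -> Q -> tensor R m p) (C : I -> Q -> set (dataset R n m p)).
Hypotheses (I_gt0 : (0 < #|I|)%N) (Q_gt0 : (0 < #|Q|)%N).
Hypothesis mC : forall i q, data_measurable (C i q).
Hypothesis disjC : forall i q q' D, C i q D -> C i q' D -> q = q'.

Definition composite (theta : {ffun I -> Q}) : tensor R m p := \sum_i t i (theta i).

(** The parameter with block i removed does not depend on theta_i, so for it the disjoint
events C i q have average probability at most 1 / #letters. The change of measure
carries this over to the parameter with the block, and some theta does at least as
badly as the average. *)
Lemma exists_hard_parameter (kappa tau : R) : 0 < kappa ->
  (forall i q, n%:R * cu ^+ 2 * frobenius (t i q) ^+ 2 / (sigma ^+ 2 * kappa)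
     + expR (kappa - tau) + expR tau / #|Q|%:R <= 4^-1) ->
  exists theta, \sum_i fine (data_law P X eps (composite theta) (C i (theta i)))
     <= #|I|%:R / 4.
Proof.
move=> kappa0 hyp.
have finP T A : data_measurable A -> data_law P X eps T A \is a fin_num.
  by move=> mA; apply: fin_num_measure; exact: data_preimage_measurable.
pose pr T A := fine (data_law P X eps T A).
have Q0 : 0 < #|Q|%:R :> R by rewrite ltr0n.
apply: exists_le_average; first by rewrite card_ffun expn_gt0 Q_gt0.
rewrite exchange_big /= mulrCA -[#|I|%:R]/(#|I|%:R) mulr_natl -sumr_const.
apply: ler_sum => i _.
pose t0 theta : tensor R m p := \sum_(j | j != i) t j (theta j).
have split theta : composite theta - t0 theta = t i (theta i).
  by rewrite /composite (bigD1 i)//= addrK.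
pose alpha q := n%:R * cu ^+ 2 * frobenius (t i q) ^+ 2 / (sigma ^+ 2 * kappa) + expR (kappa - tau).
have step theta : pr (composite theta) (C i (theta i)) <=
    alpha (theta i) + expR tau * pr (t0 theta) (C i (theta i)).
  rewrite -lee_fin EFinD EFinM /pr !fineK; [|exact: finP|exact: finP].
  by rewrite /alpha -split; exact: (data_law_change model).
apply: (le_trans (ler_sum _ (fun theta _ => step theta))).
pose g theta q := alpha q + expR tau * pr (t0 theta) (C i q).
have := @sum_resample _ _ _ i g.
have gi theta q q' : g (update theta i q') q = g theta q.
  rewrite /g.
  suff -> : t0 (update theta i q') = t0 theta by [].
  by apply: eq_bigr => j ji; rewrite ffunE (negbTE ji).
move=> /(_ gi) sumg; rewrite -(ler_pM2l Q0) sumg.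
apply: (@le_trans _ _ (\sum_(theta : {ffun I -> Q}) (#|Q|%:R / 4))); last first.
  by rewrite sumr_const -[leLHS]mulr_natl mulrCA.
apply: ler_sum => theta _; rewrite /g big_split /= -mulr_sumr.
have le1 : \sum_q pr (t0 theta) (C i q) <= 1.
  apply: (@sum_disjoint_probability_le1 Q (fun q => data (t0 theta) @^-1` C i q)).
    by move=> q; exact: data_preimage_measurable.
  by move=> q q' w; exact: disjC.
have tau0 := expR_gt0 tau.
apply: (@le_trans _ _ (\sum_q alpha q + expR tau)).
  by rewrite lerD2l -[leRHS]mulr1 ler_pM2l.
apply: (@le_trans _ _ (\sum_(q : Q) (alpha q + expR tau / #|Q|%:R))).
  by rewrite [leRHS]big_split /= lerD2l sumr_const -[leRHS]mulr_natl mulrC divfK// gt_eqF.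
apply: (@le_trans _ _ (\sum_(q : Q) (4^-1 : R))); first by apply: ler_sum => q _; exact: hyp.
by rewrite sumr_const -[leLHS]mulr_natl.
Qed.

(** The number of blocks decoded correctly has mean at most #blocks / 4, hence is below
#blocks / 2 with probability at least 1/2. *)
Lemma minimax_product_prior (Ttilde : dataset R n m p -> tensor R m p) (s : nat)
    (kappa tau r2 rate : R) :
  is_estimator Ttilde -> 0 < kappa -> 0 <= r2 -> rate <= r2 * #|I|%:R / 2 ->
  (forall theta, sparse_class s (composite theta)) ->
  (forall (theta : {ffun I -> Q}) D, r2 * \sum_i \1_(~` C i (theta i)) D <= frobenius (Ttilde D - composite theta) ^+ 2) ->
  (forall i q, n%:R * cu ^+ 2 * frobenius (t i q) ^+ 2 / (sigma ^+ 2 * kappa)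
     + expR (kappa - tau) + expR tau / #|Q|%:R <= 4^-1) ->
  ((2^-1)%:E <= ereal_sup [set data_law P X eps T
     [set D | (rate <= frobenius (Ttilde D - T) ^+ 2)%R] | T in sparse_class s])%E.
Proof.
move=> est kappa0 r20 ler sparse loss hyp.
have [theta htheta] := exists_hard_parameter kappa0 hyp.
pose T := composite theta.
apply: (@le_trans _ _ (data_law P X eps T [set D | (rate <= frobenius (Ttilde D - T) ^+ 2)%R])); last first.
  by apply: ereal_sup_ubound; exists T => //; exact: sparse.
have I0 : 0 < #|I|%:R :> R by rewrite ltr0n.
pose A i : set Omega := data T @^-1` C i (theta i).
have mA i : measurable (A i) by exact: data_preimage_measurable.
pose G (w : Omega) : R := 2 / #|I|%:R * \sum_i \1_(A i) w.
have msum : measurable_fun setT (fun w => \sum_i (\1_(A i) w : R)).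
  by apply: measurable_sum => i; exact: measurable_indic.
have mG : measurable_fun setT G by exact: measurable_funM.
have sum0 w : 0 <= \sum_i (\1_(A i) w : R) by apply: sumr_ge0 => i _; rewrite indicE.
have G0 w : 0 <= G w by rewrite mulr_ge0// divr_ge0.
pose U : set Omega := G @^-1` `[1, +oo[.
have mU : measurable U by rewrite -[U]setTI; exact: mG.
have PU : (P U <= (2^-1)%:E)%E.
  apply: (le_trans (probability_le_integral P mU mG G0 _)).
    by move=> w; rewrite /U /= in_itv/= andbT.
  rewrite ge0_integral_realZ; [|by []|by rewrite divr_ge0|by []].
  under eq_integral do rewrite -sumEFin.
  rewrite ge0_integral_sum; [|by []|
    by move=> i; apply/measurable_EFinP; exact: measurable_indic|
    by move=> i w _; rewrite lee_fin indicE].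
  under eq_bigr do rewrite integral_real_indic//.
  have -> : (\sum_i P (A i) = (\sum_i fine (data_law P X eps T (C i (theta i))))%:E)%E.
    by rewrite -sumEFin; apply: eq_bigr => i _; rewrite fineK//; apply: fin_num_measure; exact: mA.
  rewrite -EFinM lee_fin.
  apply: (@le_trans _ _ (2 / #|I|%:R * (#|I|%:R / 4))); first by rewrite ler_pM2l// divr_gt0.
  by rewrite mulrA divfK ?gt_eqF//; lra.
have -> : ((2^-1)%:E = 1 - (2^-1)%:E :> \bar R)%E by rewrite -EFinB; congr EFin; lra.
have mTt (j : 'I_p) (k l : 'I_m) : measurable_fun setT (fun w => Ttilde (data T w) j k l).
  move=> _ B mB; rewrite setTI.
  exact: (data_preimage_measurable T (est j k l B mB)).
have mfro : measurable_fun setT (fun w => frobenius (Ttilde (data T w) - T) ^+ 2).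
  rewrite [F in measurable_fun _ F](_ : _ = (fun w => \sum_j \sum_k \sum_l (Ttilde (data T w) j k l - T j k l) ^+ 2)); last first.
    apply/funext => w; rewrite frobenius_sqr; apply: eq_bigr => j _; apply: eq_bigr => k _.
    by apply: eq_bigr => l _; rewrite !ffunE !mxE.
  apply: measurable_sum => j; apply: measurable_sum => k; apply: measurable_sum => l.
  by apply: measurable_funX; apply: measurable_funB => //; exact: mTt.
apply: (@le_trans _ _ (P (~` U))).
  rewrite probability_setC//.
  by apply: leeB.
apply: le_measure; rewrite ?inE.
- exact: measurableC.
- exact: measurable_le_set.
move=> w; rewrite /U /= in_itv/= andbT => /negP; rewrite -ltNge => Gw.
apply: (le_trans ler); apply: le_trans (loss theta _).
rewrite -mulrA ler_wpM2l//.
have -> : \sum_i \1_(~` C i (theta i)) (data T w) = \sum_i (1 - \1_(A i) w) :> R.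
  apply: eq_bigr => i _; rewrite !indicE in_setC.
  have -> : (data T w \in C i (theta i)) = (w \in A i) by apply/idP/idP => /set_mem h; exact: mem_set.
  by case: (w \in A i); rewrite ?subr0 ?subrr.
rewrite sumrB sumr_const -/(#|I|%:R).
have : \sum_i (\1_(A i) w : R) < #|I|%:R / 2.
  by move: Gw; rewrite /G mulrAC ltr_pdivrMr// mul1r; lra.
lra.
Qed.

End ProductPrior.

(** * The minimax lower bound *)

Section SingleEntries.
Context {R : realType} {m p : nat}.
Implicit Types (T : tensor R m p) (e : 'I_p * 'I_m * 'I_m).

Definition entry T e : R := T e.1.1 e.1.2 e.2.

Definition single e (c : R) : tensor R m p :=
  [ffun j => \matrix_(k, l) if (j, k, l) == e then c else 0].

Lemma entry_single e c e' : entry (single e c) e' = if e' == e then c else 0.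
Proof. by case: e' => [[j k] l]; rewrite /entry ffunE mxE. Qed.

Lemma entry_sum (I : finType) (F : I -> tensor R m p) e :
  entry (\sum_i F i) e = \sum_i entry (F i) e.
Proof. by rewrite /entry sum_ffunE summxE. Qed.

Lemma entryB T T' e : entry (T - T') e = entry T e - entry T' e.
Proof. by rewrite /entry !ffunE !mxE. Qed.

Lemma frobenius_entries T : frobenius T ^+ 2 = \sum_e entry T e ^+ 2.
Proof.
rewrite frobenius_sqr pair_bigA /= pair_bigA /=.
by apply: eq_bigr => -[[j k] l].
Qed.

Lemma frobenius_single e c : frobenius (single e c) ^+ 2 = c ^+ 2.
Proof.
rewrite frobenius_entries (bigD1 e)//= entry_single eqxx big1 ?addr0// => e' /negbTE e'e.
by rewrite entry_single e'e expr0n.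
Qed.

Lemma sum_injective_le (K : finType) (phi : K -> 'I_p * 'I_m * 'I_m) T :
  injective phi -> \sum_i entry T (phi i) ^+ 2 <= frobenius T ^+ 2.
Proof.
move=> inj; rewrite frobenius_entries.
rewrite -(big_imset (fun e => entry T e ^+ 2) (in2W inj)) /=.
rewrite [leRHS](bigID [in phi @: K]) /= lerDl.
by apply: sumr_ge0 => e _; exact: sqr_ge0.
Qed.

Lemma frobenius_mx0P a b (M : 'M[R]_(a, b)) : (forall k l, M k l = 0) -> frobenius_mx M = 0.
Proof.
move=> M0; rewrite /frobenius_mx big1 ?sqrtr0// => k _.
by rewrite big1// => l _; rewrite M0 expr0n.
Qed.

Lemma sparse_class_singles (I : finType) (e : I -> 'I_p * 'I_m * 'I_m) (c : I -> R) (s : nat) :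
  (#|[set (e i).1.1 | i : I]| <= s)%N -> sparse_class s (\sum_i single (e i) (c i)).
Proof.
move=> cs; apply: leq_trans cs; rewrite /sparse_class /=.
rewrite -sum1_card [leqRHS]big_mkcond /=; apply: leq_sum => j _.
case: ifPn => [_|jn]; first by case: (_ != _).
rewrite frobenius_mx0P ?eqxx// => k l.
rewrite -[LHS]/(entry _ (j, k, l)) entry_sum big1// => i _.
rewrite entry_single; case: eqP => // ei.
by case/imsetP: jn; exists i => //; rewrite -ei.
Qed.

End SingleEntries.

Lemma expR_nat_ge {R : realType} k : 2 ^+ k <= expR k%:R :> R.
Proof.
rewrite -[k%:R]mul1r expRM_natr; apply: lerXn2r; rewrite ?nnegrE ?expR_ge0//.
by have := @expR_ge1Dx R 1; lra.
Qed.

Lemma expR_nat_le {R : realType} k : expR k%:R <= 4 ^+ k :> R.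
Proof.
rewrite -[k%:R]mul1r expRM_natr; apply: lerXn2r; rewrite ?nnegrE ?expR_ge0//.
have h : 1 / 2 <= expR (- (1 / 2)) :> R by have := @expR_ge1Dx R (- (1 / 2)); lra.
have e : expR 1 * (expR (- (1 / 2)) * expR (- (1 / 2))) = 1 :> R.
  by rewrite -!expRD (_ : 1 + _ = 0) ?expR0//; field.
have : 1 / 4 <= expR (- (1 / 2)) * expR (- (1 / 2)) :> R by nra.
by have := expR_gt0 (1 : R); nra.
Qed.

Section MinimaxLowerBound.
Context {R : realType} {d : measure_display} {Omega : measurableType d}.
Variables (P : probability Omega R) (n m p s : nat) (cl cu sigma : R).
Variables (S : 'M[R]_(p * m)).
Variables (X : 'I_n -> Omega -> 'M[R]_(m, p)) (eps : 'I_n -> Omega -> 'cV[R]_m).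
Hypothesis model : regression_model P cl cu sigma S X eps.
Hypotheses (n_gt0 : (0 < n)%N) (m_gt0 : (0 < m)%N) (s_gt0 : (0 < s)%N) (s_le_p : (s <= p)%N).
Hypotheses (cu_gt0 : 0 < cu) (sigma_gt0 : 0 < sigma).
Variable Ttilde : dataset R n m p -> tensor R m p.
Hypothesis estT : is_estimator Ttilde.

Let p_gt0 : (0 < p)%N. Proof. exact: leq_trans s_le_p. Qed.

Let noise_level : R := sigma ^+ 2 / (n%:R * cu ^+ 2).

Let noise_level_gt0 : 0 < noise_level.
Proof. by rewrite divr_gt0 ?mulr_gt0 ?exprn_gt0 ?ltr0n. Qed.

Let level_cancel kappa (c : R) : 0 < kappa ->
  n%:R * cu ^+ 2 * (noise_level * c) / (sigma ^+ 2 * kappa) = c / kappa.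
Proof.
move=> kappa0; rewrite /noise_level; field.
by rewrite !lt0r_neq0 ?ltr0n//.
Qed.

Let minimax_risk_ge (rate : R) : Prop :=
  ((2^-1)%:E <= ereal_sup [set data_law P X eps T
     [set D | (rate <= frobenius (Ttilde D - T) ^+ 2)%R] | T in sparse_class s])%E.

(** Each of the s m^2 entries of the first s slices takes one of 2^14 values in arithmetic
progression, and is decoded by rounding. With kappa = 1 and tau = 5 each of the three
terms of [exists_hard_parameter] is at most 1/16. *)
Lemma minimax_dimension (rate : R) :
  rate <= noise_level * (s * m ^ 2)%:R / 2 ^+ 35 -> minimax_risk_ge rate.
Proof.
move=> le_rate.
have [b bE] : exists b : nat, b%:R = 2 ^+ 14 :> R by exists (2 ^ 14)%N; rewrite natrX.
have b_gt0 : (0 < b)%N by rewrite -(ltr0n R) bE exprn_gt0.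
pose delta : R := Num.sqrt (noise_level / 2 ^+ 32).
have delta0 : 0 < delta by rewrite sqrtr_gt0 divr_gt0// exprn_gt0.
have delta2 : delta ^+ 2 = noise_level / 2 ^+ 32.
  by rewrite sqr_sqrtr// ltW// divr_gt0// exprn_gt0.
pose phi (i : 'I_s * 'I_m * 'I_m) : 'I_p * 'I_m * 'I_m := (widen_ord s_le_p i.1.1, i.1.2, i.2).
have phi_inj : injective phi.
  move=> [[a k] l] [[a' k'] l'] [/= aa' -> ->].
  by congr (_, _, _); apply/val_inj.
pose t (i : 'I_s * 'I_m * 'I_m) (q : 'I_b) : tensor R m p := single (phi i) (delta * q%:R).
pose C i (q : 'I_b) : set (dataset R n m p) :=
  [set D | `|entry (Ttilde D) (phi i) - delta * q%:R| < delta / 2].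
have entry_composite theta i : entry (composite t theta) (phi i) = delta * (theta i)%:R.
  rewrite /composite entry_sum (bigD1 i)//= entry_single eqxx big1 ?addr0// => i' i'i.
  by rewrite entry_single (inj_eq phi_inj) eq_sym (negbTE i'i).
apply: (@minimax_product_prior _ _ _ P n m p cl cu sigma S X eps model m_gt0 p_gt0 sigma_gt0
  _ _ t C _ _ _ _ Ttilde s 1 5 (delta ^+ 2 / 4)) => //.
- by rewrite !card_prod !card_ord !muln_gt0 s_gt0 m_gt0.
- by rewrite card_ord.
- move=> i q.
  rewrite /C (_ : [set D | _] = (fun D => Ttilde D (phi i).1.1 (phi i).1.2 (phi i).2) @^-1`
      [set x | `|x - delta * q%:R| < delta / 2])//.
  apply: estT; rewrite (_ : [set x | _] = `]delta * q%:R - delta / 2, delta * q%:R + delta / 2[%classic).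
    exact: measurable_itv.
  by apply/seteqP; split => x /=; rewrite in_itv/= ltr_distl.
- move=> i q q' D; rewrite /C /= => h h'; apply/val_inj/eqP; rewrite eqn_leq.
  have lt1 : `|delta * q%:R - delta * q'%:R| < delta.
    rewrite -(subrKA (entry (Ttilde D) (phi i))) (le_lt_trans (ler_normD _ _))//.
    by move: h h'; rewrite distrC; lra.
  have {}lt1 : `|q%:R - q'%:R| < 1 :> R.
    by move: lt1; rewrite -mulrBr normrM gtr0_norm// gtr_pMr.
  move: lt1; rewrite ltr_norml => /andP[lo hi].
  by apply/andP; split; rewrite -ltnS -(ltr_nat R) -natr1; lra.
- by rewrite divr_ge0// sqr_ge0.
- apply: (le_trans le_rate).
  rewrite delta2 !card_prod !card_ord mulnA -mulnA mulnn.
  have -> : (2 : R) ^+ 35 = 2 ^+ 32 * 8 by rewrite (exprD _ 32 3); congr (_ * _); ring.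
  rewrite invfM; set N : R := (_ ^+ 32)^-1; lra.
- move=> theta; apply: sparse_class_singles.
  apply: leq_trans (_ : #|[set widen_ord s_le_p a | a : 'I_s]| <= _)%N.
    apply/subset_leq_card/fintype.subsetP => j /imsetP[i _ ->].
    by apply/imsetP; exists i.1.1.
  by rewrite (leq_trans (leq_imset_card _ _))// card_ord.
- move=> theta D; apply: le_trans (sum_injective_le _ phi_inj).
  rewrite mulr_sumr; apply: ler_sum => i _.
  rewrite entryB entry_composite indicE; case: (boolP (_ \in _)) => [|_]; last by rewrite mulr0 sqr_ge0.
  rewrite inE /C /= => /negP; rewrite -leNgt mulr1 => le.
  rewrite -(real_normK (num_real (_ - _))).
  have -> : delta ^+ 2 / 4 = (delta / 2) ^+ 2 by field.
  by rewrite ler_pXn2r// nnegrE// ltW// divr_gt0.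
- move=> i q; rewrite frobenius_single exprMn delta2 card_ord bE.
  have -> : noise_level / 2 ^+ 32 * q%:R ^+ 2 = noise_level * (q%:R ^+ 2 / 2 ^+ 32) by rewrite mulrAC -mulrA.
  rewrite level_cancel// divr1.
  have q2 : q%:R ^+ 2 / 2 ^+ 32 <= 1 / 16 :> R.
    rewrite ler_pdivrMr ?exprn_gt0//.
    have -> : 1 / 16 * 2 ^+ 32 = (2 ^+ 14) ^+ 2 :> R.
      rewrite -exprM (exprD _ 28 4) mulrCA; rewrite [X in _ * X](_ : _ = 1) ?mulr1//.
      by field.
    rewrite ler_pXn2r ?nnegrE ?exprn_ge0// -bE ler_nat.
    exact: ltnW.
  have e4 : expR (1 - 5) <= 1 / 16 :> R.
    have -> : (1 - 5 : R) = - 4%:R by ring.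
    rewrite expRN -[leRHS]invf_div divr1 lef_pV2 ?posrE ?expR_gt0//.
    by apply: le_trans (expR_nat_ge 4); rewrite -natrX ler_nat.
  have e5 : expR 5 / 2 ^+ 14 <= 1 / 16 :> R.
    rewrite ler_pdivrMr ?exprn_gt0//; apply: (le_trans (expR_nat_le 5)).
    have -> : 4 ^+ 5 = 2 ^+ 10 :> R by rewrite (exprM 2 2 5) expr2; congr (_ ^+ _); ring.
    rewrite (exprD _ 10 4) mulrCA; set M : R := 2 ^+ 10.
    have : 0 < M by rewrite exprn_gt0.
    by rewrite (exprD _ 2 2) expr2; lra.
  lra.
Qed.

(** Block i consists of b slices, one of which holds a single nonzero entry delta. With
kappa = ln b / 4 and tau = ln b / 2 each of the three terms of [exists_hard_parameter] is
at most 1/16 as soon as b >= 2^16. *)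
Lemma minimax_selection (b : nat) (rate : R) :
  (b * s <= p)%N -> 16 * ln 2 <= ln b%:R :> R ->
  rate <= noise_level * s%:R * ln b%:R / 2 ^+ 9 -> minimax_risk_ge rate.
Proof.
move=> bs lnb le_rate.
have lnb0 : 0 < ln b%:R :> R.
  by apply: lt_le_trans lnb; rewrite mulr_gt0// ln_gt0// ltr1n.
have b_gt0 : (0 < b)%N by case: b lnb0 {bs lnb le_rate} => //; rewrite ln0// ltxx.
pose delta : R := Num.sqrt (noise_level * ln b%:R / 64).
have c0 : 0 < noise_level * ln b%:R / 64.
  by apply: divr_gt0 => //; exact: mulr_gt0.
have delta0 : 0 < delta by rewrite sqrtr_gt0.
have delta2 : delta ^+ 2 = noise_level * ln b%:R / 64 by rewrite sqr_sqrtr// ltW.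
pose k0 : 'I_m := Ordinal m_gt0.
have lt_index (i : 'I_s) (q : 'I_b) : (i * b + q < p)%N.
  have := ltn_ord i; have := ltn_ord q; move: bs; case: i q => /= i _ [/= q _]; nia.
pose phi (iq : 'I_s * 'I_b) : 'I_p * 'I_m * 'I_m := (Ordinal (lt_index iq.1 iq.2), k0, k0).
have phi_inj : injective phi.
  move=> [i q] [i' q'] [/= e].
  have ei : i = i' :> nat.
    have := congr1 (fun x => x %/ b)%N e.
    by rewrite !divnMDl// !divn_small// !addn0.
  congr (_, _); apply: val_inj => //=.
  by move: e; rewrite ei => /addnI.
pose t (i : 'I_s) (q : 'I_b) : tensor R m p := single (phi (i, q)) delta.
pose C i (q : 'I_b) : set (dataset R n m p) :=
  [set D | forall q', (delta / 2 < entry (Ttilde D) (phi (i, q'))) = (q' == q)].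
have entry_composite theta i q : entry (composite t theta) (phi (i, q)) = if q == theta i then delta else 0.
  rewrite /composite entry_sum (bigD1 i)//= entry_single (inj_eq phi_inj) xpair_eqE eqxx /=.
  rewrite big1 ?addr0// => i' i'i.
  by rewrite entry_single (inj_eq phi_inj) xpair_eqE eq_sym (negbTE i'i).
apply: (@minimax_product_prior _ _ _ P n m p cl cu sigma S X eps model m_gt0 p_gt0 sigma_gt0
  _ _ t C _ _ _ _ Ttilde s (ln b%:R / 4) (ln b%:R / 2) (delta ^+ 2 / 4)) => //.
- by rewrite card_ord.
- by rewrite card_ord.
- move=> i q.
  pose B q' : set (dataset R n m p) := (fun D => entry (Ttilde D) (phi (i, q'))) @^-1`
    (if q' == q then `]delta / 2, +oo[%classic else `]-oo, delta / 2]%classic).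
  have -> : C i q = \bigcap_(q' in [set: 'I_b]) B q'.
    apply/seteqP; split => D; rewrite /C /B /=.
      by move=> h q' _ /=; have := h q'; case: (q' == q) => hq /=; rewrite in_itv/= ?andbT// leNgt hq.
    move=> h q'; have := h q' I; case: (q' == q); rewrite /= in_itv/= ?andbT// => le.
    by apply/negbTE; rewrite -leNgt.
  apply: (@fin_bigcap_measurable _ (generated _)); first exact: finite_finset.
  move=> q' _; apply: estT; case: (_ == _); exact: measurable_itv.
- by move=> i q q' D h h'; have := h q; rewrite h' eqxx => /eqP.
- by rewrite divr_gt0.
- by rewrite divr_ge0// sqr_ge0.
- apply: (le_trans le_rate).
  rewrite delta2 card_ord (_ : (2 : R) ^+ 9 = 512); first lra.
  by rewrite -natrX.
- move=> theta; apply: (@sparse_class_singles _ _ _ _ (fun i => phi (i, theta i)) (fun=> delta)).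
  by rewrite (leq_trans (leq_imset_card _ _))// card_ord.
- move=> theta D; apply: le_trans (sum_injective_le _ phi_inj).
  rewrite -(pair_bigA _ (fun i q => entry (Ttilde D - composite t theta) (phi (i, q)) ^+ 2)) /=.
  rewrite mulr_sumr; apply: ler_sum => i _.
  have s0 : 0 <= \sum_q entry (Ttilde D - composite t theta) (phi (i, q)) ^+ 2.
    by apply: sumr_ge0 => q _; exact: sqr_ge0.
  rewrite indicE; case: (boolP (_ \in _)) => [|_]; last by rewrite mulr0.
  rewrite inE /C /= => /existsNP[q' /eqP hq']; rewrite mulr1.
  rewrite (bigD1 q')//= -[leLHS]addr0; apply: lerD; last first.
    by apply: sumr_ge0 => q _; exact: sqr_ge0.
  rewrite entryB entry_composite -(real_normK (num_real (_ - _))).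
  have -> : delta ^+ 2 / 4 = (delta / 2) ^+ 2 by field.
  rewrite ler_pXn2r//; last by rewrite nnegrE ltW// divr_gt0.
  move: hq'; case: ltP => [lt|le]; case: (q' == theta i) => //= _.
    by rewrite subr0; apply: le_trans (ler_norm _); exact: ltW.
  by rewrite distrC; apply: le_trans (ler_norm _); lra.
- move=> i q; rewrite frobenius_single delta2 card_ord -[X in _ * X / _]mulrA level_cancel ?divr_gt0//.
  have -> : ln b%:R / 64 / (ln b%:R / 4) = 1 / 16 :> R by field; rewrite lt0r_neq0.
  have -> : ln b%:R / 4 - ln b%:R / 2 = - (ln b%:R / 4) :> R by field.
  have bexp : b%:R = expR (ln b%:R) :> R by rewrite lnK// posrE ltr0n.
  have -> : expR (ln b%:R / 2) / b%:R = expR (- (ln b%:R / 2)) :> R.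
    by rewrite {2}bexp -expRN -expRD; congr expR; field.
  have quarter : expR (- (ln b%:R / 4)) <= 1 / 16 :> R.
    have -> : 1 / 16 = expR (- (4%:R * ln 2)) :> R.
      rewrite expRN expRM_natl lnK ?posrE// -natrX; lra.
    rewrite ler_expR lerN2; lra.
  have : expR (- (ln b%:R / 2)) <= expR (- (ln b%:R / 4)) :> R by rewrite ler_expR; lra.
  lra.
Qed.

(** The maximum is at most 2^16 m^2, the range of the first design, unless floor(p / s) is
at least 2^16 and ln(p / s) > m^2; then the second design applies, with
ln(p / s) <= 2 ln floor(p / s). *)
Lemma minimax_lower_bound :
  minimax_risk_ge ((2 ^+ 51)^-1 * sigma ^+ 2 * s%:R * Num.max (m%:R ^+ 2) (ln (p%:R / s%:R))
                    / (cu ^+ 2 * n%:R)).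
Proof.
set M := Num.max _ _.
have -> : (2 ^+ 51)^-1 * sigma ^+ 2 * s%:R * M / (cu ^+ 2 * n%:R) = noise_level * s%:R * M / 2 ^+ 51.
  rewrite /noise_level; field.
  by rewrite !lt0r_neq0 ?ltr0n ?exprn_gt0.
have sR : 0 < s%:R :> R by rewrite ltr0n.
have m1 : 1 <= m%:R ^+ 2 :> R by rewrite -natrX ler1n expn_gt0 m_gt0.
have Ns : 0 < noise_level * s%:R by exact: mulr_gt0.
have dimension_case : M <= 2 ^+ 16 * m%:R ^+ 2 ->
    minimax_risk_ge (noise_level * s%:R * M / 2 ^+ 51).
  move=> leM; apply: minimax_dimension.
  apply: (@le_trans _ _ (noise_level * s%:R * (2 ^+ 16 * m%:R ^+ 2) / 2 ^+ 51)).
    by rewrite ler_pM2r ?invr_gt0 ?exprn_gt0// ler_pM2l.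
  rewrite natrM natrX (_ : (2 : R) ^+ 51 = 2 ^+ 35 * 2 ^+ 16); last by rewrite -exprD.
  have /lt0r_neq0 : 0 < (2 : R) ^+ 35 by rewrite exprn_gt0.
  have /lt0r_neq0 : 0 < (2 : R) ^+ 16 by rewrite exprn_gt0.
  move: ((2 : R) ^+ 35) ((2 : R) ^+ 16) => u v v0 u0.
  by rewrite le_eqVlt; apply/orP; left; apply/eqP; field; rewrite u0 v0.
have [B BE] : exists B : nat, B%:R = 2 ^+ 16 :> R by exists (2 ^ 16)%N; rewrite natrX.
pose b := (p %/ s)%N.
have ratio_lt : p%:R / s%:R < b.+1%:R :> R.
  by rewrite ltr_pdivrMr// -natrM ltr_nat -ltn_divLR.
have ratio_gt0 : 0 < p%:R / s%:R :> R by rewrite divr_gt0// ltr0n.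
have [bB|Bb] := ltnP b B.
  apply: dimension_case; rewrite ge_max; apply/andP; split.
    by rewrite ler_peMl ?sqr_ge0// -natrX ler1n expn_gt0.
  apply: (le_trans (ltW (ln_sublinear ratio_gt0))).
  apply: (le_trans (ltW ratio_lt)); apply: (@le_trans _ _ (2 ^+ 16)).
    by rewrite -BE ler_nat.
  by rewrite ler_peMr// exprn_ge0.
have [leM|] := boolP (ln (p%:R / s%:R) <= m%:R ^+ 2 :> R); last first.
  rewrite -ltNge => /ltW ltM.
  have bR : 2 ^+ 16 <= b%:R :> R by rewrite -BE ler_nat.
  have b2 : 2 <= b%:R :> R.
    by apply: le_trans bR; rewrite exprS ler_peMr// -natrX ler1n expn_gt0.
  have b0 : 0 < b%:R :> R by exact: lt_le_trans b2.
  apply: (@minimax_selection b); first exact: leq_divM.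
  - have -> : 16 * ln 2 = ln (2 ^+ 16) :> R by rewrite lnXn// mulr_natl.
    by rewrite ler_ln// posrE exprn_gt0.
  - have -> : M = ln (p%:R / s%:R) by exact: max_r.
    have ln2 : ln (p%:R / s%:R) <= 2 * ln b%:R :> R.
      rewrite [leRHS]mulr_natl -lnXn// ler_ln ?posrE ?exprn_gt0//.
      by apply: (le_trans (ltW ratio_lt)); rewrite -natr1 expr2; nra.
    have lnb0 : 0 <= ln b%:R :> R by rewrite ln_ge0//; lra.
    rewrite -[leLHS]mulrA -[leRHS]mulrA ler_pM2l//.
    rewrite ler_pdivrMr ?exprn_gt0// mulrAC -[leRHS]mulrA.
    rewrite (_ : (2 : R) ^+ 51 = 2 * 2 ^+ 41 * 2 ^+ 9); last by rewrite -exprS -exprD.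
    rewrite mulfK ?lt0r_neq0 ?exprn_gt0// (le_trans ln2)// mulrC ler_wpM2l//.
    by rewrite ler_peMr// -natrX ler1n expn_gt0.
apply: dimension_case; rewrite ge_max; apply/andP; split.
  by rewrite ler_peMl ?sqr_ge0// -natrX ler1n expn_gt0.
by apply: (le_trans leM); rewrite ler_peMl ?sqr_ge0// -natrX ler1n expn_gt0.
Qed.

End MinimaxLowerBound.

(** * Restricted lower bounds and the oracle inequality *)

Section Maurey.
Context {R : realType} {V : zmodType} (B : V -> V -> R).
Hypothesis Bsym : forall x y, B x y = B y x.
Hypothesis BDl : forall x y z, B (x + y) z = B x z + B y z.
Variables (T : finType) (w : T -> R) (a : T -> V) (v : V).
Hypothesis w_ge0 : forall t, 0 <= w t.
Hypothesis w_sum1 : \sum_t w t = 1.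
Hypothesis barycentre : forall z, \sum_t w t * B z (a t) = B z v.

Let BDr x y z : B x (y + z) = B x y + B x z.
Proof. by rewrite Bsym BDl !(Bsym x). Qed.

(** The right-hand side is the mean of the form at z plus k independent atoms drawn with
weights w; one draw is averaged at each step. *)
Lemma maurey_sum k z :
  (forall r : seq T, size r = k -> {in r, forall t, 0 < w t} ->
     0 <= B (z + \sum_(t <- r) a t) (z + \sum_(t <- r) a t)) ->
  0 <= B z z + 2 * k%:R * B z v + k%:R * (k%:R - 1) * B v v
       + k%:R * \sum_t w t * B (a t) (a t).
Proof.
elim: k z => [|k IH] z Hz.
  by have := Hz [::] erefl; rewrite big_nil addr0 !(mul0r, mulr0, addr0); apply.
set W := \sum_t w t * B (a t) (a t).
pose J t := B (z + a t) (z + a t) + 2 * k%:R * B (z + a t) v + k%:R * (k%:R - 1) * B v v + k%:R * W.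
have J0 t : 0 <= w t * J t.
  have := w_ge0 t; rewrite le_eqVlt => /orP[/eqP <-|wt]; first by rewrite mul0r.
  apply: mulr_ge0; first exact: ltW.
  apply: IH => r sr wr; rewrite -addrA.
  have := Hz (t :: r); rewrite /= sr big_cons; apply => // u.
  by rewrite inE => /orP[/eqP ->|/wr].
have sumJ : \sum_t w t * J t = B z z + 2 * B z v + W + 2 * k%:R * (B z v + B v v)
    + k%:R * (k%:R - 1) * B v v + k%:R * W.
  pose c := B z z + 2 * k%:R * B z v + k%:R * (k%:R - 1) * B v v + k%:R * W.
  transitivity (\sum_t (c * w t + 2 * (w t * B z (a t)) + w t * B (a t) (a t) + 2 * k%:R * (w t * B v (a t)))).
    by apply: eq_bigr => t _; rewrite /J /c !(BDl, BDr) (Bsym (a t) z) (Bsym (a t) v); ring.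
  by rewrite !big_split /= -!mulr_sumr w_sum1 !barycentre -/W /c; ring.
have : 0 <= \sum_t w t * J t by apply: sumr_ge0.
by rewrite sumJ -natr1; lra.
Qed.

(** In the mean over k draws the off-diagonal terms add up to k (k - 1) B(v, v), and the
diagonal ones to at most k L. *)
Lemma maurey_lower_bound k L : (1 < k)%N ->
  (forall r : seq T, size r = k -> {in r, forall t, 0 < w t} ->
     0 <= B (\sum_(t <- r) a t) (\sum_(t <- r) a t)) ->
  (forall t, 0 < w t -> B (a t) (a t) <= L) ->
  - (L / (k%:R - 1)) <= B v v.
Proof.
move=> k1 Hk HL.
have B0 x : B 0 x = 0 by have := BDl 0 0 x; rewrite addr0; lra.
have := @maurey_sum k 0; rewrite !B0 mulr0 !add0r => H.
have {}H := H (fun r sr wr => ltac:(rewrite add0r; exact: Hk)).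
have k1R : 1 < k%:R :> R by rewrite ltr1n.
have le : \sum_t w t * B (a t) (a t) <= L.
  rewrite -[L]mul1r -w_sum1 mulr_suml; apply: ler_sum => t _.
  have := w_ge0 t; rewrite le_eqVlt => /orP[/eqP <-|wt]; first by rewrite !mul0r.
  by rewrite ler_pM2l// HL.
rewrite -mulNr ler_pdivrMr ?subr_gt0//.
have k0 : 0 < k%:R :> R by lra.
rewrite -(ler_pM2l k0); nra.
Qed.

Lemma jensen_quadratic L : (forall x, 0 <= B x x) ->
  (forall t, 0 < w t -> B (a t) (a t) <= L) -> B v v <= L.
Proof.
move=> B_ge0 HL.
have le : \sum_t w t * B (a t) (a t) <= L.
  rewrite -[L]mul1r -w_sum1 mulr_suml; apply: ler_sum => t _.
  have := w_ge0 t; rewrite le_eqVlt => /orP[/eqP <-|wt]; first by rewrite !mul0r.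
  by rewrite ler_pM2l// HL.
apply: le_trans le.
have B0 x : B 0 x = 0 by have := BDl 0 0 x; rewrite addr0; lra.
have BN x y : B (- x) y = - B x y by have := BDl x (- x) y; rewrite subrr B0; lra.
have : 0 <= \sum_t w t * B (a t - v) (a t - v).
  by apply: sumr_ge0 => t _; rewrite mulr_ge0.
have -> : \sum_t w t * B (a t - v) (a t - v) =
    \sum_t (w t * B (a t) (a t) + (-2) * (w t * B v (a t)) + B v v * w t).
  apply: eq_bigr => t _; rewrite BDl !BDr !BN [B _ (- v)]Bsym [B v (- v)]Bsym !BN; ring.
rewrite !big_split /= -!mulr_sumr barycentre w_sum1; lra.
Qed.

End Maurey.

Section Grid.
Context {R : realType} (m : nat).
Hypothesis m_gt0 : (0 < m)%N.

(** A sign and a magnitude in units of 1/(10 m). The last index allows a number of modulus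
1 to be rounded up. *)
Definition grid := (bool * 'I_(10 * m).+2)%type.

Definition grid_step : R := (10 * m%:R)^-1.

Definition grid_value (c : grid) : R := (-1) ^+ c.1 * (c.2%:R * grid_step).

Lemma grid_step_gt0 : 0 < grid_step.
Proof. by rewrite invr_gt0 mulr_gt0 ?ltr0n. Qed.

(** Random rounding, without bias, to the two neighbouring grid points of the same sign. *)
Lemma grid_rounding (x : R) : `|x| <= 1 ->
  exists w : grid -> R, [/\ forall c, 0 <= w c, \sum_c w c = 1,
    \sum_c w c * grid_value c = x &
    forall c, 0 < w c -> `|grid_value c| <= `|x| + grid_step].
Proof.
move=> x1; have h0 := grid_step_gt0.
pose y := `|x| / grid_step.
have y0 : 0 <= y by rewrite divr_ge0// ltW.
have /andP[lo hi] := Num.Theory.truncn_itv y0.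
pose q := Num.truncn y.
have yle : y <= (10 * m)%:R.
  by rewrite /y /grid_step invrK natrM ler_piMl// mulr_ge0.
have qle : (q <= 10 * m)%N by rewrite -(ler_nat R) (le_trans lo).
have qlt : (q < (10 * m).+2)%N by rewrite ltnS (leq_trans qle).
have q1lt : (q.+1 < (10 * m).+2)%N by rewrite !ltnS.
pose c0 : grid := (x < 0, Ordinal qlt).
pose c1 : grid := (x < 0, Ordinal q1lt).
have c01 : c0 != c1 by rewrite xpair_eqE eqxx /= -val_eqE /= neq_ltn ltnSn.
pose u := y - q%:R.
have u0 : 0 <= u by rewrite subr_ge0.
have u1 : 0 <= 1 - u by move: hi; rewrite -natr1 /u /q; lra.
have xE : (-1) ^+ (x < 0)%R * (y * grid_step) = x.
  by rewrite /y divfK ?lt0r_neq0// -numEsign.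
pose w c := if c == c0 then 1 - u else if c == c1 then u else 0.
have sumE F : \sum_c w c * F c = (1 - u) * F c0 + u * F c1.
  rewrite (bigD1 c0)//= (bigD1 c1)/=; last by rewrite eq_sym.
  rewrite big1 ?addr0 /w ?eqxx 1?eq_sym 1?(negbTE c01)// => c /andP[/negbTE -> /negbTE ->].
  by rewrite mul0r.
exists w; split.
- by move=> c; rewrite /w; case: ifP => // _; case: ifP.
- have := sumE (fun=> 1); under eq_bigr do rewrite mulr1.
  by move=> ->; rewrite !mulr1 subrK.
- rewrite sumE /grid_value /= -[RHS]xE -natr1 /u; ring.
- move=> c wc.
  have normc (d : grid) : `|grid_value d| = d.2%:R * grid_step.
    by rewrite /grid_value normrMsign ger0_norm// mulr_ge0// ltW.
  have xy : `|x| = y * grid_step by rewrite /y divfK// lt0r_neq0.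
  rewrite normc xy -[X in _ + X]mul1r -mulrDl ler_pM2r//.
  move: wc; rewrite /w; case: eqP => [->|_] /=; first by move: lo; rewrite -/q; lra.
  by case: eqP => [->|_] /=; rewrite ?ltxx// -natr1 lerD2r.
Qed.

End Grid.

Section ProductWeights.
Context {R : realType} {I G : finType} (w : I -> G -> R).
Hypothesis w_sum1 : forall i, \sum_g w i g = 1.

Lemma product_weight_sum1 : \sum_(z : {ffun I -> G}) \prod_i w i (z i) = 1.
Proof. by rewrite -bigA_distr_bigA /= big1. Qed.

Lemma product_weight_marginal i (F : G -> R) :
  \sum_(z : {ffun I -> G}) (\prod_i' w i' (z i')) * F (z i) = \sum_g w i g * F g.
Proof.
pose w' i' g := w i' g * (if i' == i then F g else 1).
transitivity (\sum_(z : {ffun I -> G}) \prod_i' w' i' (z i')).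
  apply: eq_bigr => z _; rewrite /w' big_split /=; congr (_ * _).
  by rewrite (bigD1 i)//= eqxx big1 ?mulr1// => i' /negbTE ->.
rewrite -bigA_distr_bigA /= (bigD1 i)//= [X in _ * X]big1 ?mulr1.
  by apply: eq_bigr => g _; rewrite /w' eqxx.
move=> i' /negbTE i'i; rewrite -(w_sum1 i'); apply: eq_bigr => g _.
by rewrite /w' i'i mulr1.
Qed.

End ProductWeights.

Section Atoms.
Context {R : realType} {m p : nat}.
Hypothesis m_gt0 : (0 < m)%N.
Local Notation gridmx := {ffun 'I_m * 'I_m -> grid m}.

Definition slice (j : 'I_p) (U : 'M[R]_m) : tensor R m p :=
  [ffun j' => if j' == j then U else 0].

Definition grid_matrix (z : gridmx) : 'M[R]_m := \matrix_(k, l) grid_value (z (k, l)).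

Definition small_grid (z : gridmx) : bool :=
  \sum_k \sum_l (grid_value (z (k, l)) : R) ^+ 2 <= 121 / 100.

Definition atom (t : 'I_p * gridmx) : tensor R m p := slice t.1 (grid_matrix t.2).

Lemma frobenius_slice j U : frobenius (slice j U) ^+ 2 = frobenius_mx U ^+ 2.
Proof.
rewrite frobenius_slices (bigD1 j)//= ffunE eqxx big1 ?addr0// => j' /negbTE j'j.
rewrite ffunE j'j frobenius_mx_sqr big1// => k _; rewrite big1// => l _.
by rewrite mxE expr0n.
Qed.

Lemma frobenius_atom t : small_grid t.2 -> frobenius (atom t) ^+ 2 <= 121 / 100.
Proof.
rewrite /atom frobenius_slice frobenius_mx_sqr; apply: le_trans.
by apply: ler_sum => k _; apply: ler_sum => l _; rewrite mxE.
Qed.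

(** The entries are rounded independently. With mesh h every outcome has squared norm at
most sum (|u| + h)^2 <= (|U|_F + m h)^2, and m h = 1/10. *)
Lemma unit_matrix_barycentre (U : 'M[R]_m) : frobenius_mx U ^+ 2 <= 1 ->
  exists w : gridmx -> R, [/\ forall z, 0 <= w z, \sum_z w z = 1,
    forall k l, \sum_z w z * grid_value (z (k, l)) = U k l &
    forall z, 0 < w z -> small_grid z].
Proof.
rewrite frobenius_mx_sqr pair_bigA /= => U1.
have abs1 (kl : 'I_m * 'I_m) : `|U kl.1 kl.2| <= 1.
  rewrite -(@ler_pXn2r _ 2) ?nnegrE// expr1n real_normK ?num_real//.
  apply: le_trans U1; rewrite (bigD1 kl)//= lerDl.
  by apply: sumr_ge0 => kl' _; exact: sqr_ge0.
have /choice[v hv] : forall kl : 'I_m * 'I_m, exists w : grid m -> R,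
    [/\ forall c, 0 <= w c, \sum_c w c = 1,
    \sum_c w c * grid_value c = U kl.1 kl.2 &
    forall c, 0 < w c -> `|grid_value c : R| <= `|U kl.1 kl.2| + grid_step m].
  by move=> kl; exact: grid_rounding.
have v1 kl : \sum_c v kl c = 1 by case: (hv kl).
exists (fun z => \prod_kl v kl (z kl)); split.
- by move=> z; apply: prodr_ge0 => kl _; case: (hv kl).
- exact: product_weight_sum1.
- by move=> k l; rewrite product_weight_marginal//; case: (hv (k, l)).
- move=> z wz; rewrite /small_grid pair_bigA /=.
  have vz kl : 0 < v kl (z kl).
    rewrite lt_neqAle; have [-> _ _ _] := hv kl; rewrite andbT eq_sym.
    by apply: contraTneq wz => v0; rewrite (bigD1 kl)//= v0 mul0r ltxx.
  pose h : R := grid_step m.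
  have h0 : 0 < h := grid_step_gt0 m_gt0.
  have mh : m%:R * h = 1 / 10.
    by rewrite /h /grid_step invfM mulrCA divff ?mulr1 ?div1r// pnatr_eq0 -lt0n.
  have m0 : 0 < m%:R :> R by rewrite ltr0n.
  apply: (@le_trans _ _ (\sum_(kl : 'I_m * 'I_m) (U kl.1 kl.2 ^+ 2 + h * (m%:R * U kl.1 kl.2 ^+ 2 + m%:R^-1) + h ^+ 2))).
    apply: ler_sum => -[k l] _ /=.
    have [_ _ _ /(_ _ (vz (k, l)))/= le] := hv (k, l).
    rewrite -(real_normK (num_real (grid_value _))) -(real_normK (num_real (U k l))).
    set x := `|U k l| in le *; set y := `|_| in le *.
    have x0 : 0 <= x by exact: normr_ge0.
    have y0 : 0 <= y by exact: normr_ge0.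
    have : y ^+ 2 <= (x + h) ^+ 2 by rewrite ler_pXn2r ?nnegrE ?addr_ge0// ltW.
    have : 2 * x <= m%:R * x ^+ 2 + m%:R^-1.
      have : 0 <= m%:R^-1 * (m%:R * x - 1) ^+ 2 by rewrite mulr_ge0 ?sqr_ge0// invr_ge0 ltW.
      have -> : m%:R^-1 * (m%:R * x - 1) ^+ 2 = m%:R * x ^+ 2 + m%:R^-1 - 2 * x.
        by field; rewrite lt0r_neq0.
      lra.
    nra.
  rewrite !big_split /= !sumr_const card_prod card_ord -!mulr_sumr big_split /= -mulr_sumr.
  rewrite sumr_const card_prod card_ord.
  set s := \sum_i _ in U1 *.
  rewrite -[h ^+ 2 *+ _]mulr_natl -[_^-1 *+ _]mulr_natl natrM.
  have e1 : m%:R * m%:R * m%:R^-1 = m%:R :> R by rewrite mulfK// lt0r_neq0.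
  have s0 : 0 <= s by apply: sumr_ge0 => kl _; exact: sqr_ge0.
  have -> : m%:R * m%:R * h ^+ 2 = 1 / 100 by rewrite -expr2 -exprMn mh; lra.
  rewrite e1 mulrDr mulrA (mulrC h) mh; nra.
Qed.

End Atoms.

Section RestrictedEigenvalue.
Context {R : realType} {n m p : nat} (X : 'I_n -> 'M[R]_(m, p)).
Hypothesis m_gt0 : (0 < m)%N.
Local Notation gridmx := {ffun 'I_m * 'I_m -> grid m}.

(** The polarisation of the squared empirical norm. *)
Definition emp_form (A A' : tensor R m p) : R :=
  n%:R^-1 * \sum_i \sum_k inner A (X i) k 0 * inner A' (X i) k 0.

Definition tensor_dot (A A' : tensor R m p) : R := \sum_j \sum_k \sum_l A j k l * A' j k l.

Definition group_norm (A : tensor R m p) : R := \sum_j frobenius_mx (A j).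

Lemma emp_formC A A' : emp_form A A' = emp_form A' A.
Proof. by congr (_ * _); apply: eq_bigr => i _; apply: eq_bigr => k _; rewrite mulrC. Qed.

Lemma emp_formDl A A' A'' : emp_form (A + A') A'' = emp_form A A'' + emp_form A' A''.
Proof.
rewrite -mulrDr -big_split; congr (_ * _); apply: eq_bigr => i _ /=.
by rewrite -big_split; apply: eq_bigr => k _ /=; rewrite innerD mxE mulrDl.
Qed.

Lemma emp_formZl c A A' : emp_form (c *: A) A' = c * emp_form A A'.
Proof.
rewrite mulrCA mulr_sumr; congr (_ * _); apply: eq_bigr => i _ /=.
by rewrite mulr_sumr; apply: eq_bigr => k _ /=; rewrite innerZ mxE mulrA.
Qed.

Lemma emp_form_ge0 A : 0 <= emp_form A A.
Proof.
rewrite mulr_ge0 ?invr_ge0//; apply: sumr_ge0 => i _; apply: sumr_ge0 => k _.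
by rewrite -expr2 sqr_ge0.
Qed.

Lemma emp_norm_sqr A : emp_norm X A ^+ 2 = emp_form A A.
Proof.
have E : n%:R^-1 * \sum_(i < n) frobenius_mx (inner A (X i)) ^+ 2 = emp_form A A.
  congr (_ * _); apply: eq_bigr => i _; rewrite frobenius_mx_sqr; apply: eq_bigr => k _.
  by rewrite big_ord1 expr2.
by rewrite /emp_norm sqr_sqrtr E// emp_form_ge0.
Qed.

Lemma tensor_dotC A A' : tensor_dot A A' = tensor_dot A' A.
Proof.
by apply: eq_bigr => j _; apply: eq_bigr => k _; apply: eq_bigr => l _; rewrite mulrC.
Qed.

Lemma tensor_dotDl A A' A'' : tensor_dot (A + A') A'' = tensor_dot A A'' + tensor_dot A' A''.
Proof.
rewrite -big_split; apply: eq_bigr => j _ /=; rewrite -big_split; apply: eq_bigr => k _ /=.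
by rewrite -big_split; apply: eq_bigr => l _ /=; rewrite ffunE mxE mulrDl.
Qed.

Lemma tensor_dotZl c A A' : tensor_dot (c *: A) A' = c * tensor_dot A A'.
Proof.
rewrite mulr_sumr; apply: eq_bigr => j _; rewrite mulr_sumr; apply: eq_bigr => k _.
by rewrite mulr_sumr; apply: eq_bigr => l _; rewrite ffunE mxE mulrA.
Qed.

Lemma tensor_dot_frobenius A : tensor_dot A A = frobenius A ^+ 2.
Proof.
rewrite frobenius_sqr; apply: eq_bigr => j _; apply: eq_bigr => k _.
by apply: eq_bigr => l _; rewrite expr2.
Qed.

Lemma frobenius_mx_ge0 a b (M : 'M[R]_(a, b)) : 0 <= frobenius_mx M.
Proof. exact: sqrtr_ge0. Qed.

Lemma frobenius_mx_eq0 a b (M : 'M[R]_(a, b)) : frobenius_mx M = 0 -> M = 0.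
Proof.
move=> M0; have := frobenius_mx_sqr M; rewrite M0 expr0n pair_bigA /= => /esym/eqP.
rewrite psumr_eq0 => [/allP z|kl _]; last exact: sqr_ge0.
apply/matrixP => k l; rewrite mxE; have := z (k, l) (mem_index_enum _).
by rewrite sqrf_eq0 => /eqP.
Qed.

Lemma frobenius_mxZ a b c (M : 'M[R]_(a, b)) : frobenius_mx (c *: M) ^+ 2 = c ^+ 2 * frobenius_mx M ^+ 2.
Proof.
rewrite !frobenius_mx_sqr mulr_sumr; apply: eq_bigr => k _.
by rewrite mulr_sumr; apply: eq_bigr => l _; rewrite mxE exprMn.
Qed.

Lemma normalized_barycentre (U : 'M[R]_m) :
  exists w : gridmx -> R, [/\ forall z, 0 <= w z, \sum_z w z = 1,
    forall k l, \sum_z frobenius_mx U * w z * grid_value (z (k, l)) = U k l &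
    forall z, 0 < w z -> small_grid (R := R) z].
Proof.
have [U0|U0] := eqVneq (frobenius_mx U) 0.
  have [|w [w0 w1 _ ws]] := @unit_matrix_barycentre R m m_gt0 (0 : 'M[R]_m).
    by rewrite frobenius_mx_sqr big1// => k _; rewrite big1// => l _; rewrite mxE expr0n.
  exists w; split => // k l; rewrite U0 (frobenius_mx_eq0 U0) mxE big1// => z _.
  by rewrite !mul0r.
have [|w [w0 w1 wU ws]] := @unit_matrix_barycentre R m m_gt0 ((frobenius_mx U)^-1 *: U).
  by rewrite frobenius_mxZ -exprMn mulVf// expr1n.
exists w; split => // k l.
by under eq_bigr do rewrite -mulrA; rewrite -mulr_sumr wU mxE mulrA divff// mul1r.
Qed.

(** Slice j is drawn with probability |A_j|_F / sum_j |A_j|_F, then a rounding of the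
normalised slice. *)
Lemma tensor_barycentre (A : tensor R m p) : 0 < group_norm A ->
  exists w : 'I_p * gridmx -> R, [/\ forall t, 0 <= w t, \sum_t w t = 1,
    \sum_t w t *: atom t = (group_norm A)^-1 *: A &
    forall t, 0 < w t -> small_grid (R := R) t.2].
Proof.
move=> A0.
have /choice[v hv] : forall j : 'I_p, exists w : gridmx -> R,
   [/\ forall z, 0 <= w z, \sum_z w z = 1,
    forall k l, \sum_z frobenius_mx (A j) * w z * grid_value (z (k, l)) = A j k l &
    forall z, 0 < w z -> small_grid (R := R) z].
  by move=> j; exact: normalized_barycentre.
exists (fun t => (group_norm A)^-1 * (frobenius_mx (A t.1) * v t.1 t.2)); split.
- move=> [j z] /=; have [v0 _ _ _] := hv j.
  by rewrite !mulr_ge0 ?frobenius_mx_ge0// invr_ge0 ltW.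
- rewrite -mulr_sumr -(pair_bigA _ (fun j z => frobenius_mx (A j) * v j z)) /=.
  under eq_bigr => j _.
    have [_ v1 _ _] := hv j; rewrite -mulr_sumr v1 mulr1; over.
  by rewrite mulVf// lt0r_neq0.
- apply/ffunP => j; apply/matrixP => k l.
  rewrite sum_ffunE summxE ffunE mxE.
  rewrite -(pair_bigA _ (fun j' z => ((group_norm A)^-1 * (frobenius_mx (A j') * v j' z) *: atom (j', z)) j k l)) /=.
  rewrite (bigD1 j)//= [X in _ + X]big1 ?addr0; last first.
    move=> j' j'j; rewrite big1// => z _.
    by rewrite !ffunE mxE eq_sym (negbTE j'j) mxE mulr0.
  have [_ _ vA _] := hv j; rewrite -vA mulr_sumr; apply: eq_bigr => z _.
  by rewrite !ffunE mxE eqxx mxE !mulrA.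
- move=> [j z] /= wz; have [v0 _ _ vs] := hv j; apply: vs.
  rewrite lt_neqAle v0 andbT eq_sym; apply: contraTneq wz => ->.
  by rewrite !mulr0 ltxx.
Qed.

(** Maurey for the form |.|_n^2 - c |.|_F^2, which is nonnegative on sums of k atoms. *)
Lemma restricted_lower_bound (c L : R) (k : nat) (A : tensor R m p) : 0 <= c -> (1 < k)%N ->
  (forall r : seq ('I_p * gridmx), size r = k -> {in r, forall t, small_grid (R := R) t.2} ->
     c * frobenius (\sum_(t <- r) atom t) ^+ 2
       <= emp_form (\sum_(t <- r) atom t) (\sum_(t <- r) atom t)) ->
  (forall t : 'I_p * gridmx, small_grid (R := R) t.2 -> emp_form (atom t) (atom t) <= L) ->
  c * frobenius A ^+ 2 - L * group_norm A ^+ 2 / (k%:R - 1) <= emp_form A A.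
Proof.
move=> c0 k1 lower upper.
have k1R : 0 < k%:R - 1 :> R by rewrite subr_gt0 ltr1n.
have [A0|A0] := eqVneq (group_norm A) 0.
  have Aj j : A j = 0.
    apply: frobenius_mx_eq0; apply/eqP; move/eqP: A0.
    rewrite psumr_eq0 => [/allP/(_ j (mem_index_enum j))//|j' _].
    exact: frobenius_mx_ge0.
  have -> : frobenius A ^+ 2 = 0.
    rewrite frobenius_sqr big1// => j _; rewrite big1// => k' _; rewrite big1// => l _.
    by rewrite Aj mxE expr0n.
  by rewrite A0 expr0n /= !(mulr0, mul0r) subr0 emp_form_ge0.
have {}A0 : 0 < group_norm A.
  by rewrite lt_neqAle eq_sym A0 sumr_ge0// => j _; exact: frobenius_mx_ge0.
have [w [w0 w1 wA ws]] := tensor_barycentre A0.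
pose B (x y : tensor R m p) := emp_form x y - c * tensor_dot x y.
have Bsym x y : B x y = B y x by rewrite /B emp_formC tensor_dotC.
have BDl x y z : B (x + y) z = B x z + B y z.
  by rewrite /B emp_formDl tensor_dotDl; ring.
have BZl a x y : B (a *: x) y = a * B x y by rewrite /B emp_formZl tensor_dotZl; ring.
have Bsum x : \sum_t w t * B x (atom t) = B x ((group_norm A)^-1 *: A).
  rewrite -wA Bsym; elim/big_rec2: _ => [|t y1 y2 _ IH].
    by have := BDl 0 0 x; rewrite addr0; lra.
  by rewrite BDl -IH BZl (Bsym x).
have := maurey_lower_bound Bsym BDl w0 w1 Bsum k1 (L := L).
have lower' r : size r = k -> {in r, forall t, 0 < w t} ->
    0 <= B (\sum_(t <- r) atom t) (\sum_(t <- r) atom t).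
  move=> sr wr; rewrite /B tensor_dot_frobenius subr_ge0; apply: lower => //.
  by move=> t /wr/ws.
have upper' t : 0 < w t -> B (atom t) (atom t) <= L.
  move=> /ws/upper; apply: le_trans; rewrite /B lerBlDr lerDl mulr_ge0//.
  by rewrite tensor_dot_frobenius sqr_ge0.
move=> /(_ lower' upper'); rewrite BZl Bsym BZl mulrA -expr2 exprVn.
rewrite ler_pdivlMl ?exprn_gt0// /B tensor_dot_frobenius.
rewrite mulrN (mulrC L) -mulrA (mulrC (_ ^+ 2)); lra.
Qed.

(** By convexity, since U / |U|_F is a barycentre of atoms. *)
Lemma slice_upper_bound (L : R) (j : 'I_p) (U : 'M[R]_m) :
  (forall t : 'I_p * gridmx, small_grid (R := R) t.2 -> emp_form (atom t) (atom t) <= L) ->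
  emp_form (slice j U) (slice j U) <= L * frobenius_mx U ^+ 2.
Proof.
move=> upper.
have [w [w0 w1 wU ws]] := normalized_barycentre U.
have wE : slice j U = frobenius_mx U *: \sum_z w z *: atom (j, z).
  apply/ffunP => j'; apply/matrixP => k l; rewrite !ffunE mxE sum_ffunE summxE.
  case: (eqVneq j' j) => [->|j'j].
    rewrite -wU mulr_sumr; apply: eq_bigr => z _.
    by rewrite !ffunE mxE eqxx mxE mulrA.
  rewrite mxE big1 ?mulr0// => z _.
  by rewrite !ffunE mxE (negbTE j'j) mxE mulr0.
rewrite wE emp_formZl emp_formC emp_formZl mulrA -expr2 mulrC ler_wpM2r ?sqr_ge0//.
have Bsum x : \sum_z w z * emp_form x (atom (j, z)) = emp_form x (\sum_z w z *: atom (j, z)).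
  rewrite emp_formC; elim/big_rec2: _ => [|t y1 y2 _ IH].
    by have := emp_formDl 0 0 x; rewrite addr0; lra.
  by rewrite emp_formDl -IH emp_formZl (emp_formC x).
apply: (jensen_quadratic emp_formC emp_formDl w0 w1 Bsum emp_form_ge0).
by move=> z /ws zs; exact: (upper (j, z)).
Qed.

End RestrictedEigenvalue.

Section FrobeniusGeometry.
Context {R : realType} {a b : nat}.
Implicit Types M N : 'M[R]_(a, b).

Lemma frobenius_mx_cauchy_schwarz M N :
  \sum_k \sum_l M k l * N k l <= frobenius_mx M * frobenius_mx N.
Proof.
have [M0|M0] := eqVneq (frobenius_mx M) 0.
  rewrite M0 mul0r (frobenius_mx_eq0 M0) big1// => k _; rewrite big1// => l _.
  by rewrite mxE mul0r.
have [N0|N0] := eqVneq (frobenius_mx N) 0.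
  rewrite N0 mulr0 (frobenius_mx_eq0 N0) big1// => k _; rewrite big1// => l _.
  by rewrite mxE mulr0.
have Mp : 0 < frobenius_mx M by rewrite lt_neqAle eq_sym M0 frobenius_mx_ge0.
have Np : 0 < frobenius_mx N by rewrite lt_neqAle eq_sym N0 frobenius_mx_ge0.
set x := frobenius_mx M in M0 Mp *; set y := frobenius_mx N in N0 Np *.
apply: (@le_trans _ _ (\sum_k \sum_l (y / (2 * x) * M k l ^+ 2 + x / (2 * y) * N k l ^+ 2))).
  apply: ler_sum => k _; apply: ler_sum => l _.
  have : 0 <= (2 * x * y)^-1 * (y * M k l - x * N k l) ^+ 2.
    by rewrite mulr_ge0 ?sqr_ge0// invr_ge0 !mulr_ge0// ltW.
  have -> : (2 * x * y)^-1 * (y * M k l - x * N k l) ^+ 2 =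
    y / (2 * x) * M k l ^+ 2 + x / (2 * y) * N k l ^+ 2 - M k l * N k l.
    by field; rewrite M0 N0.
  lra.
under eq_bigr do rewrite big_split /= -!mulr_sumr.
rewrite big_split /= -!mulr_sumr -!frobenius_mx_sqr -/x -/y.
by rewrite le_eqVlt; apply/orP; left; apply/eqP; field; rewrite M0 N0.
Qed.

Lemma frobenius_mx_triangle M N : frobenius_mx (M + N) <= frobenius_mx M + frobenius_mx N.
Proof.
rewrite -(@ler_pXn2r _ 2) ?nnegrE ?addr_ge0 ?frobenius_mx_ge0// sqrrD !frobenius_mx_sqr.
rewrite (_ : \sum_k \sum_l (M + N) k l ^+ 2 = \sum_k \sum_l M k l ^+ 2
    + 2 * (\sum_k \sum_l M k l * N k l) + \sum_k \sum_l N k l ^+ 2); last first.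
  rewrite mulr_sumr -!big_split /=; apply: eq_bigr => k _.
  rewrite mulr_sumr -!big_split /=; apply: eq_bigr => l _.
  by rewrite mxE; ring.
by rewrite lerD2r lerD2l; have := frobenius_mx_cauchy_schwarz M N; lra.
Qed.

Lemma frobenius_mxN M : frobenius_mx (- M) = frobenius_mx M.
Proof.
congr Num.sqrt; apply: eq_bigr => k _; apply: eq_bigr => l _.
by rewrite mxE sqrrN.
Qed.

End FrobeniusGeometry.

Section OracleInequality.
Context {R : realType} {n m p : nat} (X : 'I_n -> 'M[R]_(m, p)) (E : 'I_n -> 'cV[R]_m).
Variables (T That : tensor R m p) (lambda : R) (s : nat).
Hypotheses (n_gt0 : (0 < n)%N) (lambda_gt0 : 0 < lambda).
Hypothesis sparseT : sparse_class s T.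
Hypothesis minimal :
  is_minimizer (objective lambda X (fun i => inner T (X i) + E i)) That.

Definition noise_matrix (j : 'I_p) : 'M[R]_m :=
  \matrix_(k, l) (n%:R^-1 * \sum_i E i k 0 * X i l j).

Hypothesis noise_small : forall j, frobenius_mx (noise_matrix j) <= 9 / 10 * lambda.

Local Notation Delta := (That - T).

Let noise_term : n%:R^-1 * \sum_i \sum_k E i k 0 * inner Delta (X i) k 0 <=
  9 / 10 * lambda * group_norm Delta.
Proof.
have -> : n%:R^-1 * \sum_i \sum_k E i k 0 * inner Delta (X i) k 0 =
    \sum_j \sum_k \sum_l noise_matrix j k l * Delta j k l.
  transitivity (n%:R^-1 * \sum_i \sum_k \sum_j \sum_l E i k 0 * X i l j * Delta j k l).
    congr (_ * _); apply: eq_bigr => i _; apply: eq_bigr => k _.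
    rewrite mxE mulr_sumr; apply: eq_bigr => j _; rewrite mulr_sumr; apply: eq_bigr => l _.
    by rewrite mulrA.
  rewrite mulr_sumr.
  under eq_bigr do rewrite mulr_sumr.
  under eq_bigr do under eq_bigr do rewrite mulr_sumr.
  under eq_bigr do under eq_bigr do under eq_bigr do rewrite mulr_sumr.
  under eq_bigr do rewrite exchange_big /=.
  rewrite exchange_big /=; apply: eq_bigr => j _.
  rewrite exchange_big /=; apply: eq_bigr => k _.
  rewrite exchange_big /=; apply: eq_bigr => l _.
  rewrite mxE -mulrA mulr_suml mulr_sumr; apply: eq_bigr => i _.
  by rewrite !mulrA.
rewrite mulr_sumr; apply: ler_sum => j _.
apply: (le_trans (frobenius_mx_cauchy_schwarz _ _)).
by rewrite ler_wpM2r ?frobenius_mx_ge0.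
Qed.

Let support : pred 'I_p := fun j => frobenius_mx (T j) != 0.

(** Cauchy-Schwarz over at most s slices. *)
Let support_norm : \sum_(j | support j) frobenius_mx (Delta j) <= Num.sqrt s%:R * frobenius Delta.
Proof.
have x0 j : 0 <= frobenius_mx (Delta j) by exact: frobenius_mx_ge0.
have s_le : \sum_(j | support j) (1 : R) <= s%:R.
  have -> : \sum_(j | support j) (1 : R) = (\sum_(j | support j) 1)%N%:R by rewrite natr_sum.
  rewrite ler_nat; apply: leq_trans sparseT.
  by rewrite big_mkcond; apply: leq_sum => j _; rewrite /support; case: (_ != _).
have [F0|F0] := eqVneq (frobenius Delta) 0.
  have : frobenius Delta ^+ 2 = 0 by rewrite F0 expr0n.
  rewrite frobenius_slices => /eqP; rewrite psumr_eq0 => [/allP z|j _]; last exact: sqr_ge0.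
  rewrite F0 mulr0 big1// => j _; apply/eqP.
  by have := z j (mem_index_enum j); rewrite sqrf_eq0.
have Fp : 0 < frobenius Delta by rewrite lt_neqAle eq_sym F0 sqrtr_ge0.
have sR : 0 <= s%:R :> R by [].
have [s0|s0] := eqVneq s 0%N.
  rewrite s0 sqrtr0 mul0r big_pred0// => j; apply/negbTE/negP => sj.
  by move: s_le; rewrite s0 (bigD1 j)//= leNgt ltr_wpDr// sumr_ge0.
have rp : 0 < Num.sqrt s%:R :> R by rewrite sqrtr_gt0 ltr0n lt0n.
have r2 : Num.sqrt s%:R ^+ 2 = s%:R :> R by rewrite sqr_sqrtr.
set r := Num.sqrt _ in rp r2 *; set F := frobenius _ in Fp F0 *.
(* Cauchy-Schwarz, as the sum over the support of x <= (F / r + r x^2 / F) / 2. *)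
apply: (@le_trans _ _ (\sum_(j | support j) (F / (2 * r) * 1 + r / (2 * F) * frobenius_mx (Delta j) ^+ 2))).
  apply: ler_sum => j _; have := x0 j; set x := frobenius_mx _ => xj.
  have : 0 <= (2 * r * F)^-1 * (F - r * x) ^+ 2.
    by rewrite mulr_ge0 ?sqr_ge0// invr_ge0 !mulr_ge0// ltW.
  have -> : (2 * r * F)^-1 * (F - r * x) ^+ 2 = F / (2 * r) * 1 + r / (2 * F) * x ^+ 2 - x.
    by field; rewrite F0 lt0r_neq0.
  lra.
rewrite big_split /= -!mulr_sumr.
have le2 : \sum_(j | support j) frobenius_mx (Delta j) ^+ 2 <= F ^+ 2.
  rewrite /F frobenius_slices [leRHS](bigID support) /= lerDl.
  by apply: sumr_ge0 => j _; exact: sqr_ge0.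
apply: (@le_trans _ _ (F / (2 * r) * r ^+ 2 + r / (2 * F) * F ^+ 2)).
  by apply: lerD; apply: ler_wpM2l; rewrite ?r2// divr_ge0// ?mulr_ge0// ltW.
by rewrite le_eqVlt; apply/orP; left; apply/eqP; field; rewrite F0 lt0r_neq0.
Qed.

(** The objective at the minimizer is at most the objective at T. The noise term is at
most 9/10 of the penalty of the error, which leaves 1/10 of it outside the support. *)
Lemma basic_inequality :
  2^-1 * emp_form X Delta Delta <=
  lambda * (19 / 10 * \sum_(j | support j) frobenius_mx (Delta j)
            - 1 / 10 * \sum_(j | ~~ support j) frobenius_mx (Delta j)).
Proof.
have := minimal T; rewrite /objective.
have sqE (i : 'I_n) (B : tensor R m p) :
  frobenius_mx (inner T (X i) + E i - inner B (X i)) ^+ 2 =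
  \sum_k E i k 0 ^+ 2 - 2 * (\sum_k E i k 0 * inner (B - T) (X i) k 0)
    + \sum_k inner (B - T) (X i) k 0 * inner (B - T) (X i) k 0.
  rewrite frobenius_mx_sqr mulr_sumr -sumrB -big_split; apply: eq_bigr => k _ /=.
  by rewrite big_ord1 innerB !mxE; ring.
have fitE (B : tensor R m p) : (2 * n%:R)^-1 *
    \sum_i frobenius_mx (inner T (X i) + E i - inner B (X i)) ^+ 2 =
  (2 * n%:R)^-1 * (\sum_i \sum_k E i k 0 ^+ 2)
   - n%:R^-1 * (\sum_i \sum_k E i k 0 * inner (B - T) (X i) k 0)
   + 2^-1 * emp_form X (B - T) (B - T).
  under eq_bigr do rewrite sqE.
  rewrite big_split sumrB /= -mulr_sumr /emp_form.
  by field; rewrite pnatr_eq0 -lt0n.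
rewrite !fitE subrr.
have inner0 i k : inner (0 : tensor R m p) (X i) k 0 = 0.
  by rewrite mxE big1// => j _; rewrite big1// => l _; rewrite ffunE mxE mulr0.
have -> : emp_form X 0 0 = 0.
  by rewrite /emp_form big1 ?mulr0// => i _; rewrite big1// => k _; rewrite inner0 mulr0.
rewrite [\sum_i \sum_k E i k 0 * inner 0 (X i) k 0]big1 ?mulr0 ?subr0 ?addr0; last first.
  by move=> i _; rewrite big1// => k _; rewrite inner0 mulr0.
move=> opt.
have {}opt : 2^-1 * emp_form X Delta Delta <=
   n%:R^-1 * (\sum_i \sum_k E i k 0 * inner Delta (X i) k 0)
   + lambda * (\sum_j frobenius_mx (T j) - \sum_j frobenius_mx (That j)) by lra.
apply: (le_trans opt).
have pen : \sum_j frobenius_mx (T j) - \sum_j frobenius_mx (That j) <=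
   \sum_(j | support j) frobenius_mx (Delta j) - \sum_(j | ~~ support j) frobenius_mx (Delta j).
  rewrite -sumrB (bigID support) /= -sumrN; apply: lerD.
    apply: ler_sum => j _; rewrite lerBlDr.
    have -> : T j = - Delta j + That j by rewrite !ffunE opprB subrK.
    by rewrite -(frobenius_mxN (Delta j)); exact: frobenius_mx_triangle.
  apply: ler_sum => j; rewrite negbK => /eqP Tj0.
  by rewrite Tj0 !ffunE (frobenius_mx_eq0 Tj0) subr0 sub0r.
have gE : group_norm Delta = \sum_(j | support j) frobenius_mx (Delta j) +
   \sum_(j | ~~ support j) frobenius_mx (Delta j) by rewrite /group_norm (bigID support).
have := noise_term; rewrite gE.
have : lambda * (\sum_j frobenius_mx (T j) - \sum_j frobenius_mx (That j)) <=
  lambda * (\sum_(j | support j) frobenius_mx (Delta j) - \sum_(j | ~~ support j) frobenius_mx (Delta j)).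
  by rewrite ler_pM2l.
lra.
Qed.

(** The basic inequality confines the error to the cone N_1 <= 20 N_S <= 20 sqrt(s) |.|_F,
with N_S the part of N_1 on the support of T. There the loss L N_1^2 / K is at most half
of c |.|_F^2, and the basic inequality becomes c |.|_F^2 / 2 <= 3.8 lambda sqrt(s) |.|_F. *)
Lemma oracle_inequality (c L K : R) : 0 < c -> 0 <= L -> 0 < K ->
  (forall A, c * frobenius A ^+ 2 - L * group_norm A ^+ 2 / K <= emp_form X A A) ->
  800 * L * s%:R <= c * K ->
  frobenius Delta ^+ 2 <= 58 * s%:R * lambda ^+ 2 / c ^+ 2 /\
  emp_form X Delta Delta <= 29 * s%:R * lambda ^+ 2 / c.
Proof.
move=> c0 L0 K0 RE cK.
have basic := basic_inequality.
set NS := \sum_(j | support j) _ in basic *.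
set NC := \sum_(j | ~~ support j) _ in basic *.
have gE : group_norm Delta = NS + NC by rewrite /group_norm (bigID support).
have NC0 : 0 <= NC by apply: sumr_ge0 => j _; exact: frobenius_mx_ge0.
have NS0 : 0 <= NS by apply: sumr_ge0 => j _; exact: frobenius_mx_ge0.
have Q0 := emp_form_ge0 X Delta.
set q := emp_form _ _ _ in basic Q0 *.
have cone : group_norm Delta <= 20 * NS.
  have : 0 <= lambda * (19 / 10 * NS - 1 / 10 * NC) by lra.
  by rewrite pmulr_rge0// gE; lra.
have NSle := support_norm; rewrite -/NS in NSle.
set f := frobenius Delta in NSle *; set r := Num.sqrt s%:R in NSle.
have f0 : 0 <= f by exact: sqrtr_ge0.
have r0 : 0 <= r by exact: sqrtr_ge0.
have r2 : r ^+ 2 = s%:R by rewrite sqr_sqrtr.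
have g2 : group_norm Delta ^+ 2 <= 400 * s%:R * f ^+ 2.
  have -> : 400 * s%:R * f ^+ 2 = (20 * (r * f)) ^+ 2 by rewrite -r2; ring.
  rewrite ler_pXn2r ?nnegrE ?mulr_ge0//; last by rewrite gE addr_ge0.
  by apply: (le_trans cone); rewrite ler_pM2l.
have lowq : c / 2 * f ^+ 2 <= q.
  have := RE Delta; rewrite -/f -/q; apply: le_trans.
  have : L * group_norm Delta ^+ 2 / K <= c / 2 * f ^+ 2.
    rewrite ler_pdivrMr//.
    apply: (@le_trans _ _ (L * (400 * s%:R * f ^+ 2))); first by rewrite ler_wpM2l.
    have := ler_wpM2r (sqr_ge0 f) cK; lra.
  lra.
have upq : q <= 38 / 10 * lambda * r * f.
  have : lambda * (19 / 10 * NS - 1 / 10 * NC) <= lambda * (19 / 10 * (r * f)).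
    by rewrite ler_pM2l//; lra.
  lra.
have lr0 : 0 <= lambda * r by rewrite mulr_ge0// ltW.
have fle : f <= 76 / 10 * (lambda * r) / c.
  rewrite ler_pdivlMr//; have [->|fn0] := eqVneq f 0; first by rewrite mul0r mulr_ge0.
  have fp : 0 < f by rewrite lt_neqAle eq_sym fn0.
  rewrite -(ler_pM2r fp); lra.
have lr2 : (lambda * r) ^+ 2 = s%:R * lambda ^+ 2 by rewrite exprMn r2 mulrC.
have c2 : 0 < c ^+ 2 by rewrite exprn_gt0.
split.
  apply: (@le_trans _ _ ((76 / 10 * (lambda * r) / c) ^+ 2)).
    by rewrite ler_pXn2r ?nnegrE// divr_ge0 ?mulr_ge0// ltW.
  rewrite exprMn exprVn ler_pM2r ?invr_gt0// exprMn lr2.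
  have : 0 <= s%:R * lambda ^+ 2 by rewrite mulr_ge0 ?sqr_ge0.
  lra.
apply: (le_trans upq).
rewrite (_ : 38 / 10 * lambda * r * f = 38 / 10 * (lambda * r) * f); last by rewrite !mulrA.
apply: (@le_trans _ _ (38 / 10 * (lambda * r) * (76 / 10 * (lambda * r) / c))).
  by rewrite ler_wpM2l// mulr_ge0.
rewrite mulrA ler_pM2r ?invr_gt0//.
have -> : 38 / 10 * (lambda * r) * (76 / 10 * (lambda * r)) = 38 / 10 * (76 / 10) * (lambda * r) ^+ 2 by ring.
rewrite lr2; have : 0 <= s%:R * lambda ^+ 2 by rewrite mulr_ge0 ?sqr_ge0.
lra.
Qed.

End OracleInequality.

(** * Exponential moments of squared norms *)

Section SubgaussianChiSquare.
Context {R : realType} {d : measure_display} {Omega : measurableType d}.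
Variables (P : probability Omega R) (I : eqType) (v : I -> Omega -> R) (beta t : R).
Hypothesis mv : forall a, measurable_fun setT (v a).
Hypotheses (t_gt0 : 0 < t) (t_small : 2 * t * beta < 1).

Let inv_root : R := (Num.sqrt (1 - 2 * t * beta))^-1.

(** The generating function at x of N(0, 2 t). *)
Lemma exp_sqr_linearized (x : R) :
  ((expR (t * x ^+ 2))%:E = \int[normal_prob 0 (Num.sqrt (2 * t))]_y (expR (y * x))%:E)%E.
Proof.
have s0 : Num.sqrt (2 * t) != 0 :> R by rewrite lt0r_neq0// sqrtr_gt0 mulr_gt0.
under eq_integral do rewrite mulrC.
rewrite normal_mgf// sqr_sqrtr ?mulr_ge0 ?ltW// mulr0 add0r; congr (expR _)%:E.
by field.
Qed.

(** Induction on the number of coordinates: the square of one coordinate is linearised,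
and integrating the sub-Gaussian bound against N(0, 2 t) costs one factor
(1 - 2 t beta)^(-1/2). The weight Y absorbs the factors exp(t v_a^2) of the coordinates
already removed from the sum, and any event to which the bound is restricted. *)
Lemma subgaussian_exp_sum_sqr (r : seq I) : uniq r ->
  forall (Y : Omega -> R) (C : R), measurable_fun setT Y -> (forall w, 0 <= Y w) -> 0 <= C ->
  (forall g : I -> R, (\int[P]_w (expR (\sum_(a <- r) g a * v a w) * Y w)%:E <=
     (C * expR (beta / 2 * \sum_(a <- r) g a ^+ 2))%:E)%E) ->
  (\int[P]_w (expR (t * \sum_(a <- r) v a w ^+ 2) * Y w)%:E <= (C * inv_root ^+ size r)%:E)%E.
Proof.
elim: r => [_|a r IH /= /andP[ar ur]] Y C mY Y0 C0 sub.
  have := sub (fun=> 0); rewrite !big_nil mulr0 expR0 expr0.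
  apply: le_trans; rewrite le_eqVlt; apply/orP; left; apply/eqP.
  by apply: eq_integral => w _; rewrite !big_nil mulr0.
pose s := Num.sqrt (2 * t).
have s0 : s != 0 by rewrite lt0r_neq0// sqrtr_gt0 mulr_gt0.
pose Y' w := expR (t * v a w ^+ 2) * Y w.
have mY' : measurable_fun setT Y'.
  apply: measurable_funM => //; apply: measurableT_comp => //.
  by apply: measurable_funM => //; exact: measurable_funX.
have ir0 : 0 <= inv_root by rewrite invr_ge0 sqrtr_ge0.
have msum (g : I -> R) (r' : seq I) : measurable_fun setT (fun w => \sum_(b <- r') g b * v b w).
  by apply: measurable_sum => b; exact: measurable_funM.
have := IH ur Y' (C * inv_root) mY' _ _ _.
rewrite exprS mulrA => H; apply: le_trans (H _ _ _) => {H}.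
- rewrite le_eqVlt; apply/orP; left; apply/eqP.
  apply: eq_integral => w _; rewrite /Y' big_cons mulrDr expRD.
  by congr EFin; ring.
- by move=> w; rewrite mulr_ge0 ?expR_ge0.
- by rewrite mulr_ge0.
move=> g; pose Gm (w : Omega) := \sum_(b <- r) g b * v b w.
pose F (z : Omega * measurableTypeR R) : \bar R :=
  (expR (z.2 * v a z.1 + Gm z.1) * Y z.1)%:E.
have mF : measurable_fun setT F.
  apply/measurable_EFinP; apply: measurable_funM; last exact: (measurableT_comp mY).
  apply: measurableT_comp => //; apply: measurable_funD; last first.
    exact: (measurableT_comp (msum g r)).
  apply: measurable_funM; first exact: measurable_snd.
  exact: (measurableT_comp (mv a)).
have F0 z : (0 <= F z)%E by rewrite lee_fin mulr_ge0 ?expR_ge0.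
have -> : (\int[P]_w (expR (\sum_(b <- r) g b * v b w) * Y' w)%:E =
    \int[P]_w \int[normal_prob 0 s]_y F (w, y))%E.
  apply: eq_integral => w _; rewrite /F /=.
  under [RHS]eq_integral do rewrite expRD -mulrA EFinM.
  rewrite ge0_integralZr; first by rewrite -exp_sqr_linearized /Y' -EFinM; congr EFin; rewrite /Gm; ring.
  - exact: measurableT.
  - by apply/measurable_EFinP/measurableT_comp => //; exact: measurable_funM.
  - by move=> y _; rewrite lee_fin expR_ge0.
  - by rewrite lee_fin mulr_ge0 ?expR_ge0.
rewrite (fubini_tonelli F mF F0).
set q := beta / 2 * \sum_(b <- r) g b ^+ 2.
apply: (@le_trans _ _ (\int[normal_prob 0 s]_y ((C * expR q)%:E * (expR (beta / 2 * y ^+ 2))%:E))%E).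
  apply: ge0_le_integral => //.
  - by move=> y _; apply: integral_ge0 => w _; exact: F0.
  - exact: measurable_fun_fubini_tonelli_G.
  - apply: emeasurable_funM => //.
    by apply/measurable_EFinP/measurableT_comp => //; apply: measurable_funM => //; exact: measurable_funX.
  - move=> y _; have := sub (fun b => if b == a then y else g b).
    have eqs (F1 : R -> I -> R) : \sum_(b <- a :: r) F1 (if b == a then y else g b) b =
        F1 y a + \sum_(b <- r) F1 (g b) b.
      rewrite big_cons eqxx; congr (_ + _); apply: eq_big_seq => b br.
      by case: eqP => // ba; rewrite -ba br in ar.
    rewrite (eqs (fun x _ => x ^+ 2)).
    have -> : C * expR (beta / 2 * (y ^+ 2 + \sum_(b <- r) g b ^+ 2)) =
       C * expR q * expR (beta / 2 * y ^+ 2) by rewrite mulrDr expRD /q; ring.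
    rewrite -EFinM; apply: le_trans; rewrite le_eqVlt; apply/orP; left; apply/eqP.
    by apply: eq_integral => w _; rewrite /F /= (eqs (fun x b => x * v b w)).
rewrite ge0_integralZl.
- rewrite normal_exp_sqr//.
    rewrite -EFinM lee_fin /s sqr_sqrtr; last by rewrite mulr_ge0// ltW.
    have -> : 1 - 2 * (beta / 2) * (2 * t) = 1 - 2 * t * beta by field.
    by rewrite -/inv_root mulrAC.
  rewrite /s sqr_sqrtr; last by rewrite mulr_ge0// ltW.
  by have -> : 1 - 2 * (beta / 2) * (2 * t) = 1 - 2 * t * beta; [field|rewrite subr_gt0].
- exact: measurableT.
- by apply/measurable_EFinP/measurableT_comp => //; apply: measurable_funM => //; exact: measurable_funX.
- by move=> y _; rewrite lee_fin expR_ge0.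
- by rewrite lee_fin mulr_ge0 ?expR_ge0.
Qed.

End SubgaussianChiSquare.

(** * Concentration of the empirical norm *)

Section RowTails.
Context {R : realType} {d : measure_display} {Omega : measurableType d}.
Variables (P : probability Omega R) (n m p : nat) (cl cu sigma : R).
Variables (S : 'M[R]_(p * m)).
Variables (X : 'I_n -> Omega -> 'M[R]_(m, p)) (eps : 'I_n -> Omega -> 'cV[R]_m).
Hypothesis model : regression_model P cl cu sigma S X eps.
Variables (A : tensor R m p) (k : 'I_m).

Definition row_energy (w : Omega) : R := \sum_i inner A (X i w) k 0 ^+ 2.

Local Notation q := (qform S (row_vector A k)).

Lemma inner_measurable i : measurable_fun setT (fun w => inner A (X i w) k 0).
Proof. by have [s []] := inner_law_qform model A i k. Qed.

Lemma row_energy_measurable : measurable_fun setT row_energy.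
Proof. by apply: measurable_sum => i; apply: measurable_funX; exact: inner_measurable. Qed.

Lemma row_energy_ge0 w : 0 <= row_energy w.
Proof. by apply: sumr_ge0 => i _; exact: sqr_ge0. Qed.

Lemma row_energy_mgf t : 0 < 1 - 2 * t * q ->
  (\int[P]_w (expR (t * row_energy w))%:E = ((Num.sqrt (1 - 2 * t * q))^-1 ^+ n)%:E)%E.
Proof.
move=> tq.
pose f (i : 'I_n) (lj : 'I_m * 'I_p) (w : Omega) := X i w lj.1 lj.2.
pose g (i : 'I_n) (w : Omega) := expR (t * inner A (X i w) k 0 ^+ 2).
have mf i lj : measurable_fun setT (f i lj).
  exact: (covariate_measurable model (i, lj.1, lj.2)).
have indf : mutually_independent P (fun i => sigma_gen (f i)).
  by case: model => [_ [[ind _] _ _]].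
have mg i : measurable_fun setT (g i : generated (f i) -> R).
  apply: measurableT_comp => //; apply: measurable_funM => //; apply: measurable_funX.
  rewrite [F in measurable_fun _ F](_ : _ = (fun w => \sum_j \sum_l X i w l j * A j k l)); last first.
    by apply/funext => w; rewrite mxE.
  apply: measurable_sum => j; apply: measurable_sum => l; apply: measurable_funM => //.
  exact: (measurable_generator (f i) (l, j)).
have g0 i w : 0 <= g i w by exact: expR_ge0.
transitivity (\int[P]_w (\prod_i g i w)%:E)%E.
  apply: eq_integral => w _; congr EFin.
  by rewrite /row_energy mulr_sumr expR_sum.
rewrite (ge0_integral_prod_independent mf indf mg g0).
have gE i : (\int[P]_w (g i w)%:E = ((Num.sqrt (1 - 2 * t * q))^-1)%:E)%E.
  have [s law sE] := inner_law_qform model A i k.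
  by rewrite (has_law_exp_sqr law) sE.
under eq_bigr do rewrite gE.
by rewrite prodEFin prodr_const card_ord.
Qed.

(** Chernoff; a negative t gives lower tails. *)
Lemma row_energy_tail (t c rho : R) : 0 < 1 - 2 * t * q ->
  expR (- (t * c)) / Num.sqrt (1 - 2 * t * q) <= rho ->
  (P [set w | (t * (n%:R * c) <= t * row_energy w)%R] <= (rho ^+ n)%:E)%E.
Proof.
move=> tq le_rho.
have mt : measurable_fun setT (fun w => t * row_energy w).
  by apply: measurable_funM => //; exact: row_energy_measurable.
have me : measurable_fun setT (fun w => expR (t * row_energy w)) by exact: measurableT_comp.
have mE : measurable [set w | t * (n%:R * c) <= t * row_energy w] by exact: measurable_le_set.
apply: (le_trans (probability_le_integral (g := fun w => expR (- (t * c)) ^+ n * expR (t * row_energy w)) P mE _ _ _)).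
- exact: measurable_funM.
- by move=> w; rewrite mulr_ge0 ?expR_ge0// exprn_ge0// expR_ge0.
- move=> w /= le; rewrite -expRM_natl -expRD -[leLHS]expR0 ler_expR.
  have -> : n%:R * - (t * c) = - (t * (n%:R * c)) by ring.
  by rewrite addrC subr_ge0.
rewrite ge0_integral_realZ; [|exact: me|by rewrite exprn_ge0// expR_ge0|by move=> w; exact: expR_ge0].
rewrite row_energy_mgf// -EFinM lee_fin -exprMn.
by apply: lerXn2r; rewrite ?nnegrE ?mulr_ge0 ?expR_ge0 ?invr_ge0 ?sqrtr_ge0// (le_trans _ le_rho)// divr_ge0 ?expR_ge0 ?sqrtr_ge0.
Qed.

(** An upper bound for the Chernoff factors exp(1/4) / sqrt 2 of the lower tail and
exp(-11/200) / sqrt(9/10) of the upper tail. *)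
Definition tail_rate : R := 1999 / 2000.

Let tail_rate_sqr : 998 / 999 <= tail_rate ^+ 2.
Proof. rewrite /tail_rate; lra. Qed.

Let tail_rate_ge0 : 0 <= tail_rate.
Proof. rewrite /tail_rate; lra. Qed.

Let sqrt_ratio_le_gen (e c b rho : R) : 0 <= e -> 0 < c -> 0 <= rho -> b <= rho ^+ 2 ->
  e ^+ 2 <= b * c -> e / Num.sqrt c <= rho.
Proof.
move=> e0 c0 rho0 brho le; have sc : 0 < Num.sqrt c by rewrite sqrtr_gt0.
rewrite ler_pdivrMr// -(@ler_pXn2r _ 2) ?nnegrE ?mulr_ge0 ?(ltW sc)//.
by rewrite exprMn sqr_sqrtr ?(ltW c0)// (le_trans le)// ler_pM2r.
Qed.

Let sqrt_ratio_le (e c : R) : 0 <= e -> 0 < c -> e ^+ 2 <= 998 / 999 * c -> e / Num.sqrt c <= tail_rate.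
Proof.
move=> e0 c0 le; exact: (sqrt_ratio_le_gen e0 c0 tail_rate_ge0 tail_rate_sqr le).
Qed.

Lemma row_energy_lower_tail : 0 < q ->
  (P [set w | (row_energy w < n%:R * (q / 2))%R] <= (tail_rate ^+ n)%:E)%E.
Proof.
move=> q0; pose t : R := - (1 / (2 * q)).
have tq : 2 * t * q = - 1 by rewrite /t; field; rewrite lt0r_neq0.
have t0 : t < 0 by rewrite oppr_lt0 divr_gt0// mulr_gt0.
apply: le_trans (row_energy_tail (t := t) (c := q / 2) (rho := tail_rate) _ _).
- apply: le_measure; rewrite ?inE.
  + by apply: measurable_lt_set => //; exact: row_energy_measurable.
  + by apply: measurable_le_set => //; apply: measurable_funM => //; exact: row_energy_measurable.
  + by move=> w /= lt; rewrite ler_nM2l// ltW.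
- by rewrite tq; lra.
- rewrite tq; apply: sqrt_ratio_le; [exact: expR_ge0|lra|].
  have -> : - (t * (q / 2)) = 1 / 4 by rewrite /t; field; rewrite lt0r_neq0.
  rewrite expr2 -expRD (_ : 1 / 4 + 1 / 4 = 1 / 2); last by field.
  have h : 3 / 4 <= expR (- (1 / 4)) :> R by have := @expR_ge1Dx R (- (1 / 4)); lra.
  have e : expR (1 / 2) * (expR (- (1 / 4)) * expR (- (1 / 4))) = 1 :> R.
    by rewrite -!expRD (_ : 1 / 2 + _ = 0) ?expR0//; field.
  have : 9 / 16 <= expR (- (1 / 4)) * expR (- (1 / 4)) :> R by nra.
  by have := expR_gt0 (1 / 2 : R); nra.
Qed.

Lemma row_energy_upper_tail : 0 < q ->
  (P [set w | (n%:R * (11 / 10 * q) < row_energy w)%R] <= (tail_rate ^+ n)%:E)%E.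
Proof.
move=> q0; pose t : R := 1 / (20 * q).
have tq : 2 * t * q = 1 / 10 by rewrite /t; field; rewrite lt0r_neq0.
have t0 : 0 < t by rewrite divr_gt0// mulr_gt0.
apply: le_trans (row_energy_tail (t := t) (c := 11 / 10 * q) (rho := tail_rate) _ _).
- apply: le_measure; rewrite ?inE.
  + by apply: measurable_lt_set => //; exact: row_energy_measurable.
  + by apply: measurable_le_set => //; apply: measurable_funM => //; exact: row_energy_measurable.
  + by move=> w /= lt; rewrite ler_pM2l// ltW.
- by rewrite tq; lra.
- rewrite tq; apply: sqrt_ratio_le; [exact: expR_ge0|lra|].
  have -> : - (t * (11 / 10 * q)) = - (11 / 200) by rewrite /t; field; rewrite lt0r_neq0.
  have h : 211 / 200 <= expR (11 / 200) :> R by have := @expR_ge1Dx R (11 / 200); lra.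
  have e : expR (- (11 / 200)) * expR (11 / 200) = 1 :> R by rewrite -expRD addNr expR0.
  have e0 := expR_gt0 (- (11 / 200) : R).
  have le : expR (- (11 / 200)) <= 200 / 211 :> R by nra.
  move: e0 le; set y := expR _ => e0 le.
  have : y * y <= 200 / 211 * (200 / 211) by apply: ler_pM => //; exact: ltW.
  rewrite expr2; lra.
Qed.

End RowTails.

(** * Counting atoms *)

Section UnionBound.
Context {R : realType} {d : measure_display} {Omega : measurableType d}.
Variable P : probability Omega R.

Lemma union_bound (I : finType) (B : I -> set Omega) (c : R) :
  (forall i, measurable (B i)) -> (forall i, (P (B i) <= c%:E)%E) ->
  (P (\bigcup_i B i) <= (#|I|%:R * c)%:E)%E.
Proof.
move=> mB PB.
have mU : measurable (\bigcup_i B i) by apply: fin_bigcup_measurable => //; exact: finite_finset.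
have mI i : measurable_fun setT (\1_(B i) : Omega -> R) by exact: measurable_indic.
apply: (le_trans (probability_le_integral (g := fun w => \sum_i \1_(B i) w) P mU _ _ _)).
- exact: measurable_sum.
- by move=> w; apply: sumr_ge0 => i _; rewrite indicE.
- move=> w [i _ Biw]; rewrite (bigD1 i)//= indicE mem_set//= lerDl.
  by apply: sumr_ge0 => j _; rewrite indicE.
under eq_integral do rewrite -sumEFin.
rewrite ge0_integral_sum; [|exact: measurableT|by move=> i; exact/measurable_EFinP|
  by move=> i w _; rewrite lee_fin indicE].
have -> : #|I|%:R * c = \sum_(i : I) c by rewrite sumr_const mulr_natl.
rewrite -sumEFin; apply: lee_sum => i _.
by rewrite integral_real_indic.
Qed.

End UnionBound.

Section AtomCount.
Context {R : realType} {m p : nat}.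
Hypothesis m_gt0 : (0 < m)%N.
Local Notation gridmx := {ffun 'I_m * 'I_m -> grid m}.

Lemma geometric_half_le (N : nat) : \sum_(a < N) 2^-1 ^+ a <= 2 :> R.
Proof.
suff -> : \sum_(a < N) 2^-1 ^+ a = 2 - 2 * 2^-1 ^+ N :> R.
  by rewrite lerBlDr lerDl mulr_ge0// exprn_ge0// invr_ge0.
elim: N => [|N IH]; first by rewrite big_ord0 expr0; lra.
by rewrite big_ord_recr /= IH exprS; lra.
Qed.

(** The squared magnitude indices of an admissible matrix add up to at most 121 m^2, hence
so do the indices, and 2^(121 m^2) prod 2^(-index) >= 1. The sum of this weight over all
grid matrices factorises over the m^2 entries, each of which contributes at most
4 (two signs and a geometric series). *)
Lemma small_grid_count :
  #|[pred z : gridmx | small_grid (R := R) z]|%:R <= 2 ^+ (123 * m ^ 2) :> R.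
Proof.
have weight (z : gridmx) : small_grid (R := R) z ->
    1 <= 2 ^+ (121 * m ^ 2) * \prod_kl (2^-1 : R) ^+ (z kl).2.
  move=> zs.
  have sum_sqr : (\sum_kl (z kl).2 ^ 2 <= 121 * m ^ 2)%N.
    rewrite -(ler_nat R) natr_sum.
    move: zs; rewrite /small_grid pair_bigA /= => zs.
    have hE (c : grid m) : (grid_value c : R) ^+ 2 = (c.2 ^ 2)%:R * (grid_step m) ^+ 2.
      by rewrite /grid_value exprMn sqrr_sign mul1r exprMn natrX.
    rewrite (eq_bigr (fun kl => ((z kl).2 ^ 2)%:R * (grid_step m : R) ^+ 2)) in zs; last first.
      by move=> [k l] _; rewrite hE.
    rewrite -mulr_suml in zs.
    rewrite /grid_step exprVn ler_pdivrMr in zs; last first.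
      by rewrite exprn_gt0// mulr_gt0// ltr0n.
    apply: (le_trans zs); rewrite natrM natrX exprMn.
    have : 0 <= (m%:R : R) ^+ 2 by exact: sqr_ge0.
    lra.
  have sum_le : (\sum_kl (z kl).2 <= 121 * m ^ 2)%N.
    apply: leq_trans sum_sqr; apply: leq_sum => kl _.
    by case: (nat_of_ord (z kl).2) => // a; rewrite expnS expn1 leq_pmulr.
  rewrite prodrXr -(subnK sum_le) exprD -mulrA -exprMn mulfV// expr1n mulr1.
  by rewrite -natrX ler1n expn_gt0.
rewrite -sum1_card natr_sum.
apply: (@le_trans _ _ (\sum_(z : gridmx) 2 ^+ (121 * m ^ 2) * \prod_kl (2^-1 : R) ^+ (z kl).2)).
  rewrite [leLHS]big_mkcond /=; apply: ler_sum => z _; case: ifPn => [zs|_].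
    exact: weight.
  by rewrite mulr_ge0 ?exprn_ge0//; apply: prodr_ge0 => kl _; rewrite exprn_ge0 ?invr_ge0.
rewrite -mulr_sumr -(bigA_distr_bigA (fun _ (c : grid m) => (2^-1 : R) ^+ c.2)) /=.
rewrite (_ : 123 * m ^ 2 = 121 * m ^ 2 + 2 * m ^ 2)%N; last by rewrite -mulnDl.
rewrite exprD ler_pM2l ?exprn_gt0// prodr_const card_prod card_ord mulnn exprM.
apply: lerXn2r; rewrite ?nnegrE//.
  by apply: sumr_ge0 => c _; rewrite exprn_ge0 ?invr_ge0.
rewrite -(pair_bigA _ (fun (_ : bool) (a : 'I_(10 * m).+2) => (2^-1 : R) ^+ a)) /=.
rewrite big_bool /=; have := geometric_half_le (10 * m).+2; lra.
Qed.

Lemma small_atom_count :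
  #|{: {t : 'I_p * gridmx | small_grid (R := R) t.2}}|%:R <= p%:R * 2 ^+ (123 * m ^ 2) :> R.
Proof.
rewrite card_sig.
have -> : #|[pred t : 'I_p * gridmx | small_grid (R := R) t.2]| =
   (p * #|[pred z : gridmx | small_grid (R := R) z]|)%N.
  have := cardX 'I_p [pred z : gridmx | small_grid (R := R) z]; rewrite card_ord => <-.
  by apply: eq_card => -[j z]; rewrite !inE.
by rewrite natrM ler_wpM2l// small_grid_count.
Qed.

End AtomCount.

(** * The design event *)

Section GoodDesign.
Context {R : realType} {d : measure_display} {Omega : measurableType d}.
Variables (P : probability Omega R) (n m p : nat) (cl cu sigma : R).
Variables (S : 'M[R]_(p * m)).
Variables (X : 'I_n -> Omega -> 'M[R]_(m, p)) (eps : 'I_n -> Omega -> 'cV[R]_m).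
Hypothesis model : regression_model P cl cu sigma S X eps.
Hypotheses (n_gt0 : (0 < n)%N) (m_gt0 : (0 < m)%N) (p_gt0 : (0 < p)%N) (cl_gt0 : 0 < cl).
Variable N : nat.
Hypothesis N_gt0 : (0 < N)%N.

Local Notation gridmx := {ffun 'I_m * 'I_m -> grid m}.
Local Notation small_atom := {t : 'I_p * gridmx | small_grid (R := R) t.2}.
Local Notation rate := (tail_rate (R := R)).
Local Notation q A k := (qform S (row_vector A k)).

Let qform_ge0 (A : tensor R m p) k : 0 <= q A k.
Proof.
have /andP[le _] := row_qform_bounds model m_gt0 p_gt0 (Ordinal n_gt0) A k.
by apply: le_trans le; rewrite mulr_ge0 ?sqr_ge0 ?sqnorm_ge0.
Qed.

Let energy_eq0 (A : tensor R m p) k w : q A k = 0 -> row_energy X A k w = 0.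
Proof.
move=> q0; have /andP[le _] := row_qform_bounds model m_gt0 p_gt0 (Ordinal n_gt0) A k.
have A0 : row_vector A k = 0.
  apply: sqnorm_eq0; apply/eqP; rewrite eq_le sqnorm_ge0 andbT.
  by move: le; rewrite q0 pmulr_rle0 ?exprn_gt0.
rewrite /row_energy big1// => i _.
by rewrite inner_row_vector A0 trmx0 mulmx0 mxE expr0n.
Qed.

Definition low_energy (A : tensor R m p) k : set Omega :=
  [set w | (row_energy X A k w < n%:R * (q A k / 2))%R].

Definition high_energy (A : tensor R m p) k : set Omega :=
  [set w | (n%:R * (11 / 10 * q A k) < row_energy X A k w)%R].

Let rate_ge0 : 0 <= rate ^+ n.
Proof. by rewrite exprn_ge0// /tail_rate; lra. Qed.

Lemma low_energy_probability A k : (P (low_energy A k) <= (rate ^+ n)%:E)%E.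
Proof.
have := qform_ge0 A k; rewrite le_eqVlt => /orP[/eqP q0|q0]; last exact: (row_energy_lower_tail model q0).
rewrite (_ : low_energy A k = set0) ?measure0 ?lee_fin//.
apply/seteqP; split => // w; rewrite /low_energy /= -q0 mul0r mulr0 ltNge.
by rewrite row_energy_ge0.
Qed.

Lemma high_energy_probability A k : (P (high_energy A k) <= (rate ^+ n)%:E)%E.
Proof.
have := qform_ge0 A k; rewrite le_eqVlt => /orP[/eqP q0|q0]; last exact: (row_energy_upper_tail model q0).
rewrite (_ : high_energy A k = set0) ?measure0 ?lee_fin//.
apply/seteqP; split => // w; rewrite /high_energy /= -q0 !mulr0 energy_eq0// ?ltxx//.
Qed.

Let menergy A k : measurable_fun setT (row_energy X A k : generated (covariate_entry X) -> R).
Proof.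
by apply: measurable_sum => i; apply: measurable_funX; exact: inner_generated_measurable.
Qed.

Let mlow A k : measurable (low_energy A k : set (generated (covariate_entry X))).
Proof. exact: (measurable_lt_set (menergy A k) (measurable_cst _)). Qed.

Let mhigh A k : measurable (high_energy A k : set (generated (covariate_entry X))).
Proof. exact: (measurable_lt_set (measurable_cst _) (menergy A k)). Qed.

Let mid : measurable_fun setT (idfun : Omega -> generated (covariate_entry X)).
Proof. by apply: measurable_to_generated => j; exact: (covariate_measurable model). Qed.

Let mO (B : set Omega) : measurable (B : set (generated (covariate_entry X))) -> measurable B.
Proof. by move=> mB; have := mid measurableT mB; rewrite setTI. Qed.

Definition bad_low : set Omega :=
  \bigcup_(rk : N.-tuple small_atom * 'I_m) low_energy (\sum_(t <- rk.1) atom (val t)) rk.2.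

Definition bad_high : set Omega :=
  \bigcup_(tk : small_atom * 'I_m) high_energy (atom (val tk.1)) tk.2.

Definition good_design : set Omega := ~` (bad_low `|` bad_high).

Let mbad : measurable ((bad_low `|` bad_high) : set (generated (covariate_entry X))).
Proof.
apply: measurableU; apply: fin_bigcup_measurable => //; exact: finite_finset.
Qed.

Lemma good_design_measurable : measurable (good_design : set (generated (covariate_entry X))).
Proof. exact: measurableC. Qed.

(** A union bound over the N-tuples of atoms and the m rows. *)
Lemma good_design_probability :
  (P (~` good_design) <= (2 * m%:R * (p%:R * 2 ^+ (123 * m ^ 2)) ^+ N * rate ^+ n)%:E)%E.
Proof.
rewrite setCK.
set M : R := p%:R * _.
have M1 : 1 <= M.
  by rewrite /M -natrX -natrM ler1n muln_gt0 p_gt0 expn_gt0.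
have cardT : #|{: small_atom}|%:R <= M := small_atom_count m_gt0.
have mlowO : measurable bad_low.
  apply: mO; apply: fin_bigcup_measurable => //; exact: finite_finset.
have mhighO : measurable bad_high.
  apply: mO; apply: fin_bigcup_measurable => //; exact: finite_finset.
have Plow : (P bad_low <= (m%:R * M ^+ N * rate ^+ n)%:E)%E.
  apply: (le_trans (union_bound (fun rk => mO (mlow _ rk.2)) (fun rk => low_energy_probability _ rk.2))).
  rewrite lee_fin ler_wpM2r// card_prod card_tuple card_ord natrM natrX mulrC ler_wpM2l//.
  by apply: lerXn2r; rewrite ?nnegrE// (le_trans _ M1).
have Phigh : (P bad_high <= (m%:R * M ^+ N * rate ^+ n)%:E)%E.
  apply: (le_trans (union_bound (fun rk => mO (mhigh _ rk.2)) (fun rk => high_energy_probability _ rk.2))).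
  rewrite lee_fin ler_wpM2r// card_prod card_ord natrM mulrC ler_wpM2l//.
  by apply: (le_trans cardT); rewrite -[leLHS]expr1 ler_weXn2l.
apply: (le_trans (measureU2 _ mlowO mhighO)).
apply: (le_trans (leeD Plow Phigh)); rewrite -EFinD lee_fin.
by rewrite le_eqVlt; apply/orP; left; apply/eqP; ring.
Qed.

Let nR : 0 < n%:R :> R. Proof. by rewrite ltr0n. Qed.

Let emp_form_energy A w : emp_form (X^~ w) A A = n%:R^-1 * \sum_k row_energy X A k w.
Proof.
rewrite /emp_form exchange_big /=; congr (_ * _).
Qed.

Lemma good_design_lower w : good_design w ->
  forall r : seq ('I_p * gridmx), size r = N -> {in r, forall t, small_grid (R := R) t.2} ->
     cl ^+ 2 / 2 * frobenius (\sum_(t <- r) atom t : tensor R m p) ^+ 2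
       <= emp_form (X^~ w) (\sum_(t <- r) atom t) (\sum_(t <- r) atom t).
Proof.
move=> gw r sr small.
have rE : r = map val (pmap insub r : seq small_atom).
  rewrite (pmap_filter (insubK _)); apply/esym/all_filterP/allP => t tr.
  by rewrite /= insubT ?small.
have sr' : size (pmap insub r : seq small_atom) == N.
  by rewrite -sr [in X in _ == X]rE size_map.
have sumE : \sum_(t <- r) atom t = \sum_(t <- (pmap insub r : seq small_atom)) atom (val t) :> tensor R m p.
  by rewrite [in LHS]rE big_map.
set A := \sum_(t <- r) _ in sumE *.
have AE : A = \sum_(t <- Tuple sr') atom (val t) by [].
rewrite emp_form_energy frobenius_rows ler_pdivlMl// mulrCA mulr_sumr mulr_sumr.
apply: ler_sum => k _.
have : ~ low_energy A k w.
  by move=> low; apply: gw; left; exists (Tuple sr', k) => //; rewrite /= -AE.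
rewrite /low_energy /= => /negP; rewrite -leNgt; apply: le_trans.
rewrite mulrCA ler_pM2l// mulrAC ler_pM2r//.
by have /andP[] := row_qform_bounds model m_gt0 p_gt0 (Ordinal n_gt0) A k.
Qed.

Lemma good_design_upper w : good_design w ->
  forall t : 'I_p * gridmx, small_grid (R := R) t.2 ->
  emp_form (X^~ w) (atom t) (atom t) <= 1331 / 1000 * cu ^+ 2.
Proof.
move=> gw t ts; rewrite emp_form_energy ler_pdivrMl//.
apply: (@le_trans _ _ (\sum_k n%:R * (11 / 10 * (cu ^+ 2 * sqnorm (row_vector (atom t) k))))).
  apply: ler_sum => k _.
  have : ~ high_energy (atom t) k w.
    by move=> high; apply: gw; right; exists (exist _ t ts, k).
  rewrite /high_energy /= => /negP; rewrite -leNgt => /le_trans; apply.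
  rewrite ler_pM2l// ler_pM2l//.
  by have /andP[] := row_qform_bounds model m_gt0 p_gt0 (Ordinal n_gt0) (atom t) k.
rewrite -!mulr_sumr -frobenius_rows ler_pM2l//.
have := frobenius_atom ts; have : 0 <= cu ^+ 2 by exact: sqr_ge0.
nra.
Qed.

End GoodDesign.

(** * The noise event *)

Section NoiseEvent.
Context {R : realType} {d : measure_display} {Omega : measurableType d}.
Variables (P : probability Omega R) (n m p : nat) (cl cu sigma : R).
Variables (S : 'M[R]_(p * m)).
Variables (X : 'I_n -> Omega -> 'M[R]_(m, p)) (eps : 'I_n -> Omega -> 'cV[R]_m).
Hypothesis model : regression_model P cl cu sigma S X eps.
Hypotheses (n_gt0 : (0 < n)%N) (m_gt0 : (0 < m)%N) (p_gt0 : (0 < p)%N).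
Hypotheses (cu_gt0 : 0 < cu) (sigma_gt0 : 0 < sigma).
Variable N : nat.
Local Notation good := (good_design S X N).
Local Notation L := (1331 / 1000 * cu ^+ 2).

(** n times an entry of [noise_matrix]. *)
Definition noise_coordinate (j : 'I_p) (kl : 'I_m * 'I_m) (w : Omega) : R :=
  \sum_i eps i w kl.1 0 * X i w kl.2 j.

Let nR : 0 < n%:R :> R. Proof. by rewrite ltr0n. Qed.

Let mX ilj : measurable_fun setT (covariate_entry X ilj).
Proof. exact: (covariate_measurable model). Qed.

Let me ik : measurable_fun setT (noise_entry eps ik).
Proof. by have [] := noise_law model ik. Qed.

Lemma noise_coordinate_measurable j kl : measurable_fun setT (noise_coordinate j kl).
Proof.
apply: measurable_sum => i; apply: measurable_funM; first exact: (me (i, kl.1)).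
exact: (mX (i, kl.2, j)).
Qed.

Lemma good_design_event : measurable good.
Proof.
have mid : measurable_fun setT (idfun : Omega -> generated (covariate_entry X)).
  exact: measurable_to_generated.
by have := mid measurableT _ (good_design_measurable S (X := X) N); rewrite setTI.
Qed.

Lemma noise_linear_form (U : 'M[R]_m) j w :
  \sum_kl U kl.1 kl.2 * noise_coordinate j kl w =
  \sum_ik noise_entry eps ik w * inner (slice j U) (X ik.1 w) ik.2 0.
Proof.
transitivity (\sum_k \sum_l \sum_i U k l * (eps i w k 0 * X i w l j)).
  rewrite pair_bigA /=; apply: eq_bigr => -[k l] _.
  by rewrite mulr_sumr.
transitivity (\sum_i \sum_k \sum_l U k l * (eps i w k 0 * X i w l j)).
  rewrite [RHS]exchange_big /=; apply: eq_bigr => k _; exact: exchange_big.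
rewrite pair_bigA /=; apply: eq_bigr => -[i k] _ /=.
rewrite mxE (bigD1 j)//= [X in _ = _ * (_ + X)]big1 ?addr0; last first.
  by move=> j' /negbTE j'j; apply: big1 => l _; rewrite ffunE j'j mxE mulr0.
rewrite mulr_sumr; apply: eq_bigr => l _; rewrite ffunE eqxx /noise_entry /=.
by ring.
Qed.

(** Given X, the linear form is Gaussian with variance sigma^2 n |U|_n^2, U having slice j
equal to g and the others zero; on the design event this is at most
sigma^2 n L |g|^2. *)
Lemma noise_mgf j (g : 'I_m * 'I_m -> R) :
  (\int[P]_w (expR (\sum_kl g kl * noise_coordinate j kl w) * \1_good w)%:E
     <= (1 * expR (sigma ^+ 2 * n%:R * L / 2 * \sum_kl g kl ^+ 2))%:E)%E.
Proof.
pose U : 'M[R]_m := \matrix_(k, l) g (k, l).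
have gE kl : g kl = U kl.1 kl.2 by rewrite mxE; case: kl.
pose h (ik : 'I_n * 'I_m) w := inner (slice j U) (X ik.1 w) ik.2 0.
pose h' ik w := sigma ^+ 2 * h ik w.
pose f w := \1_good w * expR (sigma ^+ 2 / 2 * \sum_ik h ik w ^+ 2).
have mh ik : measurable_fun setT (h ik : generated (covariate_entry X) -> R).
  exact: inner_generated_measurable.
have mh' ik : measurable_fun setT (h' ik : generated (covariate_entry X) -> R).
  by apply: measurable_funM.
have mf : measurable_fun setT (f : generated (covariate_entry X) -> R).
  apply: measurable_funM.
    by apply: measurable_indic; exact: good_design_measurable.
  apply: measurableT_comp => //; apply: measurable_funM => //.
  by apply: measurable_sum => ik; apply: measurable_funX.
have f0 w : 0 <= f w by rewrite mulr_ge0 ?expR_ge0// indicE.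
have sigma_neq0 : sigma != 0 by rewrite gt_eqF.
have -> : (\int[P]_w (expR (\sum_kl g kl * noise_coordinate j kl w) * \1_good w)%:E
    = \int[P]_w (f w)%:E)%E.
  rewrite -(integral_likelihood_ratio mX sigma_neq0 (noise_independent model)
     (noise_law model) (noise_covariate_independent model) mh' mf f0).
  apply: eq_integral => w _; congr EFin.
  rewrite /f -[RHS]mulrA -expRD mulrC; congr (_ * expR _).
  under eq_bigr do rewrite gE.
  rewrite noise_linear_form /log_likelihood_ratio.
  rewrite mulr_sumr mulr_suml -big_split /=; apply: eq_bigr => ik _.
  rewrite /h' -/(h ik w); move: (noise_entry _ _ _) (h ik w) => a b.
  by field.
have mfO : measurable_fun setT f.
  exact: (measurableT_comp mf (measurable_to_generated mX)).
rewrite mul1r -(integral_real_cst P (expR _)); apply: ge0_le_integral_real => //.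
move=> w; rewrite /f indicE; have [/set_mem Gw|_] := boolP (w \in good); last by rewrite mul0r expR_ge0.
rewrite mul1r ler_expR.
have -> : \sum_ik h ik w ^+ 2 = n%:R * emp_form (X^~ w) (slice j U) (slice j U).
  rewrite /emp_form mulrA divff ?mul1r ?gt_eqF// pair_bigA.
  by apply: eq_bigr => ik _; rewrite expr2.
have le := slice_upper_bound m_gt0 j U (good_design_upper model n_gt0 m_gt0 p_gt0 Gw).
rewrite frobenius_mx_sqr pair_bigA /= in le.
have -> : \sum_kl g kl ^+ 2 = \sum_kl U kl.1 kl.2 ^+ 2 by apply: eq_bigr => kl _; rewrite gE.
have -> : sigma ^+ 2 * n%:R * L / 2 * \sum_kl U kl.1 kl.2 ^+ 2 =
   sigma ^+ 2 / 2 * (n%:R * (L * \sum_kl U kl.1 kl.2 ^+ 2)).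
  by move: (\sum_kl _) => z; field.
by rewrite ler_pM2l ?divr_gt0 ?exprn_gt0// ler_pM2l.
Qed.

Let beta := sigma ^+ 2 * n%:R * L.
Let beta_gt0 : 0 < beta.
Proof.
have cu2 : 0 < cu ^+ 2 by rewrite exprn_gt0.
have L0 : 0 < L by lra.
by apply: mulr_gt0 => //; apply: mulr_gt0; rewrite ?exprn_gt0.
Qed.

(** The constant 3 / (8 beta) makes 1 - 2 t beta equal to 1/4, so that each of the m^2
coordinates costs a factor 2. *)
Lemma noise_exp_sqr j :
  (\int[P]_w (expR (3 / (8 * beta) * \sum_kl noise_coordinate j kl w ^+ 2) * \1_good w)%:E
     <= (2 ^+ (m ^ 2))%:E)%E.
Proof.
have t0 : 0 < 3 / (8 * beta) by rewrite divr_gt0// mulr_gt0.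
have tb : 2 * (3 / (8 * beta)) * beta = 3 / 4 by field; rewrite gt_eqF.
have tb1 : 2 * (3 / (8 * beta)) * beta < 1 by rewrite tb; lra.
have mind : measurable_fun setT (\1_good : Omega -> R).
  by apply: measurable_indic; exact: good_design_event.
have ind0 w : 0 <= \1_good w :> R by rewrite indicE.
have := subgaussian_exp_sum_sqr (noise_coordinate_measurable j) t0 tb1
  (index_enum_uniq _) mind ind0 ler01 (noise_mgf j).
move/le_trans; apply; rewrite mul1r tb.
have -> : 1 - 3 / 4 = 2^-1 ^+ 2 :> R by field.
rewrite sqrtr_sqr ger0_norm ?invr_ge0// invrK.
rewrite [size _](_ : _ = (m ^ 2)%N); first exact: lexx.
by rewrite -sum1_size sum_nat_const muln1 card_prod card_ord.
Qed.

Definition large_noise (r : R) (j : 'I_p) : set Omega :=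
  [set w | (r < frobenius_mx (noise_matrix (X^~ w) (eps^~ w) j))%R].

Let noise_matrix_sqr j w :
  frobenius_mx (noise_matrix (X^~ w) (eps^~ w) j) ^+ 2 =
   n%:R^-1 ^+ 2 * \sum_kl noise_coordinate j kl w ^+ 2.
Proof.
rewrite frobenius_mx_sqr pair_bigA mulr_sumr; apply: eq_bigr => -[k l] _ /=.
by rewrite mxE exprMn.
Qed.

Lemma large_noise_measurable r j : measurable (large_noise r j).
Proof.
apply: measurable_lt_set => //.
rewrite [F in measurable_fun _ F](_ : _ =
    (fun w => Num.sqrt (n%:R^-1 ^+ 2 * \sum_kl noise_coordinate j kl w ^+ 2))); last first.
  by apply/funext => w; rewrite -noise_matrix_sqr sqrtr_sqr ger0_norm ?frobenius_mx_ge0.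
apply: measurableT_comp; first by apply: continuous_measurable_fun; exact: sqrt_continuous.
apply: measurable_funM => //; apply: measurable_sum => kl; apply: measurable_funX.
exact: noise_coordinate_measurable.
Qed.

Lemma large_noise_probability r j : 0 <= r ->
  (P (good `&` large_noise r j) <=
     (expR (- (3 / (8 * beta) * (r * n%:R) ^+ 2)) * 2 ^+ (m ^ 2))%:E)%E.
Proof.
move=> r0.
have mG := good_design_event.
have mGL : measurable (good `&` large_noise r j).
  by apply: measurableI => //; exact: large_noise_measurable.
have mind : measurable_fun setT (\1_good : Omega -> R) by exact: measurable_indic.
set t := 3 / (8 * beta).
have t0 : 0 < t by rewrite divr_gt0// mulr_gt0.
pose F w := expR (t * \sum_kl noise_coordinate j kl w ^+ 2) * \1_good w.
have mF : measurable_fun setT F.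
  apply: measurable_funM => //; apply: measurableT_comp => //; apply: measurable_funM => //.
  by apply: measurable_sum => kl; apply: measurable_funX; exact: noise_coordinate_measurable.
have F0 w : 0 <= F w by rewrite mulr_ge0 ?expR_ge0// indicE.
pose c := expR (- (t * (r * n%:R) ^+ 2)).
have c0 : 0 <= c by exact: expR_ge0.
apply: (le_trans (probability_le_integral (g := fun w => c * F w) P mGL _ _ _)).
- exact: measurable_funM.
- by move=> w; rewrite mulr_ge0.
- move=> w [Gw large]; rewrite /F indicE mem_set// mulr1 /c -expRD -[leLHS]expR0 ler_expR.
  rewrite addrC subr_ge0 ler_pM2l//.
  have : r ^+ 2 <= frobenius_mx (noise_matrix (X^~ w) (eps^~ w) j) ^+ 2.
    by rewrite ler_pXn2r ?nnegrE ?frobenius_mx_ge0// ltW.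
  by rewrite noise_matrix_sqr exprMn exprVn mulrC ler_pdivlMr ?exprn_gt0.
rewrite ge0_integral_realZ//.
rewrite EFinM lee_wpmul2l ?lee_fin//; exact: noise_exp_sqr.
Qed.

End NoiseEvent.

(** * Finite-sample error bound *)

Section Exponents.
Context {R : realType}.
Implicit Types (x : R) (n : nat).

Lemma two_le_exp : 2 <= expR (3 / 4) :> R.
Proof.
have -> : 3 / 4 = 8%:R * (3 / 32) :> R by field.
rewrite expRM_natl.
have h : (35 / 32) ^+ 8 <= expR (3 / 32) ^+ 8 :> R.
  apply: lerXn2r; rewrite ?nnegrE ?expR_ge0//.
  by apply: le_trans (expR_ge1Dx _); lra.
by apply: le_trans h; lra.
Qed.

Lemma two_power_le_exp n : 2 ^+ n <= expR (3 / 4 * n%:R) :> R.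
Proof.
rewrite mulrC expRM_natl; apply: lerXn2r; rewrite ?nnegrE ?expR_ge0//.
exact: two_le_exp.
Qed.

Lemma tail_rate_le_exp n : tail_rate (R := R) ^+ n <= expR (- (n%:R / 2000)).
Proof.
have rate0 : 0 <= tail_rate (R := R) by rewrite /tail_rate; lra.
have rate_le : tail_rate (R := R) <= expR (- 2000^-1).
  by apply: le_trans (expR_ge1Dx _); rewrite /tail_rate; lra.
move: tail_rate rate0 rate_le => r r0 re.
have -> : expR (- (n%:R / 2000)) = expR (- 2000^-1) ^+ n :> R.
  by rewrite -expRM_natl mulrN.
move: (expR _) re => e re.
by apply: lerXn2r => //; rewrite nnegrE// (le_trans r0).
Qed.

Lemma failure_sum x : 1 <= x ->
  expR (- (3 / 10 * x)) + expR (- (10 * x)) <= expR (- (1 / 10 * x)).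
Proof.
move=> x1.
have expN_le (y c : R) : 0 <= c -> 1 <= c * (1 + y) -> expR (- y) <= c.
  move=> c0 h; rewrite expRN -div1r ler_pdivrMr ?expR_gt0// (le_trans h)//.
  by rewrite ler_wpM2l// expR_ge1Dx.
have e1 : expR (- (1 / 5 * x)) <= 5 / 6 by apply: expN_le; lra.
have e2 : expR (- (99 / 10 * x)) <= 1 / 10 by apply: expN_le; lra.
have -> : - (3 / 10 * x) = - (1 / 10 * x) + - (1 / 5 * x) by field.
have -> : - (10 * x) = - (1 / 10 * x) + - (99 / 10 * x) by field.
rewrite !expRD -mulrDr -[leRHS]mulr1 ler_pM2l ?expR_gt0//; lra.
Qed.

Lemma penalty_sqr_ge (z sigma cu lambda : R) : 0 <= z -> 0 < sigma -> 0 < cu ->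
  3 * sigma * cu * Num.sqrt z <= lambda -> 9 * sigma ^+ 2 * cu ^+ 2 * z <= lambda ^+ 2.
Proof.
move=> z0 sigma_gt0 cu_gt0 lambda_ge.
have -> : 9 * sigma ^+ 2 * cu ^+ 2 * z = (3 * sigma * cu * Num.sqrt z) ^+ 2.
  by rewrite exprMn (sqr_sqrtr z0); ring.
have l0 : 0 <= 3 * sigma * cu * Num.sqrt z by rewrite !mulr_ge0 ?sqrtr_ge0// ltW.
by rewrite ler_pXn2r// nnegrE (le_trans l0).
Qed.

End Exponents.

Section FiniteSample.
Context {R : realType} {d : measure_display} {Omega : measurableType d}.
Variables (P : probability Omega R) (n m p s : nat) (cl cu sigma lambda : R).
Variables (S : 'M[R]_(p * m)).
Variables (X : 'I_n -> Omega -> 'M[R]_(m, p)) (eps : 'I_n -> Omega -> 'cV[R]_m).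
Hypothesis model : regression_model P cl cu sigma S X eps.
Hypotheses (n_gt0 : (0 < n)%N) (m_gt0 : (0 < m)%N) (s_gt0 : (0 < s)%N) (s_le_p : (s <= p)%N).
Hypotheses (cl_gt0 : 0 < cl) (cu_gt0 : 0 < cu) (sigma_gt0 : 0 < sigma).
(** M2 is the quantity max(m^2, ln p) of the penalty level; exp(M2) bounds p, m, and the
logarithm of the number of atoms is at most 124 M2. *)
Let M2 : R := Num.max (m%:R ^+ 2) (ln p%:R).
Hypothesis lambda_ge : 3 * sigma * cu * Num.sqrt (M2 / n%:R) <= lambda.
Variable K : nat.
Local Notation L := (1331 / 1000 * cu ^+ 2).
Hypothesis K_large : 800 * L <= cl ^+ 2 / 2 * K%:R.
Hypothesis n_large : 136 * (K%:R + 1) * s%:R * M2 * 2000 <= n%:R.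
Let N := (K * s).+1.
Local Notation good := (good_design S X N).
Local Notation large := (large_noise X eps (9 / 10 * lambda)).

Let p_gt0 : (0 < p)%N. Proof. exact: leq_trans s_le_p. Qed.
Let nR : 0 < n%:R :> R. Proof. by rewrite ltr0n. Qed.
Let cu2 : 0 < cu ^+ 2. Proof. by rewrite exprn_gt0. Qed.
Let cl2 : 0 < cl ^+ 2. Proof. by rewrite exprn_gt0. Qed.
Let L_gt0 : 0 < L. Proof. by have := cu2; lra. Qed.
Let K_gt0 : (0 < K)%N.
Proof.
rewrite -(ltr0n R) ltNge; apply/negP => K0.
have : cl ^+ 2 / 2 * K%:R <= 0 by rewrite pmulr_rle0// divr_gt0.
by have := L_gt0; move: K_large; lra.
Qed.

Let m2_le : (m ^ 2)%:R <= M2. Proof. by rewrite natrX le_max lexx. Qed.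
Let lnp_le : ln p%:R <= M2. Proof. by rewrite le_max lexx orbT. Qed.
Let M2_ge1 : 1 <= M2.
Proof. by apply: le_trans m2_le; rewrite ler1n expn_gt0 m_gt0. Qed.
Let p_le : p%:R <= expR M2.
Proof. by rewrite -[leLHS]lnK ?posrE ?ltr0n// ler_expR. Qed.

Let lambda_sqr : 9 * sigma ^+ 2 * cu ^+ 2 * (M2 / n%:R) <= lambda ^+ 2.
Proof. by apply: penalty_sqr_ge => //; rewrite divr_ge0// (le_trans ler01 M2_ge1). Qed.

Lemma lambda_gt0 : 0 < lambda.
Proof.
apply: lt_le_trans lambda_ge; rewrite !mulr_gt0// sqrtr_gt0 divr_gt0//.
exact: lt_le_trans M2_ge1.
Qed.

(** The Chernoff exponent is at least 41/20 M2. Of this 3/4 M2 is lost to the dimension,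
by 2 <= exp(3/4), and M2 to the union over the slices. *)
Lemma noise_failure : (P (\bigcup_j (good `&` large j)) <= (expR (- (3 / 10 * M2)))%:E)%E.
Proof.
have l0 : 0 <= 9 / 10 * lambda by rewrite mulr_ge0// ltW// lambda_gt0.
have mGL j : measurable (good `&` large j).
  by apply: measurableI; [exact: good_design_event model _ | exact: (large_noise_measurable model)].
have one j : (P (good `&` large j) <= (expR (- (13 / 10 * M2)))%:E)%E.
  apply: (le_trans (large_noise_probability model n_gt0 m_gt0 p_gt0 cu_gt0 sigma_gt0 N j l0)).
  rewrite lee_fin; apply: (@le_trans _ _ (expR (- (41 / 20 * M2)) * expR (3 / 4 * (m ^ 2)%:R))).
    apply: ler_pM; rewrite ?expR_ge0 ?exprn_ge0 ?two_power_le_exp//.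
    rewrite ler_expR lerN2.
    have -> : 3 / (8 * (sigma ^+ 2 * n%:R * L)) * (9 / 10 * lambda * n%:R) ^+ 2 =
       243 * 10 / (8 * 1331) * (n%:R / (sigma ^+ 2 * cu ^+ 2)) * lambda ^+ 2.
      by field; rewrite !gt_eqF.
    have k0 : 0 < 243 * 10 / (8 * 1331) :> R by lra.
    have c0 : 0 < 243 * 10 / (8 * 1331) * (n%:R / (sigma ^+ 2 * cu ^+ 2)).
      by apply: mulr_gt0 => //; apply: divr_gt0 => //; apply: mulr_gt0; rewrite ?exprn_gt0.
    apply: le_trans (ler_wpM2l (ltW c0) lambda_sqr).
    have -> : 243 * 10 / (8 * 1331) * (n%:R / (sigma ^+ 2 * cu ^+ 2)) *
      (9 * sigma ^+ 2 * cu ^+ 2 * (M2 / n%:R)) = 243 * 90 / (8 * 1331) * M2.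
      by field; rewrite !gt_eqF.
    by have := M2_ge1; lra.
  by rewrite -expRD ler_expR; move: m2_le; lra.
apply: (le_trans (union_bound mGL one)); rewrite card_ord lee_fin.
apply: (@le_trans _ _ (expR M2 * expR (- (13 / 10 * M2)))); first by rewrite ler_wpM2r ?expR_ge0.
by rewrite -expRD ler_expR; lra.
Qed.

(** The union bound costs at most exp((2 + 124 N) M2), and N M2 is small compared with n. *)
Lemma design_failure : (P (~` good) <= (expR (- (10 * M2)))%:E)%E.
Proof.
apply: (le_trans (good_design_probability model n_gt0 m_gt0 p_gt0 cl_gt0 (ltn0Sn _))).
rewrite lee_fin -/N.
have M0 : 0 <= M2 by exact: le_trans M2_ge1.
have two_le : 2 <= expR M2.
  by apply: le_trans two_le_exp _; rewrite ler_expR; have := M2_ge1; lra.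
have m_le : m%:R <= expR M2.
  apply: (@le_trans _ _ M2); last by rewrite (le_trans _ (expR_ge1Dx _))// lerDr.
  by apply: le_trans m2_le; rewrite ler_nat -[leqLHS]expn1 leq_pexp2l.
have grid_le : p%:R * 2 ^+ (123 * m ^ 2) <= expR (124 * M2).
  have -> : 124 * M2 = M2 + 123 * M2 by ring.
  rewrite expRD; apply: ler_pM => //; apply: le_trans (two_power_le_exp _) _.
  by rewrite ler_expR natrM; move: m2_le M0; lra.
have -> : - (10 * M2) = (M2 + M2 + N%:R * (124 * M2)) + - (10 * M2 + (M2 + M2 + N%:R * (124 * M2))) by ring.
rewrite expRD; apply: ler_pM.
- by rewrite !mulr_ge0 ?exprn_ge0 ?mulr_ge0.
- by rewrite exprn_ge0// /tail_rate; lra.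
- rewrite !expRD expRM_natl; apply: ler_pM; rewrite ?exprn_ge0 ?mulr_ge0//.
    by apply: ler_pM.
  by apply: lerXn2r; rewrite ?nnegrE ?expR_ge0 ?mulr_ge0.
apply: le_trans (tail_rate_le_exp _) _; rewrite ler_expR lerN2.
have k0 : 0 < 2000 :> R by lra.
rewrite (ler_pdivlMr _ _ k0); apply: le_trans n_large; rewrite (ler_pM2r k0).
have NE : N%:R = K%:R * s%:R + 1 :> R by rewrite /N -natr1 natrM.
have s1 : 1 <= s%:R :> R by rewrite ler1n.
have K0 : 0 <= K%:R :> R by [].
have -> : 10 * M2 + (M2 + M2 + N%:R * (124 * M2)) = (136 + 124 * (K%:R * s%:R)) * M2.
  by rewrite NE; ring.
apply: ler_wpM2r => //; nra.
Qed.

Variables (T : tensor R m p) (That : Omega -> tensor R m p).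
Hypothesis sparseT : sparse_class s T.
Hypothesis minimal : forall w, is_minimizer
  (objective lambda (X^~ w) (fun i => response T X eps i w)) (That w).

Lemma oracle_event w : good w -> (forall j, ~ large j w) ->
  frobenius (That w - T) ^+ 2 <= 58 * s%:R * lambda ^+ 2 / (cl ^+ 2 / 2) ^+ 2 /\
  emp_norm (X^~ w) (That w - T) ^+ 2 <= 29 * s%:R * lambda ^+ 2 / (cl ^+ 2 / 2).
Proof.
move=> Gw small; rewrite emp_norm_sqr.
have c0 : 0 < cl ^+ 2 / 2 by rewrite divr_gt0.
have noise j : frobenius_mx (noise_matrix (X^~ w) (eps^~ w) j) <= 9 / 10 * lambda.
  by rewrite leNgt; apply/negP; exact: small.
have N1 : (1 < N)%N by rewrite /N ltnS muln_gt0 K_gt0.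
have RE A := restricted_lower_bound m_gt0 A (ltW c0) N1
  (good_design_lower model n_gt0 m_gt0 p_gt0 Gw) (good_design_upper model n_gt0 m_gt0 p_gt0 Gw).
have NE : N%:R - 1 = K%:R * s%:R :> R by rewrite /N -natr1 natrM addrK.
apply: (oracle_inequality n_gt0 lambda_gt0 sparseT (minimal w) noise c0 (ltW L_gt0) _ RE).
  by rewrite NE mulr_gt0// ltr0n.
by rewrite NE mulrA; apply: ler_wpM2r.
Qed.

(** exp(- 3/10 M2) + exp(- 10 M2) <= exp(- M2 / 10) <= p^(-1/10), since M2 >= 1. *)
Lemma oracle_probability :
  prob_at_least P (1 - p%:R `^ (- (1 / 10)))
    [set w | Num.max (emp_norm (X^~ w) (That w - T) ^+ 2) (frobenius (That w - T) ^+ 2)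
       <= (232 / cl ^+ 2 + 58) / cu ^+ 2 * cu ^+ 2 / cl ^+ 2 * s%:R * lambda ^+ 2].
Proof.
have mG := good_design_event model N.
have mB : measurable (\bigcup_j (good `&` large j)).
  apply: fin_bigcup_measurable; first exact: finite_finset.
  by move=> j _; apply: measurableI => //; exact: (large_noise_measurable model).
pose bad := ~` good `|` \bigcup_j (good `&` large j).
have mbad : measurable bad by apply: measurableU => //; exact: measurableC.
exists (~` bad); split; first exact: measurableC.
  rewrite probability_setC// EFinB; apply: leeB => //.
  apply: (le_trans (measureU2 _ (measurableC mG) mB)).
  apply: (le_trans (leeD design_failure noise_failure)); rewrite -EFinD lee_fin addrC.
  apply: (le_trans (failure_sum M2_ge1)).
  rewrite /powR pnatr_eq0 gtn_eqF// ler_expR mulNr lerN2.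
  by apply: ler_wpM2l.
move=> w; rewrite /bad setCU setCK => -[Gw nlarge].
have small j : ~ large j w by move=> lj; apply: nlarge; exists j.
have [F E] := oracle_event Gw small.
have s0 : 0 <= s%:R * lambda ^+ 2 by rewrite mulr_ge0// sqr_ge0.
rewrite /= ge_max; apply/andP; split.
- apply: le_trans E _; rewrite -subr_ge0.
  have -> : (232 / cl ^+ 2 + 58) / cu ^+ 2 * cu ^+ 2 / cl ^+ 2 * s%:R * lambda ^+ 2
     - 29 * s%:R * lambda ^+ 2 / (cl ^+ 2 / 2) = 232 / cl ^+ 2 ^+ 2 * (s%:R * lambda ^+ 2).
    by field; rewrite !gt_eqF.
  have k0 : 0 <= 232 :> R by lra.
  by apply: mulr_ge0 => //; apply: divr_ge0 => //; rewrite exprn_ge0// (ltW cl2).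
- apply: le_trans F _; rewrite -subr_ge0.
  have -> : (232 / cl ^+ 2 + 58) / cu ^+ 2 * cu ^+ 2 / cl ^+ 2 * s%:R * lambda ^+ 2
     - 58 * s%:R * lambda ^+ 2 / (cl ^+ 2 / 2) ^+ 2 = 58 / cl ^+ 2 * (s%:R * lambda ^+ 2).
    by field; rewrite !gt_eqF.
  have k0 : 0 <= 58 :> R by lra.
  by apply: mulr_ge0 => //; apply: divr_ge0 => //; exact: ltW.
Qed.

End FiniteSample.

(** * Both bounds *)

Section SampleSize.
Context {R : realType}.

(** The lower bound on lambda turns s lambda^2 -> 0 into s max(m^2, ln p) / n -> 0. *)
Lemma sample_size_large (n s K : nat) (sigma cu lambda M : R) :
  (0 < n)%N -> 0 < sigma -> 0 < cu -> 0 <= M ->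
  3 * sigma * cu * Num.sqrt (M / n%:R) <= lambda ->
  (Num.sqrt s%:R * lambda) ^+ 2 <= 9 * sigma ^+ 2 * cu ^+ 2 / (136 * (K%:R + 1) * 2000) ->
  136 * (K%:R + 1) * s%:R * M * 2000 <= n%:R.
Proof.
move=> n_gt0 sigma_gt0 cu_gt0 M0 lambda_ge small.
have nR : 0 < n%:R :> R by rewrite ltr0n.
have z0 : 0 <= M / n%:R by rewrite divr_ge0// ltW.
have K0 : 0 <= K%:R :> R by [].
have scale_gt0 : 0 < 136 * (K%:R + 1) * 2000 :> R by lra.
have sc2 : 0 < sigma ^+ 2 * cu ^+ 2 by apply: mulr_gt0; rewrite ?exprn_gt0.
have sc0 : 0 < 9 * sigma ^+ 2 * cu ^+ 2 by rewrite -mulrA; lra.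
have lambda2 : 9 * sigma ^+ 2 * cu ^+ 2 * (M / n%:R) <= lambda ^+ 2 by exact: penalty_sqr_ge.
rewrite exprMn sqr_sqrtr ?ler0n// (ler_pdivlMr _ _ scale_gt0) in small.
have : s%:R * (9 * sigma ^+ 2 * cu ^+ 2 * (M / n%:R)) * (136 * (K%:R + 1) * 2000)
    <= 9 * sigma ^+ 2 * cu ^+ 2.
  apply: le_trans small; rewrite (ler_pM2r scale_gt0); exact: ler_wpM2l.
have -> : s%:R * (9 * sigma ^+ 2 * cu ^+ 2 * (M / n%:R)) * (136 * (K%:R + 1) * 2000) =
   9 * sigma ^+ 2 * cu ^+ 2 * ((136 * (K%:R + 1) * s%:R * M * 2000) / n%:R).
  by field; rewrite gt_eqF.
by rewrite -[leRHS]mulr1 (ler_pM2l sc0) (ler_pdivrMr _ _ nR) mul1r.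
Qed.

End SampleSize.

Theorem theorem2 (R : realType) :
  (exists2 c1 : R, 0 < c1 &
   forall cl cu : R, 0 < cl -> cl <= cu ->
   exists2 c2 : R, 0 < c2 &
   forall (sigma : R) (m p s : nat -> nat) (lambda : nat -> R),
   0 < sigma ->
   (forall n, (0 < m n)%N) ->
   (forall n, (0 < s n <= p n)%N) ->
   (forall n, (0 < n)%N ->
     3 * sigma * cu *
       Num.sqrt (Num.max ((m n)%:R ^+ 2) (ln (p n)%:R) / n%:R) <= lambda n) ->
   (fun n => Num.sqrt (s n)%:R * lambda n) @ \oo --> (0 : R) ->
   \forall n \near \oo,
     forall (d : measure_display) (Omega : measurableType d)
       (P : probability Omega R) (S : 'M[R]_(p n * m n))
       (X : 'I_n -> Omega -> 'M[R]_(m n, p n)) (eps : 'I_n -> Omega -> 'cV[R]_(m n))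
       (T : tensor R (m n) (p n)) (That : Omega -> tensor R (m n) (p n)),
     regression_model P cl cu sigma S X eps ->
     sparse_class (s n) T ->
     (forall w, is_minimizer
        (objective (lambda n) (fun i => X i w) (fun i => response T X eps i w))
        (That w)) ->
     prob_at_least P (1 - (p n)%:R `^ (- c1))
       [set w | Num.max (emp_norm (fun i => X i w) (That w - T) ^+ 2)
                        (frobenius (That w - T) ^+ 2)
                <= c2 * cu ^+ 2 / cl ^+ 2 * (s n)%:R * lambda n ^+ 2]) /\
  (exists2 c3 : R, 0 < c3 &
   forall (cl cu sigma : R) (n m p s : nat),
   0 < cl -> cl <= cu -> 0 < sigma ->
   (0 < n)%N -> (0 < m)%N -> (0 < s <= p)%N ->
   forall (d : measure_display) (Omega : measurableType d)
     (P : probability Omega R) (S : 'M[R]_(p * m))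
     (X : 'I_n -> Omega -> 'M[R]_(m, p)) (eps : 'I_n -> Omega -> 'cV[R]_m)
     (Ttilde : dataset R n m p -> tensor R m p),
   regression_model P cl cu sigma S X eps ->
   is_estimator Ttilde ->
   ((2^-1)%:E <= ereal_sup
      [set data_law P X eps T
         [set D | (c3 * sigma ^+ 2 * s%:R * Num.max (m%:R ^+ 2) (ln (p%:R / s%:R))
                    / (cu ^+ 2 * n%:R)
                  <= frobenius (Ttilde D - T) ^+ 2)%R]
      | T in sparse_class s])%E).
Proof.
split.
- exists (1 / 10); first by rewrite divr_gt0.
  move=> cl cu cl_gt0 cl_le_cu.
  have cu_gt0 : 0 < cu by exact: lt_le_trans cl_le_cu.
  have cl2 : 0 < cl ^+ 2 by rewrite exprn_gt0.
  have cu2 : 0 < cu ^+ 2 by rewrite exprn_gt0.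
  (* 58 / c^2 and 29 / c for c = cl^2 / 2, times cl^2, are 232 / cl^2 and 58. *)
  exists ((232 / cl ^+ 2 + 58) / cu ^+ 2).
    have icl2 : 0 < (cl ^+ 2)^-1 by rewrite invr_gt0.
    by apply: divr_gt0 => //; lra.
  move=> sigma m p s lambda sigma_gt0 m_gt0 s_p lambda_ge lambda_cvg.
  (* For sums of N = K s + 1 atoms, the condition 800 L s <= c (N - 1) of
     [oracle_inequality] with L = 1331/1000 cu^2 and c = cl^2 / 2 is ratio <= K. *)
  pose ratio := 800 * (1331 / 1000 * cu ^+ 2) / (cl ^+ 2 / 2).
  have ratio0 : 0 <= ratio.
    by apply: divr_ge0; lra.
  pose K := Num.bound ratio.
  have K_large : 800 * (1331 / 1000 * cu ^+ 2) <= cl ^+ 2 / 2 * K%:R.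
    have c0 : 0 < cl ^+ 2 / 2 by lra.
    by rewrite [leRHS]mulrC -(ler_pdivrMr _ _ c0); apply: ltW; exact: archi_boundP.
  pose eta := 9 * sigma ^+ 2 * cu ^+ 2 / (136 * (K%:R + 1) * 2000).
  have K0 : 0 <= K%:R :> R by [].
  have scale_gt0 : 0 < 136 * (K%:R + 1) * 2000 :> R by lra.
  have eta_gt0 : 0 < eta.
    have sc2 : 0 < sigma ^+ 2 * cu ^+ 2 by apply: mulr_gt0; rewrite ?exprn_gt0.
    by apply: divr_gt0 => //; rewrite -mulrA; lra.
  have seta : 0 < Num.sqrt eta by rewrite sqrtr_gt0.
  move/cvgrPdist_lt: lambda_cvg => /(_ _ seta) near_small.
  near=> n.
  have n_gt0 : (0 < n)%N by near: n; exact: nbhs_infty_gt.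
  have small : (Num.sqrt (s n)%:R * lambda n) ^+ 2 <= eta.
    have : `|0 - Num.sqrt (s n)%:R * lambda n| < Num.sqrt eta by near: n.
    rewrite sub0r normrN => lt; rewrite -real_normK ?num_real//.
    rewrite -[leRHS](sqr_sqrtr (ltW eta_gt0)); apply: lerXn2r; rewrite ?nnegrE//.
    exact: ltW.
  move=> d Omega P S X eps T That model sparseT minimal.
  have /andP[s_gt0 s_le_p] := s_p n.
  have M0 : 0 <= Num.max ((m n)%:R ^+ 2) (ln (p n)%:R) :> R by rewrite le_max sqr_ge0.
  have n_large := sample_size_large n_gt0 sigma_gt0 cu_gt0 M0 (lambda_ge n n_gt0) small.
  exact: (oracle_probability model n_gt0 (m_gt0 n) s_gt0 s_le_p cl_gt0 cu_gt0 sigma_gt0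
    (lambda_ge n n_gt0) K_large n_large sparseT minimal).
- exists (2 ^+ 51)^-1; first by rewrite invr_gt0 exprn_gt0.
  move=> cl cu sigma n m p s cl_gt0 cl_le_cu sigma_gt0 n_gt0 m_gt0 /andP[s_gt0 s_le_p].
  move=> d Omega P S X eps Ttilde model estT.
  have cu_gt0 : 0 < cu by exact: lt_le_trans cl_le_cu.
  exact: (minimax_lower_bound model n_gt0 m_gt0 s_gt0 s_le_p cu_gt0 sigma_gt0 estT).
Unshelve. all: by end_near.
Qed.
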